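(* There exist universal constants $c_1,c_2,c_3,c_4,c_5>0$ such that the following holds. Let $(T(t))_{t\ge0}$ be a strongly continuous semigroup on a Banach space $X$ with $\|T(t)\|\le M$ for all $t\ge0$, for some $M\ge1$. Suppose in addition that there exists $0<\varepsilon\le2$ such that $$\|T(t)-I\|\le2-\varepsilon\qquad\text{for all }t>0.$$ Put $\widetilde{C}=\frac{M^2}{\varepsilon}>0$. Then $(T(t))$ can be extended to a bounded holomorphic semigroup in a sector $\Sigma_\theta$ with $c_1/\widetilde{C}\le\theta\le c_2/\widetilde{C}$. In particular, $$\|T(z)\|\le c_4\,\frac{M^2}{\varepsilon}\Bigl(1+\log\Bigl(\frac{M}{\varepsilon}\Bigr)\Bigr)$$ for every $z\in\mathbb{C}\setminus\{0\}$ with $|\arg(z)|\le c_3/\widetilde{C}$ (all such $z$ lying in $\Sigma_\theta$), and $$\sup_{t>0}\|t\,T'(t)\|\le c_5\,\frac{M^4}{\varepsilon^2}\Bigl(1+\log\Bigl(\frac{M}{\varepsilon}\Bigr)\Bigr).$$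
   Context: Banach spaces are over $\mathbb{C}$. $T'(t)$ denotes the derivative of $t\mapsto T(t)$. A strongly continuous ($C_0$-) semigroup on $X$ is a family $(T(t))_{t\ge0}$ of bounded linear operators with $T(0)=I$, $T(t+s)=T(t)T(s)$ for $t,s\ge0$, and $\lim_{t\downarrow0}T(t)x=x$ for all $x\in X$. For $\alpha\in[0,\pi)$, $\Sigma_\alpha=\{z\in\mathbb{C}\setminus\{0\}:|\arg z|<\alpha\}$ and $\overline{\Sigma_\alpha}=\{z:|\arg z|\le\alpha\}$ (including $0$), with argument in $(-\pi,\pi)$. A bounded holomorphic semigroup (of angle $\delta$, or in $\Sigma_\delta$) is a family of bounded operators $(T(z))_{z\in\Sigma_\delta\cup\{0\}}$ with (i) $T(z_1+z_2)=T(z_1)T(z_2)$ for $z_1,z_2\in\Sigma_\delta$; (ii) $z\mapsto T(z)$ holomorphic in $\Sigma_\delta$; (iii) $T(z)x\to x$ as $z\to0$, $z\in\overline{\Sigma_{\delta'}}$, for all $x\in X$ and $0<\delta'<\delta$; (iv) $\|T(z)\|$ bounded on $\overline{\Sigma_{\delta'}}$ for every $0<\delta'<\delta$. *)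

(* Defs.v *)
From Stdlib Require Import Reals Lra FunctionalExtensionality ProofIrrelevance.
From Coquelicot Require Import Coquelicot.

Set Implicit Arguments.
Unset Strict Implicit.
Unset Printing Implicit Defensive.

Open Scope R_scope.

(* A complex Banach space is a
   [CompleteNormedModule C_AbsRing]; the bounded operators on it are made into
   a Coquelicot [NormedModule] so that [is_derive] and [ex_derive], applied to
   operator-valued functions, refer to the operator norm. *)

(* [is_linear] includes the bound [norm (A x) <= M * norm x]. *)
Record bounded_op (X : NormedModule C_AbsRing) : Type := BoundedOp
  { bop_fun :> X -> X;
    bop_linear : is_linear bop_fun }.

Lemma bop_ext (X : NormedModule C_AbsRing) (A B : bounded_op X) :
  (forall x, A x = B x) -> A = B.
Proof.
destruct A as [f Hf], B as [g Hg]; simpl; intros H.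
assert (E : f = g) by (apply functional_extensionality; exact H).
subst g; f_equal; apply proof_irrelevance.
Qed.

Lemma is_linear_add (X : NormedModule C_AbsRing) (f g : X -> X) :
  is_linear f -> is_linear g -> is_linear (fun x => plus (f x) (g x)).
Proof.
intros Hf Hg.
apply (is_linear_comp (fun x => (f x, g x)) (fun p : X * X => plus (fst p) (snd p))).
- now apply is_linear_prod.
- apply is_linear_plus.
Qed.

Lemma is_linear_scale (X : NormedModule C_AbsRing) (k : C) (f : X -> X) :
  is_linear f -> is_linear (fun x => scal k (f x)).
Proof.
intros Hf.
apply (is_linear_comp f (fun y : X => scal k y)); [exact Hf|].
exact (@is_linear_scal_r C_AbsRing X k Cmult_comm).
Qed.

Definition bop_zero (X : NormedModule C_AbsRing) : bounded_op X :=
  BoundedOp (@is_linear_zero C_AbsRing X X).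
Definition bop_id (X : NormedModule C_AbsRing) : bounded_op X :=
  BoundedOp (@is_linear_id C_AbsRing X).
Definition bop_comp (X : NormedModule C_AbsRing) (A B : bounded_op X) : bounded_op X :=
  BoundedOp (is_linear_comp B A (bop_linear B) (bop_linear A)).
Definition bop_plus (X : NormedModule C_AbsRing) (A B : bounded_op X) : bounded_op X :=
  BoundedOp (is_linear_add (bop_linear A) (bop_linear B)).
Definition bop_opp (X : NormedModule C_AbsRing) (A : bounded_op X) : bounded_op X :=
  BoundedOp (is_linear_comp A opp (bop_linear A) is_linear_opp).
Definition bop_scal (X : NormedModule C_AbsRing) (k : C) (A : bounded_op X) : bounded_op X :=
  BoundedOp (is_linear_scale k (bop_linear A)).

(* The supremum is finite for every [A : bounded_op X] by [opnorm_lub]. *)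
Definition opnorm (X : NormedModule C_AbsRing) (A : bounded_op X) : R :=
  real (Lub_Rbar (fun r => exists x : X, norm x <= 1 /\ r = norm (A x))).

Lemma opnorm_lub (X : NormedModule C_AbsRing) (A : bounded_op X) :
  is_lub_Rbar (fun r => exists x : X, norm x <= 1 /\ r = norm (A x))
    (Finite (opnorm A)).
Proof.
unfold opnorm; set (E := fun r => _).
pose proof (Lub_Rbar_correct E) as HL.
destruct (bop_linear A) as [_ _ [M [HM HA]]].
assert (Hub : is_ub_Rbar E (Finite M)).
{ intros r [x [Hx ->]]; simpl.
  apply Rle_trans with (1 := HA x).
  rewrite <- (Rmult_1_r M) at 2.
  apply Rmult_le_compat_l; lra. }
assert (H0 : E (norm (A zero))).
{ exists zero; split; [rewrite norm_zero; lra | reflexivity]. }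
destruct (Lub_Rbar E) as [l| |]; simpl.
- exact HL.
- exact (False_ind _ (proj2 HL _ Hub)).
- exact (False_ind _ (proj1 HL _ H0)).
Qed.

Lemma opnorm_ge_0 (X : NormedModule C_AbsRing) (A : bounded_op X) : 0 <= opnorm A.
Proof.
apply Rle_trans with (1 := norm_ge_0 (A zero)).
apply (proj1 (opnorm_lub A)); exists zero; split; [rewrite norm_zero; lra | easy].
Qed.

Lemma opnorm_le (X : NormedModule C_AbsRing) (A : bounded_op X) (c : R) :
  0 <= c -> (forall x, norm (A x) <= c * norm x) -> opnorm A <= c.
Proof.
intros Hc H.
apply (proj2 (opnorm_lub A) (Finite c)).
intros r [x [Hx ->]]; simpl.
apply Rle_trans with (1 := H x).
rewrite <- (Rmult_1_r c) at 2.
now apply Rmult_le_compat_l.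
Qed.

Lemma opnorm_bound (X : NormedModule C_AbsRing) (A : bounded_op X) (x : X) :
  norm (A x) <= opnorm A * norm x.
Proof.
destruct (bop_linear A) as [_ Hs [M [_ HM]]].
destruct (norm_ge_0 x) as [Hx|Hx].
2: { specialize (HM x); rewrite <- Hx in HM |- *; lra. }
set (y := scal (RtoC (/ norm x) : C_AbsRing) x).
assert (Hy : norm y <= 1).
{ apply Rle_trans with (1 := norm_scal (RtoC (/ norm x) : C_AbsRing) x).
  change (Cmod (RtoC (/ norm x)) * norm x <= 1).
  rewrite Cmod_R, Rabs_pos_eq; [|left; now apply Rinv_0_lt_compat].
  right; field; lra. }
assert (HAy : norm (A y) <= opnorm A).
{ apply (proj1 (opnorm_lub A)); now exists y. }
assert (E : x = scal (RtoC (norm x) : C_AbsRing) y).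
{ unfold y; rewrite scal_assoc.
  change (x = scal (Cmult (RtoC (norm x)) (RtoC (/ norm x)) : C_AbsRing) x).
  rewrite <- RtoC_mult, Rinv_r; [|lra].
  symmetry; exact (scal_one x). }
rewrite E at 1; rewrite Hs.
apply Rle_trans with (1 := norm_scal (RtoC (norm x) : C_AbsRing) (A y)).
change (Cmod (RtoC (norm x)) * norm (A y) <= opnorm A * norm x).
rewrite Cmod_R, Rabs_pos_eq; [|lra].
rewrite Rmult_comm; apply Rmult_le_compat_r; lra.
Qed.

Definition bop_AbelianMonoid_mixin (X : NormedModule C_AbsRing) :
  AbelianMonoid.mixin_of (bounded_op X).
Proof.
apply (@AbelianMonoid.Mixin _ (@bop_plus X) (bop_zero X)).
- intros A B; apply bop_ext; intros x; apply plus_comm.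
- intros A B D; apply bop_ext; intros x; apply plus_assoc.
- intros A; apply bop_ext; intros x; exact (plus_zero_r (A x)).
Defined.

Canonical bop_AbelianMonoid (X : NormedModule C_AbsRing) :=
  AbelianMonoid.Pack (bounded_op X) (bop_AbelianMonoid_mixin X) (bounded_op X).

Definition bop_AbelianGroup_mixin (X : NormedModule C_AbsRing) :
  AbelianGroup.mixin_of (bop_AbelianMonoid X).
Proof.
apply (@AbelianGroup.Mixin (bop_AbelianMonoid X) (@bop_opp X)).
intros A; apply bop_ext; intros x; exact (plus_opp_r (A x)).
Defined.

Canonical bop_AbelianGroup (X : NormedModule C_AbsRing) :=
  AbelianGroup.Pack (bounded_op X)
    (AbelianGroup.Class _ _ (bop_AbelianGroup_mixin X)) (bounded_op X).

Definition bop_ModuleSpace_mixin (X : NormedModule C_AbsRing) :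
  ModuleSpace.mixin_of C_Ring (bop_AbelianGroup X).
Proof.
apply (@ModuleSpace.Mixin C_Ring (bop_AbelianGroup X) (@bop_scal X)).
- intros k l A; apply bop_ext; intros x; exact (scal_assoc k l (A x)).
- intros A; apply bop_ext; intros x; exact (scal_one (A x)).
- intros k A B; apply bop_ext; intros x; exact (scal_distr_l k (A x) (B x)).
- intros k l A; apply bop_ext; intros x; exact (scal_distr_r k l (A x)).
Defined.

Canonical bop_ModuleSpace (X : NormedModule C_AbsRing) :=
  ModuleSpace.Pack C_Ring (bounded_op X)
    (ModuleSpace.Class C_Ring _ _ (bop_ModuleSpace_mixin X)) (bounded_op X).

Lemma opnorm_triangle (X : NormedModule C_AbsRing) (A B : bounded_op X) :
  opnorm (plus A B) <= opnorm A + opnorm B.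
Proof.
apply opnorm_le.
- pose proof (opnorm_ge_0 A); pose proof (opnorm_ge_0 B); lra.
- intros x.
  apply Rle_trans with (1 := norm_triangle (A x) (B x)).
  pose proof (opnorm_bound A x); pose proof (opnorm_bound B x); lra.
Qed.

Lemma opnorm_scal (X : NormedModule C_AbsRing) (k : C) (A : bounded_op X) :
  opnorm (bop_scal k A) <= Cmod k * opnorm A.
Proof.
apply opnorm_le.
- apply Rmult_le_pos; [apply Cmod_ge_0 | apply opnorm_ge_0].
- intros x.
  apply Rle_trans with (1 := @norm_scal C_AbsRing X k (A x)).
  rewrite Rmult_assoc; apply Rmult_le_compat_l; [apply Cmod_ge_0|].
  apply opnorm_bound.
Qed.

Lemma opnorm_eq_0 (X : NormedModule C_AbsRing) (A : bounded_op X) :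
  opnorm A = 0 -> A = zero.
Proof.
intros H; apply bop_ext; intros x; apply norm_eq_zero.
pose proof (opnorm_bound A x) as HA; rewrite H in HA.
pose proof (norm_ge_0 (A x)); lra.
Qed.

Lemma opnorm_zero (X : NormedModule C_AbsRing) : opnorm (bop_zero X) = 0.
Proof.
apply Rle_antisym; [|apply opnorm_ge_0].
apply opnorm_le; [lra|]; intros x; simpl; rewrite norm_zero; lra.
Qed.

Lemma opnorm_minus_sym (X : NormedModule C_AbsRing) (A B : bounded_op X) :
  opnorm (minus A B) <= opnorm (minus B A).
Proof.
apply opnorm_le; [apply opnorm_ge_0|]; intros x.
replace (norm (minus A B x)) with (norm (minus B A x)); [apply opnorm_bound|].
change (norm (minus (B x) (A x)) = norm (minus (A x) (B x))).
now rewrite <- (opp_minus (A x)), norm_opp.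
Qed.

Definition bop_UniformSpace_mixin (X : NormedModule C_AbsRing) :
  UniformSpace.mixin_of (bounded_op X).
Proof.
apply (@UniformSpace.Mixin _ (bop_zero X)
         (fun (A : bounded_op X) (e : R) (B : bounded_op X) => opnorm (minus B A) < e)).
- intros A e; rewrite minus_eq_zero.
  change (opnorm (bop_zero X) < e); rewrite opnorm_zero; apply cond_pos.
- intros A B e H; now apply Rle_lt_trans with (1 := opnorm_minus_sym A B).
- intros A B D e1 e2 H1 H2.
  rewrite (minus_trans B D A).
  apply Rle_lt_trans with (1 := opnorm_triangle _ _).
  lra.
Defined.

Canonical bop_UniformSpace (X : NormedModule C_AbsRing) :=
  UniformSpace.Pack (bounded_op X) (bop_UniformSpace_mixin X) (bounded_op X).

Canonical bop_NormedModuleAux (X : NormedModule C_AbsRing) :=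
  NormedModuleAux.Pack C_AbsRing (bounded_op X)
    (NormedModuleAux.Class C_AbsRing _
       (ModuleSpace.class _ (bop_ModuleSpace X)) (bop_UniformSpace_mixin X))
    (bounded_op X).

Definition bop_NormedModule_mixin (X : NormedModule C_AbsRing) :
  NormedModule.mixin_of C_AbsRing (bop_NormedModuleAux X).
Proof.
apply (@NormedModule.Mixin C_AbsRing (bop_NormedModuleAux X) (@opnorm X) 1).
- exact (@opnorm_triangle X).
- exact (@opnorm_scal X).
- intros A B e H; exact H.
- intros A B e H; rewrite Rmult_1_l; exact H.
- exact (@opnorm_eq_0 X).
Defined.

Canonical bop_NormedModule (X : NormedModule C_AbsRing) :=
  NormedModule.Pack C_AbsRing (bounded_op X)
    (NormedModule.Class C_AbsRing _ _ (bop_NormedModule_mixin X)) (bounded_op X).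

(* Restriction of scalars from [C] to [R], with the same carrier, addition, balls
   and norm; needed to apply [is_derive] to functions of a real variable with
   values in a complex normed space. *)

Definition restr_ModuleSpace_mixin (V : NormedModule C_AbsRing) :
  ModuleSpace.mixin_of R_Ring (NormedModule.AbelianGroup C_AbsRing V).
Proof.
apply (@ModuleSpace.Mixin R_Ring (NormedModule.AbelianGroup C_AbsRing V)
         (fun (r : R) (v : V) => scal (RtoC r : C_AbsRing) v)).
- intros r s v; rewrite scal_assoc.
  now change (mult r s) with (Rmult r s); rewrite RtoC_mult.
- intros v; exact (scal_one v).
- intros r u v.
  exact (@scal_distr_l C_Ring (NormedModule.ModuleSpace C_AbsRing V) (RtoC r) u v).
- intros r s v.
  change (plus r s) with (Rplus r s); rewrite RtoC_plus.
  exact (@scal_distr_r C_Ring (NormedModule.ModuleSpace C_AbsRing V)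
           (RtoC r) (RtoC s) v).
Defined.

Definition restr_NormedModuleAux (V : NormedModule C_AbsRing) :
  NormedModuleAux R_AbsRing :=
  NormedModuleAux.Pack R_AbsRing V
    (NormedModuleAux.Class R_AbsRing V
       (ModuleSpace.Class R_Ring V
          (AbelianGroup.class (NormedModule.AbelianGroup C_AbsRing V))
          (restr_ModuleSpace_mixin V))
       (UniformSpace.class (NormedModule.UniformSpace C_AbsRing V))) V.

Definition restr_NormedModule_mixin (V : NormedModule C_AbsRing) :
  NormedModule.mixin_of R_AbsRing (restr_NormedModuleAux V).
Proof.
apply (@NormedModule.Mixin R_AbsRing (restr_NormedModuleAux V)
         (fun v : V => norm v) (@norm_factor C_AbsRing V)).
- exact (@norm_triangle C_AbsRing V).
- intros r v.
  change (norm (scal (RtoC r : C_AbsRing) (v : V)) <= Rabs r * norm (v : V)).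
  rewrite <- Cmod_R; apply (@norm_scal C_AbsRing V).
- exact (@norm_compat1 C_AbsRing V).
- exact (@norm_compat2 C_AbsRing V).
- exact (@norm_eq_zero C_AbsRing V).
Defined.

Definition restr_R (V : NormedModule C_AbsRing) : NormedModule R_AbsRing :=
  NormedModule.Pack R_AbsRing V
    (NormedModule.Class R_AbsRing V _ (restr_NormedModule_mixin V)) V.

(* [phi] is the argument in (-PI, PI) of the nonzero number [z]; numbers on the
   negative real axis have none. *)
Definition is_arg (z : C) (phi : R) : Prop :=
  z <> RtoC 0 /\ - PI < phi < PI /\
  z = (Cmod z * cos phi, Cmod z * sin phi).

Definition sector (alpha : R) (z : C) : Prop :=
  exists phi, is_arg z phi /\ Rabs phi < alpha.

Definition closed_sector (alpha : R) (z : C) : Prop :=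
  z = RtoC 0 \/ exists phi, is_arg z phi /\ Rabs phi <= alpha.

(* Only the values of [T] on [0, +oo) are constrained. *)
Definition is_C0_semigroup (X : NormedModule C_AbsRing) (T : R -> bounded_op X) : Prop :=
  T 0 = bop_id X /\
  (forall t s, 0 <= t -> 0 <= s -> T (t + s) = bop_comp (T t) (T s)) /\
  (forall x : X, filterlim (fun t => T t x) (at_right 0) (locally x)).

(* [ex_derive] over [C_AbsRing] is complex differentiability in operator norm.
   [T] is a total function standing for a family indexed by the sector and 0. *)
Definition is_bounded_holomorphic_semigroup
  (X : NormedModule C_AbsRing) (delta : R) (T : C -> bounded_op X) : Prop :=
  0 < delta < PI /\
  (forall z1 z2, sector delta z1 -> sector delta z2 ->
     T (Cplus z1 z2) = bop_comp (T z1) (T z2)) /\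
  (forall z, sector delta z ->
     @ex_derive C_AbsRing (bop_NormedModule X) T z) /\
  (forall delta' (x : X), 0 < delta' < delta ->
     filterlim (fun z => T z x)
       (within (closed_sector delta') (locally (RtoC 0))) (locally x)) /\
  (forall delta', 0 < delta' < delta ->
     exists K, forall z, closed_sector delta' z -> norm (T z) <= K).

(* Main.v *)
(* Write A for the generator. For real s <> 0 and t = pi/|s|, e^{-ist} T(t) = -T(t), and
   I + T(t) is invertible with inverse of norm at most 1/eps; as R(is,A)(I + T(t)) is an integral
   of T over [0,t], this gives |l| ||R(l,A)|| <= b = O(M/eps) on the right half-plane, beside
   Re l ||R(l,A)|| <= M. A Neumann series then controls the resolvent of h A, uniformly for h in
   the cone |arg h| <= c/b.
   Instead of inverting the Laplace transform along a contour, put Q = (I - h A)^{-1}: averaging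
   z^{-k} (I - z q Q)^{-m} over the L-th roots of unity z recovers the k-th Taylor coefficient as
   L grows. With m = 2 and 1 - q ~ 1/k, the bound
   ||(I - z q Q)^{-1}|| <= min(C M k, C b/|1 - z q|) gives ||Q^k|| = O(M b); with m = 3 it gives
   ||k (Q - I) Q^k|| = O(M b^2). All constants are uniform in k and h, so (I - (z/k) A)^{-k}
   converges in operator norm, uniformly at rate 1/k, to a semigroup S(z) in the cone, with
   ||S(z)|| = O(M b) and ||A S(z)|| = O(M b^2/|z|); on the positive reals the limit is T.
   Everything happens in the bicommutant of T, a commutative Banach algebra. *)

Require Import Defs.
From Stdlib Require Import Reals Lra Lia Ring ProofIrrelevance ClassicalEpsilon.
From Coquelicot Require Import Coquelicot.

Open Scope R_scope.

(** * Commutative Banach algebras *)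

(** The generator [A] is unbounded, so it never appears as an object. It is present only through
    bounded elements such as [A (1 - h A)^-1], and the resolvent is the element [R0] solving
    [(1 - e^{-lt} T(t)) R0 = F], where [F] is an integral over the bounded interval [[0, t]]; no
    improper integral is formed. A second obstacle is that [T] is strongly but not norm continuous,
    while the algebra only knows the norm. Identities that hold in the limit of small times are
    therefore proved after multiplication by [F 1 d] or by powers of [J = (1 - A)^-1], and these
    factors are cancelled at the end because the ranges of the operators [F 1 d] together are dense.
    The average of the squared minimum of the two resolvent bounds is compared with that of a
    Poisson kernel, which is known exactly. Hence the bounds come out without a logarithm, and the
    factor [1 + log (M / eps)] of the statement enters only through its lower bound [1/5]. *)

Record cbalg : Type := CBAlg
  { car :> Type;
    azero : car; aone : car;
    aadd : car -> car -> car; amul : car -> car -> car;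
    asub : car -> car -> car; aopp : car -> car;
    aring : ring_theory azero aone aadd amul asub aopp eq;
    emb : C -> car;
    emb_1 : emb (RtoC 1) = aone;
    emb_add : forall c d : C, emb (Cplus c d) = aadd (emb c) (emb d);
    emb_mul : forall c d : C, emb (Cmult c d) = amul (emb c) (emb d);
    nrm : car -> R;
    nrm_ge_0 : forall x, 0 <= nrm x;
    nrm_add : forall x y, nrm (aadd x y) <= nrm x + nrm y;
    nrm_mul : forall x y, nrm (amul x y) <= nrm x * nrm y;
    nrm_emb : forall c, nrm (emb c) <= Cmod c;
    nrm_eq_0 : forall x, nrm x = 0 -> x = azero;
    nrm_complete : forall u : nat -> car,
      (forall e, 0 < e -> exists N, forall n m, (N <= n)%nat -> (N <= m)%nat ->
         nrm (asub (u n) (u m)) <= e) ->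
      exists l, forall e, 0 < e -> exists N, forall n, (N <= n)%nat ->
         nrm (asub (u n) l) <= e }.

Arguments azero {_}. Arguments aone {_}. Arguments aadd {_}. Arguments amul {_}.
Arguments asub {_}. Arguments aopp {_}. Arguments emb {_}. Arguments nrm {_}.

Declare Scope cba_scope.
Delimit Scope cba_scope with A.
Bind Scope cba_scope with car.
Notation "x + y" := (aadd x y) : cba_scope.
Notation "x * y" := (amul x y) : cba_scope.
Notation "x - y" := (asub x y) : cba_scope.
Notation "- x" := (aopp x) : cba_scope.
Notation "0" := azero : cba_scope.
Notation "1" := aone : cba_scope.

Fixpoint apow {A : cbalg} (x : A) (n : nat) : A :=
  match n with O => 1%A | S m => (x * apow x m)%A end.
Infix "^" := apow : cba_scope.

Fixpoint asum {A : cbalg} (f : nat -> A) (n : nat) : A :=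
  match n with O => 0%A | S m => (asum f m + f m)%A end.

Fixpoint rsum (f : nat -> R) (n : nat) : R :=
  match n with O => 0 | S m => rsum f m + f m end.

Lemma rsum_le (f g : nat -> R) n :
  (forall i, (i < n)%nat -> f i <= g i) -> rsum f n <= rsum g n.
Proof.
induction n as [|n IH]; intros H; simpl; [lra|].
apply Rplus_le_compat; [apply IH; intros; apply H; lia | apply H; lia].
Qed.

Lemma rsum_const (c : R) n : rsum (fun _ => c) n = INR n * c.
Proof. induction n as [|n IH]; [simpl; ring|]. rewrite S_INR; simpl; rewrite IH; ring. Qed.

Lemma rsum_scal (c : R) (f : nat -> R) n : rsum (fun i => c * f i) n = c * rsum f n.
Proof. induction n as [|n IH]; simpl; [ring|]. rewrite IH; ring. Qed.

Section Algebra.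
Variable A : cbalg.
Add Ring cba_ring : (aring A).
Implicit Types x y z : A.

Lemma emb_0 : emb (RtoC 0) = (0%A : A).
Proof.
assert (H : (emb (RtoC 0) + emb (RtoC 0) = emb (RtoC 0) :> A)%A).
{ rewrite <- emb_add; f_equal; ring. }
transitivity ((emb (RtoC 0) + emb (RtoC 0)) - emb (RtoC 0) : A)%A.
- ring.
- rewrite H; ring.
Qed.

Lemma emb_opp (c : C) : emb (Copp c) = (- emb c : A)%A.
Proof.
assert (H : (emb c + emb (Copp c) = 0 :> A)%A).
{ rewrite <- emb_add, <- emb_0; f_equal; ring. }
transitivity ((emb c + emb (Copp c)) - emb c : A)%A; [ring|rewrite H; ring].
Qed.

Lemma emb_sub (c d : C) : emb (Cminus c d) = (emb c - emb d : A)%A.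
Proof. unfold Cminus; rewrite emb_add, emb_opp; ring. Qed.

Lemma emb_pow (c : C) n : emb (Cpow c n) = (apow (emb c) n : A).
Proof. induction n; simpl; [apply emb_1|]. now rewrite emb_mul, IHn. Qed.

Lemma nrm_0 : nrm (0%A : A) = 0.
Proof.
apply Rle_antisym; [|apply nrm_ge_0].
replace (0%A : A) with (emb (RtoC 0) : A) by apply emb_0.
eapply Rle_trans; [apply nrm_emb|rewrite Cmod_0; lra].
Qed.

Lemma nrm_1 : nrm (1%A : A) <= 1.
Proof.
replace (1%A : A) with (emb (RtoC 1) : A) by apply emb_1.
eapply Rle_trans; [apply nrm_emb|rewrite Cmod_1; lra].
Qed.

Lemma nrm_emb_mul (c : C) x : nrm (emb c * x)%A <= Cmod c * nrm x.
Proof.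
eapply Rle_trans; [apply nrm_mul|].
apply Rmult_le_compat_r; [apply nrm_ge_0|apply nrm_emb].
Qed.

Lemma nrm_mul_le x y a b : nrm x <= a -> nrm y <= b -> nrm (x * y)%A <= a * b.
Proof.
intros; eapply Rle_trans; [apply nrm_mul|].
apply Rmult_le_compat; auto using nrm_ge_0.
Qed.

Lemma nrm_add_le x y a b : nrm x <= a -> nrm y <= b -> nrm (x + y)%A <= a + b.
Proof. intros; pose proof (nrm_add A x y); lra. Qed.

Lemma nrm_opp x : nrm (- x)%A = nrm x.
Proof.
assert (H : forall y, nrm (- y)%A <= nrm y).
{ intros y; replace (- y)%A with (emb (Copp (RtoC 1)) * y)%A.
  - eapply Rle_trans; [apply nrm_emb_mul|]; rewrite Cmod_opp, Cmod_1; lra.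
  - rewrite emb_opp, emb_1; ring. }
apply Rle_antisym; [apply H|].
replace x with (- - x)%A at 1 by ring; apply H.
Qed.

Lemma nrm_sub_le x y a b : nrm x <= a -> nrm y <= b -> nrm (x - y)%A <= a + b.
Proof.
intros; replace (x - y)%A with (x + - y)%A by ring.
apply nrm_add_le; [|rewrite nrm_opp]; assumption.
Qed.

Lemma nrm_sub_sym x y : nrm (x - y)%A = nrm (y - x)%A.
Proof. rewrite <- nrm_opp; f_equal; ring. Qed.

Lemma nrm_le_trans x y z : nrm (x - z)%A <= nrm (x - y)%A + nrm (y - z)%A.
Proof. replace (x - z)%A with ((x - y) + (y - z))%A by ring; apply nrm_add. Qed.

(** The norm is only assumed to satisfy inequalities. Equality comes from applying the inequality to
    [c] and to its inverse. *)
Lemma nrm_emb_cancel (c : C) x : c <> RtoC 0 -> nrm (emb c * x)%A = Cmod c * nrm x.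
Proof.
intros Hc; apply Rle_antisym; [apply nrm_emb_mul|].
assert (Hm : 0 < Cmod c) by now apply Cmod_gt_0.
replace x with (emb (Cinv c) * (emb c * x))%A at 1.
- apply Rle_trans with (Cmod c * (Cmod (Cinv c) * nrm (emb c * x)%A)).
  + apply Rmult_le_compat_l; [lra|apply nrm_emb_mul].
  + rewrite Cmod_inv by assumption; right; field; lra.
- transitivity ((emb (Cinv c) * emb c) * x)%A; [ring|].
  rewrite <- emb_mul, Cinv_l, emb_1 by assumption; ring.
Qed.

Lemma eq_of_nrm_small x y : (forall e, 0 < e -> nrm (x - y)%A <= e) -> x = y.
Proof.
intros H.
assert (E : (x - y)%A = 0%A).
{ apply nrm_eq_0, Rle_antisym; [|apply nrm_ge_0].
  apply Rnot_lt_le; intros Hp; specialize (H (nrm (x - y)%A / 2) ltac:(lra)); lra. }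
transitivity ((x - y) + y)%A; [ring|rewrite E; ring].
Qed.

Lemma nrm_asum_le (f : nat -> A) n : nrm (asum f n) <= rsum (fun i => nrm (f i)) n.
Proof.
induction n as [|n IH]; simpl; [rewrite nrm_0; lra|].
now apply nrm_add_le; [|apply Rle_refl].
Qed.

Lemma nrm_asum_const (f : nat -> A) n c :
  (forall i, (i < n)%nat -> nrm (f i) <= c) -> nrm (asum f n) <= INR n * c.
Proof.
intros H; eapply Rle_trans; [apply nrm_asum_le|].
rewrite <- rsum_const; now apply rsum_le.
Qed.

Lemma asum_ext (f g : nat -> A) n :
  (forall i, (i < n)%nat -> f i = g i) -> asum f n = asum g n.
Proof.
induction n as [|n IH]; intros H; simpl; [reflexivity|].
rewrite IH, H; auto with arith.
Qed.

Lemma asum_scal x (f : nat -> A) n : asum (fun i => x * f i)%A n = (x * asum f n)%A.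
Proof. induction n as [|n IH]; simpl; [ring|rewrite IH; ring]. Qed.

Lemma asum_add (f g : nat -> A) n : asum (fun i => f i + g i)%A n = (asum f n + asum g n)%A.
Proof. induction n as [|n IH]; simpl; [ring|rewrite IH; ring]. Qed.

Lemma apow_add x m n : (x ^ (m + n) = x ^ m * x ^ n)%A.
Proof. induction m as [|m IH]; simpl; [ring|rewrite IH; ring]. Qed.

Lemma apow_mul x y n : ((x * y) ^ n = x ^ n * y ^ n)%A.
Proof. induction n as [|n IH]; simpl; [ring|rewrite IH; ring]. Qed.

Lemma apow_apow x m n : (x ^ (m * n) = (x ^ m) ^ n)%A.
Proof.
induction n as [|n IH]; [now rewrite Nat.mul_0_r|].
rewrite Nat.mul_succ_r, Nat.add_comm, apow_add, IH; reflexivity.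
Qed.

Lemma nrm_apow x n : nrm (x ^ n)%A <= nrm x ^ n.
Proof.
induction n as [|n IH]; [apply nrm_1|].
simpl; now apply nrm_mul_le; [apply Rle_refl|].
Qed.

Lemma apow_sub x y n :
  (x ^ n - y ^ n = (x - y) * asum (fun i => x ^ i * y ^ (n - 1 - i)) n)%A.
Proof.
induction n as [|n IH]; [simpl; ring|].
change (x ^ S n - y ^ S n = (x - y) * (asum (fun i => x ^ i * y ^ (S n - 1 - i)) n
          + x ^ n * y ^ (S n - 1 - n)))%A.
replace (S n - 1 - n)%nat with 0%nat by lia.
rewrite (asum_ext _ (fun i => y * (x ^ i * y ^ (n - 1 - i)))%A).
2:{ intros i Hi; replace (S n - 1 - i)%nat with (S (n - 1 - i)) by lia; simpl; ring. }
rewrite asum_scal; simpl.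
transitivity (y * (x ^ n - y ^ n) + (x - y) * x ^ n)%A; [ring|rewrite IH; ring].
Qed.

(** * Limits in the algebra and the Neumann series *)

Definition alim (u : nat -> A) (l : A) : Prop :=
  forall e, 0 < e -> exists N, forall n, (N <= n)%nat -> nrm (u n - l)%A <= e.

Lemma alim_const x : alim (fun _ => x) x.
Proof.
intros e He; exists 0%nat; intros n _; replace (x - x)%A with (0%A : A) by ring.
rewrite nrm_0; lra.
Qed.

Lemma alim_nrm_le (u : nat -> A) l c N0 :
  alim u l -> (forall n, (N0 <= n)%nat -> nrm (u n) <= c) -> nrm l <= c.
Proof.
intros Hu Hc; apply le_epsilon; intros e He.
destruct (Hu e He) as [N HN].
replace l with (u (Nat.max N0 N) - (u (Nat.max N0 N) - l))%A by ring.
apply nrm_sub_le; [apply Hc; lia|apply HN; lia].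
Qed.

Lemma alim_sub (u v : nat -> A) l m :
  alim u l -> alim v m -> alim (fun n => u n - v n)%A (l - m)%A.
Proof.
intros Hu Hv e He.
destruct (Hu (e / 2) ltac:(lra)) as [N1 H1], (Hv (e / 2) ltac:(lra)) as [N2 H2].
exists (Nat.max N1 N2); intros n Hn.
replace (u n - v n - (l - m))%A with ((u n - l) - (v n - m))%A by ring.
replace e with (e / 2 + e / 2) by field; apply nrm_sub_le; [apply H1|apply H2]; lia.
Qed.

Lemma alim_mul (u v : nat -> A) l m :
  alim u l -> alim v m -> alim (fun n => u n * v n)%A (l * m)%A.
Proof.
intros Hu Hv e He.
pose proof (nrm_ge_0 A l) as Hl0; pose proof (nrm_ge_0 A m) as Hm0.
set (c := nrm l + nrm m + 1).
assert (Hc : 0 < e / (2 * c)) by (apply Rdiv_lt_0_compat; unfold c; lra).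
destruct (Hu _ Hc) as [N1 H1], (Hv (Rmin 1 (e / (2 * c))) ltac:(apply Rmin_pos; lra)) as [N2 H2].
exists (Nat.max N1 N2); intros n Hn.
specialize (H1 n ltac:(lia)); specialize (H2 n ltac:(lia)).
assert (Hv1 : nrm (v n) <= nrm m + 1).
{ replace (v n) with (m + (v n - m))%A by ring; apply nrm_add_le; [lra|].
  eapply Rle_trans; [exact H2|apply Rmin_l]. }
replace (u n * v n - l * m)%A with ((u n - l) * v n + l * (v n - m))%A by ring.
apply Rle_trans with (e / (2 * c) * (nrm m + 1) + nrm l * (e / (2 * c))).
- apply nrm_add_le; apply nrm_mul_le; try assumption; [lra|].
  eapply Rle_trans; [exact H2|apply Rmin_r].
- replace (e / (2 * c) * (nrm m + 1) + nrm l * (e / (2 * c))) with (e / 2); [lra|].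
  unfold c in *; field; lra.
Qed.

Lemma alim_unique (u : nat -> A) l m : alim u l -> alim u m -> l = m.
Proof.
intros Hl Hm; apply eq_of_nrm_small; intros e He.
destruct (Hl (e / 2) ltac:(lra)) as [N1 H1], (Hm (e / 2) ltac:(lra)) as [N2 H2].
set (n := Nat.max N1 N2).
replace (l - m)%A with ((u n - m) - (u n - l))%A by ring.
replace e with (e / 2 + e / 2) by field; apply nrm_sub_le; [apply H2|apply H1]; lia.
Qed.

Lemma half_pow_small c e : 0 < e -> exists N, forall n, (N <= n)%nat -> c * (/ 2) ^ n <= e.
Proof.
intros He; assert (Hc : 0 < Rabs c + 1) by (pose proof (Rabs_pos c); lra).
destruct (pow_lt_1_zero (/ 2) ltac:(rewrite Rabs_pos_eq; lra) (e / (Rabs c + 1))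
  ltac:(apply Rdiv_lt_0_compat; lra)) as [N HN].
exists N; intros n Hn; specialize (HN n Hn).
rewrite Rabs_pos_eq in HN by (apply pow_le; lra).
apply Rle_trans with ((Rabs c + 1) * (/ 2) ^ n).
- apply Rmult_le_compat_r; [apply pow_le; lra|pose proof (Rle_abs c); lra].
- apply Rle_trans with ((Rabs c + 1) * (e / (Rabs c + 1))); [apply Rmult_le_compat_l; lra|].
  right; field; lra.
Qed.

Lemma alim_of_steps (u : nat -> A) c N0 :
  (forall n, (N0 <= n)%nat -> nrm (u (S n) - u n)%A <= c * (/ 2) ^ n) -> exists l, alim u l.
Proof.
intros H.
(* The subtracted term makes the telescoping induction on [k] close; it is dropped afterwards. *)
assert (Hd : forall n k, (N0 <= n)%nat ->
  nrm (u (n + k)%nat - u n)%A <= 2 * c * ((/ 2) ^ n - (/ 2) ^ (n + k))).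
{ intros n k Hn; induction k as [|k IH].
  - rewrite Nat.add_0_r; replace (u n - u n)%A with (0%A : A) by ring; rewrite nrm_0; lra.
  - rewrite Nat.add_succ_r.
    replace (u (S (n + k)) - u n)%A with ((u (n + k)%nat - u n) + (u (S (n + k)) - u (n + k)%nat))%A
      by ring.
    pose proof (nrm_add_le _ _ _ _ IH (H (n + k)%nat ltac:(lia))); simpl; lra. }
assert (Hc : 0 <= c).
{ specialize (H N0 (le_n N0)); assert (0 < (/ 2) ^ N0) by (apply pow_lt; lra).
  pose proof (nrm_ge_0 A (u (S N0) - u N0)%A); nra. }
apply nrm_complete; intros e He.
destruct (half_pow_small (2 * c) e He) as [N HN].
exists (Nat.max N0 N).
assert (Hle : forall n m, (Nat.max N0 N <= n)%nat -> (n <= m)%nat -> nrm (u m - u n)%A <= e).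
{ intros n m Hn Hm; replace m with (n + (m - n))%nat by lia.
  pose proof (Hd n (m - n)%nat ltac:(lia)); pose proof (HN n ltac:(lia)).
  assert (0 < (/ 2) ^ (n + (m - n))) by (apply pow_lt; lra); nra. }
intros n m Hn Hm; destruct (Nat.le_ge_cases n m).
- rewrite nrm_sub_sym; now apply Hle.
- now apply Hle.
Qed.

Lemma neumann x : nrm x <= / 2 -> exists y, (y * (1 - x))%A = 1%A /\ nrm y <= 2.
Proof.
intros Hx.
set (u := fun n => asum (fun i => x ^ i)%A n).
assert (Hu : forall n, (u n * (1 - x) = 1 - x ^ n)%A).
{ induction n as [|n IH]; unfold u in *; simpl; [ring|].
  transitivity (asum (fun i => x ^ i) n * (1 - x) + x ^ n * (1 - x))%A; [ring|].
  rewrite IH; ring. }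
assert (Hp : forall n, nrm (x ^ n)%A <= (/ 2) ^ n).
{ intros n; eapply Rle_trans; [apply nrm_apow|]; apply pow_incr; split; [apply nrm_ge_0|exact Hx]. }
destruct (alim_of_steps u 1 0) as [y Hy].
{ intros n _; replace (u (S n) - u n)%A with (x ^ n)%A by (unfold u; simpl; ring).
  rewrite Rmult_1_l; apply Hp. }
exists y; split.
- apply (alim_unique (fun n => u n * (1 - x))%A); [apply alim_mul; [exact Hy|apply alim_const]|].
  intros e He; destruct (half_pow_small 1 e He) as [N HN]; exists N; intros n Hn.
  rewrite Hu; replace (1 - x ^ n - 1)%A with (- x ^ n)%A by ring.
  rewrite nrm_opp; eapply Rle_trans; [apply Hp|]; specialize (HN n Hn); lra.
- apply (alim_nrm_le u y 2 0 Hy); intros n _.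
  assert (Hs : nrm (u n) <= 2 - 2 * (/ 2) ^ n).
  { induction n as [|n IH]; [unfold u; simpl; rewrite nrm_0; lra|].
    replace (u (S n)) with (u n + x ^ n)%A by reflexivity.
    pose proof (nrm_add_le _ _ _ _ IH (Hp n)); simpl; lra. }
  assert (0 < (/ 2) ^ n) by (apply pow_lt; lra); lra.
Qed.
End Algebra.

Arguments alim {A}.

(** * Averages over roots of unity *)

Definition cis (t : R) : C := (cos t, sin t).

Lemma cis_add s t : cis (s + t) = Cmult (cis s) (cis t).
Proof. unfold cis, Cmult; simpl; rewrite cos_plus, sin_plus; f_equal; ring. Qed.

Lemma cis_0 : cis 0 = RtoC 1.
Proof. unfold cis; rewrite cos_0, sin_0; reflexivity. Qed.

Lemma Cmod_cis t : Cmod (cis t) = 1.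
Proof.
change (sqrt (cos t ^ 2 + sin t ^ 2) = 1); rewrite <- sqrt_1; f_equal.
pose proof (sin2_cos2 t); unfold Rsqr in *; lra.
Qed.

Lemma cis_pow t n : Cpow (cis t) n = cis (INR n * t).
Proof.
induction n as [|n IH]; simpl Cpow; [simpl; rewrite Rmult_0_l, cis_0; reflexivity|].
rewrite IH, <- cis_add, S_INR; f_equal; ring.
Qed.

Fixpoint csum (f : nat -> C) (n : nat) : C :=
  match n with O => RtoC 0 | S m => Cplus (csum f m) (f m) end.

Lemma csum_geometric (c : C) n :
  Cmult (Cminus (RtoC 1) c) (csum (fun l => Cpow c l) n) = Cminus (RtoC 1) (Cpow c n).
Proof. induction n as [|n IH]; simpl; [ring|]. rewrite Cmult_plus_distr_l, IH; ring. Qed.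

Lemma csum_ext (f g : nat -> C) n : (forall l, f l = g l) -> csum f n = csum g n.
Proof. intros H; induction n as [|n IH]; simpl; [reflexivity|now rewrite IH, H]. Qed.

(** [cis (node L l)] is the [l]-th of the [L]-th roots of unity. *)
Definition node (L l : nat) : R := 2 * PI * INR l / INR L.

(** A geometric sum of ratio [c = cis (2 PI d / L)] with [c ^ L = 1]; it vanishes once [c] differs
    from 1, which holds since [sin (PI d / L)] has no zero for [0 < |d| < L]. Taking [d] real allows
    negative differences of natural numbers. *)
Lemma csum_node (L : nat) (d : R) :
  0 < Rabs d < INR L -> cis (2 * PI * d) = RtoC 1 ->
  csum (fun l => cis (d * node L l)) L = RtoC 0.
Proof.
intros Hd H1.
assert (HL : 0 < INR L) by (pose proof (Rabs_pos d); lra).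
set (c := cis (2 * PI * d / INR L)).
rewrite (csum_ext _ (fun l => Cpow c l)).
2:{ intros l; unfold c, node; rewrite cis_pow; f_equal; field; lra. }
assert (Hc : Cminus (RtoC 1) c <> RtoC 0).
{ intros H.
  assert (Hcos : cos (2 * PI * d / INR L) = 1).
  { apply (f_equal fst) in H; unfold c, cis in H; simpl in H; lra. }
  replace (2 * PI * d / INR L) with (2 * (PI * d / INR L)) in Hcos by (field; lra).
  rewrite cos_2a_sin in Hcos.
  assert (Hs : sin (PI * d / INR L) = 0).
  { apply Rsqr_eq_0; unfold Rsqr; lra. }
  assert (Hpi := PI_RGT_0).
  assert (Hq : 0 < PI * Rabs d / INR L < PI).
  { split; [apply Rdiv_lt_0_compat; [apply Rmult_lt_0_compat|]; lra|].
    apply Rmult_lt_reg_r with (INR L); [lra|].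
    unfold Rdiv; rewrite Rmult_assoc, Rinv_l, Rmult_1_r by lra.
    apply Rmult_lt_compat_l; lra. }
  assert (Hs' : sin (PI * Rabs d / INR L) = 0).
  { destruct (Rcase_abs d) as [Hn|Hn].
    - rewrite Rabs_left by lra.
      replace (PI * - d / INR L) with (- (PI * d / INR L)) by (field; lra).
      rewrite sin_neg; lra.
    - rewrite Rabs_right by lra; exact Hs. }
  pose proof (sin_gt_0 _ (proj1 Hq) (proj2 Hq)); lra. }
pose proof (csum_geometric c L) as H.
unfold c at 3 in H; rewrite cis_pow in H.
replace (INR L * (2 * PI * d / INR L)) with (2 * PI * d) in H by (field; lra).
rewrite H1 in H.
set (s := csum (fun l => Cpow c l) L) in *.
replace s with (Cmult (Cinv (Cminus (RtoC 1) c)) (Cmult (Cminus (RtoC 1) c) s)).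
- rewrite H; ring.
- field; exact Hc.
Qed.

Lemma cis_2PI_nat (n : nat) : cis (2 * PI * INR n) = RtoC 1.
Proof.
replace (2 * PI * INR n) with (0 + 2 * INR n * PI) by ring.
unfold cis; rewrite cos_period, sin_period, cos_0, sin_0; reflexivity.
Qed.

Lemma cis_2PI_sub (j k : nat) : cis (2 * PI * (INR j - INR k)) = RtoC 1.
Proof.
assert (H : Cmult (cis (2 * PI * (INR j - INR k))) (cis (2 * PI * INR k)) = RtoC 1).
{ rewrite <- cis_add, <- (cis_2PI_nat j); f_equal; ring. }
rewrite cis_2PI_nat in H; rewrite <- H; ring.
Qed.

Lemma csum_node_sub (L j k : nat) :
  (j < L)%nat -> (k < L)%nat -> j <> k ->
  csum (fun l => cis ((INR j - INR k) * node L l)) L = RtoC 0.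
Proof.
intros Hj Hk Hjk; apply csum_node; [|apply cis_2PI_sub].
apply lt_INR in Hj; apply lt_INR in Hk; pose proof (pos_INR j); pose proof (pos_INR k).
split; [apply Rabs_pos_lt; intros He; apply Hjk, INR_eq; lra|].
apply Rabs_def1; lra.
Qed.

Lemma csum_one n : csum (fun _ => RtoC 1) n = RtoC (INR n).
Proof. induction n as [|n IH]; [reflexivity|]. rewrite S_INR, RtoC_plus; simpl; now rewrite IH. Qed.

(** For [z = p cis (node L l)] one has [z ^ L = p ^ L], so the finite sum [s] of the first [L]
    powers of [z] is [(1 - p ^ L) / (1 - z)], and the Poisson kernel is an affine function of
    [Re s]. Summed over the nodes, every power of [z] but the zeroth cancels, whence an exact value
    and not only a limit. *)
Lemma rsum_poisson (L : nat) (p : R) :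
  (0 < L)%nat -> 0 <= p < 1 ->
  rsum (fun l => (1 - p ^ 2) / (1 + p ^ 2 - 2 * p * cos (node L l))) L =
  INR L * ((1 + p ^ L) / (1 - p ^ L)).
Proof.
intros HL Hp.
set (z := fun l => Cmult (RtoC p) (cis (node L l))).
assert (HpL : p ^ L < 1).
{ destruct L as [|L]; [lia|]; simpl.
  apply Rle_lt_trans with (p * 1); [|lra].
  apply Rmult_le_compat_l; [lra|]; rewrite <- (pow1 L); apply pow_incr; lra. }
assert (Hz : forall l, Cpow (z l) L = RtoC (p ^ L)).
{ intros l; unfold z; rewrite Cpow_mult_l, cis_pow.
  replace (INR L * node L l) with (2 * PI * INR l).
  - rewrite cis_2PI_nat, RtoC_pow; ring.
  - unfold node; field; apply not_0_INR; lia. }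
assert (Hden : forall l, 0 < 1 + p ^ 2 - 2 * p * cos (node L l)).
{ intros l; pose proof (COS_bound (node L l)).
  apply Rlt_le_trans with ((1 - p) ^ 2); [apply pow_lt; lra|nra]. }
assert (Hre : forall l, (1 - p ^ 2) / (1 + p ^ 2 - 2 * p * cos (node L l)) =
  Re (csum (fun j => Cpow (z l) j) L) * (2 / (1 - p ^ L)) - 1).
{ intros l; set (s := csum (fun j => Cpow (z l) j) L).
  assert (Hs : Cmult (Cminus (RtoC 1) (z l)) s = RtoC (1 - p ^ L)).
  { unfold s; rewrite csum_geometric, Hz, RtoC_minus; reflexivity. }
  pose proof (Hden l) as Hd.
  unfold z, cis in Hs; destruct s as [s1 s2]; simpl in *.
  apply (f_equal fst) in Hs as H1; apply (f_equal snd) in Hs as H2; simpl in H1, H2.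
  set (x := cos (node L l)) in *; set (y := sin (node L l)) in *.
  assert (Hxy : y * y = 1 - x * x).
  { pose proof (sin2_cos2 (node L l)); unfold Rsqr in *; fold x y in H; lra. }
  (* The equation [Hs] is multiplied by the conjugate of [1 - z], and the real part is taken. *)
  assert (H3 : s1 * (1 + p ^ 2 - 2 * p * x) = (1 - p ^ L) * (1 - p * x)).
  { replace (s1 * (1 + p ^ 2 - 2 * p * x)) with
      (s1 * (1 - 2 * p * x + p ^ 2 * (x * x) + p ^ 2 * (y * y))) by (rewrite Hxy; ring).
    transitivity (((1 + - (p * x - 0 * y)) * s1 - (0 + - (p * y + 0 * x)) * s2) * (1 - p * x)
      - ((1 + - (p * x - 0 * y)) * s2 + (0 + - (p * y + 0 * x)) * s1) * (p * y)); [ring|].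
    rewrite H1, H2; ring. }
  unfold Re; simpl.
  apply Rmult_eq_reg_r with ((1 + p ^ 2 - 2 * p * x) * (1 - p ^ L)); [|apply Rgt_not_eq, Rmult_lt_0_compat; lra].
  transitivity ((1 - p ^ 2) * (1 - p ^ L)); [field; lra|].
  transitivity (2 * (s1 * (1 + p ^ 2 - 2 * p * x)) - (1 + p ^ 2 - 2 * p * x) * (1 - p ^ L)).
  - rewrite H3; ring.
  - field; lra. }
set (S2 := fun J => rsum (fun l => Re (csum (fun j => Cpow (z l) j) J)) L).
assert (HS : forall J, (1 <= J <= L)%nat -> S2 J = INR L).
{ intros J HJ; induction J as [|J IH]; [lia|].
  assert (Hstep : S2 (S J) = S2 J + p ^ J * Re (csum (fun l => cis ((INR J - INR 0) * node L l)) L)).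
  { assert (Hl : forall l, Re (csum (fun j => Cpow (z l) j) (S J)) =
       Re (csum (fun j => Cpow (z l) j) J) + p ^ J * Re (cis ((INR J - INR 0) * node L l))).
    { intros l; cbn [csum]; replace (Cpow (z l) J) with (Cmult (RtoC (p ^ J)) (cis (INR J * node L l))) by (unfold z; rewrite Cpow_mult_l, cis_pow, RtoC_pow; reflexivity).
      replace ((INR J - INR 0) * node L l) with (INR J * node L l) by (simpl; ring).
      unfold Re, cis, RtoC; simpl; ring. }
    unfold S2; generalize L at 1 2 4 as n; intros n.
    induction n as [|n IHn]; [simpl; ring|].
    cbn [rsum]; rewrite IHn, Hl; cbn [csum].
    unfold Re; simpl; ring. }
  rewrite Hstep; destruct J as [|J].
  - rewrite (csum_ext _ (fun _ => RtoC 1)).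
    2:{ intros l; rewrite <- cis_0; f_equal; simpl; ring. }
    rewrite csum_one; unfold S2; simpl rsum.
    rewrite (rsum_const 0); simpl; ring.
  - rewrite IH, csum_node_sub by lia; simpl; ring. }
transitivity (S2 L * (2 / (1 - p ^ L)) - INR L).
- unfold S2; generalize L at 2 4 6 as n.
  intros n; induction n as [|n IH]; [simpl; ring|].
  cbn [rsum]; rewrite IH, Hre, S_INR; ring.
- rewrite HS by lia; field; lra.
Qed.

(* The two-sided bound on [f] makes it at most a multiple of a Poisson kernel, of a parameter
   [p] adjusted to the ratio [a / b]; so its average has no logarithmic factor. *)
Lemma rsum_min_sqr (q a b : R) :
  0 < q < 1 -> 0 < a -> 0 < b ->
  exists L0 : nat, forall (L : nat) (f : R -> R), (L0 <= L)%nat -> (0 < L)%nat ->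
    (forall t, 0 <= f t /\ f t * (1 - q) <= a /\
       f t ^ 2 * (1 + q ^ 2 - 2 * q * cos t) <= b ^ 2) ->
    rsum (fun l => f (node L l) ^ 2) L <= INR L * (4 * a * b / (1 - q)).
Proof.
intros Hq Ha Hb.
set (k := b / a); assert (Hk : 0 < k) by (apply Rdiv_lt_0_compat; lra).
(* Adding [k ^ 2] times the square of the first bound on [f] to the second gives
   [f t ^ 2 * (m - 2 q cos t) <= 2 b ^ 2]; the weight [k = b / a] makes both contributions equal to
   [b ^ 2]. *)
set (m := 1 + q ^ 2 + k ^ 2 * (1 - q) ^ 2).
set (e := ((1 - q) ^ 2 * (1 + k ^ 2)) * ((1 + q) ^ 2 + k ^ 2 * (1 - q) ^ 2)).
assert (He : e = m ^ 2 - 4 * q ^ 2) by (unfold e, m; ring).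
assert (Hkp : 0 < k ^ 2) by (apply pow_lt; lra).
assert (He2 : (k * (1 - q)) ^ 2 <= e).
{ unfold e; assert (0 < (1 - q) ^ 2) by (apply pow_lt; lra).
  replace ((k * (1 - q)) ^ 2) with ((1 - q) ^ 2 * k ^ 2 * 1) by ring.
  apply Rmult_le_compat; nra. }
set (D := sqrt e).
assert (HD0 : k * (1 - q) <= D).
{ unfold D; rewrite <- (sqrt_pow2 (k * (1 - q))) by nra. apply sqrt_le_1_alt; exact He2. }
assert (HDp : 0 < D) by nra.
assert (HD2 : D * D = m ^ 2 - 4 * q ^ 2) by (unfold D; rewrite sqrt_sqrt; [exact He|eapply Rle_trans; [apply pow2_ge_0|exact He2]]).
assert (Hm : 0 < m).
{ unfold m; pose proof (pow2_ge_0 q).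
  assert (0 <= k ^ 2 * (1 - q) ^ 2) by (apply Rmult_le_pos; [lra|apply pow2_ge_0]); lra. }
(* [s] and [p] are chosen such that [m - 2 q cos t = s (1 + p ^ 2 - 2 p cos t)]: [s] and [s p ^ 2]
   are the roots of [X ^ 2 - m X + q ^ 2], and their difference is [D]. *)
set (s := (m + D) / 2); assert (Hs : 0 < s) by (unfold s; lra).
set (p := q / s).
assert (Hsp : s * p = q) by (unfold p; field; lra).
assert (Hspp : s * p ^ 2 = (m - D) / 2).
{ apply Rmult_eq_reg_l with s; [|lra].
  replace (s * (s * p ^ 2)) with (s * p * (s * p)) by ring; rewrite Hsp.
  transitivity ((m * m - D * D) / 4); [rewrite HD2; field|unfold s; field]. }
assert (Hp0 : 0 <= p) by (unfold p; apply Rlt_le, Rdiv_lt_0_compat; lra).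
assert (Hp1 : p < 1).
{ apply Rnot_le_lt; intros H; assert (s * 1 <= s * p ^ 2).
  { apply Rmult_le_compat_l; nra. } unfold s in H0 at 1; lra. }
assert (HpD : s * (1 - p ^ 2) = D) by (rewrite Rmult_minus_distr_l, Hspp; unfold s; field).
(* For [p ^ L <= 1/3] the factor [(1 + p ^ L) / (1 - p ^ L)] is at most 2. *)
destruct (pow_lt_1_zero p ltac:(rewrite Rabs_pos_eq; lra) (/ 3) ltac:(lra)) as [L0 HL0].
exists L0; intros L f HL HLp Hf.
specialize (HL0 L HL); rewrite Rabs_pos_eq in HL0 by (apply pow_le; lra).
assert (HpL : 0 <= p ^ L) by (apply pow_le; lra).
apply Rle_trans with (2 * b ^ 2 / D * (INR L * ((1 + p ^ L) / (1 - p ^ L)))).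
- rewrite <- rsum_poisson by (lra || assumption).
  rewrite <- rsum_scal; apply rsum_le; intros l _.
  destruct (Hf (node L l)) as [H0 [H1 H2]]; set (x := cos (node L l)) in *; set (y := f (node L l)) in *.
  assert (H3 : (y * (1 - q)) ^ 2 * k ^ 2 <= b ^ 2).
  { replace (b ^ 2) with (a ^ 2 * k ^ 2) by (unfold k; field; lra).
    apply Rmult_le_compat_r; [lra|]; apply pow_incr; nra. }
  assert (Hx : -1 <= x <= 1) by apply COS_bound.
  assert (Hden : 0 < 1 + p ^ 2 - 2 * p * x).
  { apply Rlt_le_trans with ((1 - p) ^ 2); [apply pow_lt; lra|nra]. }
  assert (Hmain : y ^ 2 * (s * (1 + p ^ 2 - 2 * p * x)) <= 2 * b ^ 2).
  { replace (s * (1 + p ^ 2 - 2 * p * x)) with (s + s * p ^ 2 - 2 * (s * p) * x) by ring.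
    rewrite Hspp, Hsp; unfold s, m; nra. }
  apply Rmult_le_reg_r with (s * (1 + p ^ 2 - 2 * p * x)); [apply Rmult_lt_0_compat; lra|].
  eapply Rle_trans; [exact Hmain|].
  right; transitivity (2 * b ^ 2 / D * (s * (1 - p ^ 2))); [rewrite HpD; field; lra|field; lra].
- apply Rle_trans with (2 * b ^ 2 / D * (INR L * 2)).
  + apply Rmult_le_compat_l; [apply Rlt_le, Rdiv_lt_0_compat; [nra|lra]|].
    apply Rmult_le_compat_l; [apply pos_INR|].
    apply Rmult_le_reg_r with (1 - p ^ L); [lra|].
    unfold Rdiv; rewrite Rmult_assoc, Rinv_l by lra; lra.
  + replace (2 * b ^ 2 / D * (INR L * 2)) with (INR L * (4 * b ^ 2 / D)) by (field; lra).
    apply Rmult_le_compat_l; [apply pos_INR|].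
    apply Rmult_le_reg_r with D; [lra|].
    apply Rle_trans with (4 * b ^ 2); [right; field; lra|].
    apply Rle_trans with (4 * a * b / (1 - q) * (k * (1 - q))); [right; unfold k; field; lra|].
    apply Rmult_le_compat_l; [|exact HD0].
    apply Rlt_le, Rdiv_lt_0_compat; [nra|lra].
Qed.

(** * Powers of an element whose resolvent is controlled in the unit disc *)

Section Powers.
Variable A : cbalg.
Add Ring cba_ring3 : (aring A).
Local Notation embn n := (emb (RtoC (INR n))).

Lemma embn_S n : embn (S n) = (embn n + 1 : A)%A.
Proof. rewrite S_INR, RtoC_plus, emb_add, emb_1; reflexivity. Qed.

Lemma apow_1 n : ((1 : A) ^ n = 1)%A.
Proof. induction n as [|n IH]; simpl; [reflexivity|rewrite IH; ring]. Qed.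

Lemma asum_rmul (f : nat -> A) x n : asum (fun i => f i * x)%A n = (asum f n * x)%A.
Proof. induction n as [|n IH]; simpl; [ring|rewrite IH; ring]. Qed.

Lemma asum_emb (f : nat -> C) n : asum (fun l => emb (f l) : A) n = emb (csum f n).
Proof. induction n as [|n IH]; simpl; [now rewrite emb_0|now rewrite IH, emb_add]. Qed.

(** Discrete Fourier inversion. The bound [J <= L] rules out aliasing, since then [|j - k| < L]. The
    coefficients lie in the algebra because one application needs the factor [Q - 1] in them. *)
Lemma asum_root_extract (W : A) (c : nat -> A) (L k : nat) : (k < L)%nat -> forall J, (J <= L)%nat ->
  asum (fun l => emb (cis (- (INR k * node L l))) *
          asum (fun j => c j * (emb (cis (node L l)) * W) ^ j) J)%A L =
  if Nat.ltb k J then (embn L * (c k * W ^ k))%A else 0%A.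
Proof.
intros Hk; induction J as [|J IH]; intros HJ.
- simpl; rewrite (asum_ext _ _ (fun _ => 0 * 0)%A) by (intros; ring).
  rewrite asum_scal; ring.
- rewrite (asum_ext _ _ (fun l => emb (cis (- (INR k * node L l))) *
     asum (fun j => c j * (emb (cis (node L l)) * W) ^ j) J +
     emb (cis ((INR J - INR k) * node L l)) * (c J * W ^ J))%A).
  2:{ intros l _; simpl asum at 1.
      replace ((INR J - INR k) * node L l) with (- (INR k * node L l) + INR J * node L l) by ring.
      rewrite cis_add, emb_mul, apow_mul, <- emb_pow, cis_pow; ring. }
  rewrite asum_add, IH by lia; rewrite asum_rmul, asum_emb.
  destruct (Nat.ltb_spec k J), (Nat.ltb_spec k (S J)); try lia.
  + rewrite csum_node_sub, emb_0 by lia; ring.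
  + replace J with k by lia.
    rewrite (csum_ext _ (fun _ => RtoC 1)), csum_one; [ring|].
    intros l; rewrite <- cis_0; f_equal; ring.
  + rewrite csum_node_sub, emb_0 by lia; ring.
Qed.

(** Only a polynomial of degree below [L] is inverted; [H] is the function it truncates, and [t]
    bounds the truncation error at each node. *)
Lemma coef_average (W : A) (c H : nat -> A) (L J k : nat) (t : R) :
  (k < J)%nat -> (J <= L)%nat ->
  (forall l, nrm (H l - asum (fun j => c j * (emb (cis (node L l)) * W) ^ j) J)%A <= t) ->
  INR L * nrm (c k * W ^ k)%A <= rsum (fun l => nrm (H l)) L + INR L * t.
Proof.
intros Hk HJ HH.
assert (HL : 0 < INR L) by (apply lt_0_INR; lia).
replace (INR L * nrm (c k * W ^ k)%A) with (nrm (embn L * (c k * W ^ k))%A).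
2:{ rewrite nrm_emb_cancel; [rewrite Cmod_R, Rabs_pos_eq; lra|].
    intros E; apply RtoC_inj in E; lra. }
pose proof (asum_root_extract W c L k ltac:(lia) J HJ) as E.
replace (Nat.ltb k J) with true in E by (symmetry; apply Nat.ltb_lt; lia).
rewrite <- E.
eapply Rle_trans; [apply nrm_asum_le|].
rewrite <- rsum_const.
assert (Hs : forall f g n, rsum f n + rsum g n = rsum (fun i => f i + g i) n).
{ intros f g n; induction n as [|n IH]; simpl; [ring|rewrite <- IH; ring]. }
rewrite Hs; apply rsum_le; intros l _.
eapply Rle_trans; [apply nrm_emb_mul|]; rewrite Cmod_cis, Rmult_1_l.
set (s := asum _ _); specialize (HH l); fold s in HH.
replace s with (H l - (H l - s))%A by ring.
apply nrm_sub_le; [apply Rle_refl|exact HH].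
Qed.

Lemma weighted_geometric2 (z : A) J :
  ((1 - z) * (1 - z) * asum (fun j => (embn j + 1) * z ^ j) J =
   1 - z ^ J * (embn J + 1 - embn J * z))%A.
Proof.
induction J as [|J IH].
- simpl; rewrite emb_0; ring.
- cbn [asum apow]; rewrite embn_S.
  transitivity ((1 - z) * (1 - z) * asum (fun j => (embn j + 1) * z ^ j) J
    + (1 - z) * (1 - z) * ((embn J + 1) * z ^ J))%A; [ring|].
  rewrite IH; ring.
Qed.

Lemma weighted_geometric3 (z : A) J :
  ((1 - z) * (1 - z) * (1 - z) *
     asum (fun j => (embn j + 1) * (embn j + 1 + 1) * z ^ j) J =
   (1 + 1) - z ^ J * ((embn J + 1) * (embn J + 1 + 1) - (1 + 1) * embn J * (embn J + 1 + 1) * z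
     + embn J * (embn J + 1) * (z * z)))%A.
Proof.
induction J as [|J IH].
- simpl; rewrite emb_0; ring.
- cbn [asum apow]; rewrite embn_S.
  set (s := asum _ J) in *.
  transitivity ((1 - z) * (1 - z) * (1 - z) * s
    + (1 - z) * (1 - z) * (1 - z) * ((embn J + 1) * (embn J + 1 + 1) * z ^ J))%A; [ring|].
  rewrite IH; ring.
Qed.

Lemma nrm_embn n : nrm (embn n : A) <= INR n.
Proof.
eapply Rle_trans; [apply nrm_emb|]; rewrite Cmod_R, Rabs_pos_eq; [lra|apply pos_INR].
Qed.

(** Equivalent to a spectral radius below 1. *)
Definition geometric (W : A) := exists m, (0 < m)%nat /\ nrm (W ^ m)%A <= / 2.

Lemma succ_le_pow2 n : INR n + 1 <= 2 ^ n.
Proof. induction n as [|n IH]; [simpl; lra|]. rewrite S_INR; simpl; pose proof (pos_INR n); lra. Qed.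

(** The remainders of the weighted geometric sums are polynomials in [J] of degree at most 2, hence
    the quadratic weight. A single large [J] is enough, as the truncation length can be chosen. *)
Lemma geometric_tail (W : A) : geometric W -> forall e N, 0 < e ->
  exists J, (N <= J)%nat /\ (INR J + 2) ^ 2 * nrm (W ^ J)%A <= e.
Proof.
intros [m [Hm HW]] e N He.
set (c := (4 * INR m + 2) ^ 2).
assert (Hm1 : 1 <= INR m) by (apply (le_INR 1); lia).
assert (Hc : 0 < c) by (apply pow_lt; lra).
destruct (nfloor_ex (c / e)) as [n0 Hn0]; [apply Rlt_le, Rdiv_lt_0_compat; lra|].
set (n := Nat.max n0 N).
(* The exponent [4 n] yields the decay [2^-(4n) <= (n + 1)^-4]: two powers absorb the weight and the
   other two give smallness. *)
exists (m * (4 * n))%nat; split; [nia|].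
assert (Hn : c / e <= INR n + 1).
{ apply Rle_trans with (INR n0 + 1); [lra|].
  apply Rplus_le_compat_r, le_INR; unfold n; lia. }
assert (Hn1 : 0 <= INR n) by apply pos_INR.
assert (H2 := succ_le_pow2 n).
rewrite apow_apow.
assert (Hp : nrm ((W ^ m) ^ (4 * n))%A <= / ((INR n + 1) ^ 4)).
{ eapply Rle_trans; [apply nrm_apow|].
  apply Rle_trans with ((/ 2) ^ (4 * n)); [apply pow_incr; split; [apply nrm_ge_0|exact HW]|].
  rewrite pow_inv; apply Rinv_le_contravar; [apply pow_lt; lra|].
  rewrite Nat.mul_comm, pow_mult; apply pow_incr; lra. }
apply Rle_trans with (c * (INR n + 1) ^ 2 * / ((INR n + 1) ^ 4)).
- apply Rmult_le_compat; [apply pow2_ge_0|apply nrm_ge_0| |exact Hp].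
  unfold c; rewrite <- Rpow_mult_distr; apply pow_incr.
  rewrite !mult_INR; replace (INR 4) with 4 by (simpl; ring); nra.
- replace (c * (INR n + 1) ^ 2 * / ((INR n + 1) ^ 4)) with (c / (INR n + 1) ^ 2) by (field; lra).
  apply Rmult_le_reg_r with ((INR n + 1) ^ 2); [apply pow_lt; lra|].
  unfold Rdiv; rewrite Rmult_assoc, Rinv_l, Rmult_1_r by (apply pow_nonzero; lra).
  apply Rle_trans with (e * (INR n + 1)).
  + apply Rmult_le_reg_l with (/ e); [now apply Rinv_0_lt_compat|].
    rewrite <- Rmult_assoc, Rinv_l by lra; unfold Rdiv in Hn; lra.
  + apply Rmult_le_compat_l; nra.
Qed.

Lemma nrm_two : nrm (1 + 1 : A)%A <= 2.
Proof. replace 2 with (1 + 1) by ring; apply nrm_add_le; apply nrm_1. Qed.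

(** [G w] is the inverse of [1 - w Q] in the unit disc. [HGa] allows a blow-up at the whole circle,
    [HGb] only at the point 1, and by [HGd] the factor [Q - 1] removes even that. *)
Variables (Q : A) (G : C -> A) (a b d : R).
Hypothesis Ha : 0 < a.
Hypothesis Hb : 0 < b.
Hypothesis HG : forall w, Cmod w < 1 -> (G w * (1 - emb w * Q) = 1)%A.
Hypothesis HGa : forall w, Cmod w < 1 -> nrm (G w) * (1 - Cmod w) <= a.
Hypothesis HGb : forall w, Cmod w < 1 -> nrm (G w) * Cmod (Cminus (RtoC 1) w) <= b.
Hypothesis HGd : forall w, Cmod w < 1 -> nrm ((Q - 1) * G w)%A <= d.

Local Notation W q := (emb (RtoC q) * Q)%A.
Local Notation Gc q t := (G (Cmult (cis t) (RtoC q))).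

Lemma Cmod_cis_mul t q : 0 <= q -> Cmod (Cmult (cis t) (RtoC q)) = q.
Proof. intros; rewrite Cmod_mult, Cmod_cis, Cmod_R, Rabs_pos_eq; lra. Qed.

Lemma Gc_inv q t : 0 <= q < 1 -> (Gc q t * (1 - emb (cis t) * W q) = 1)%A.
Proof.
intros Hq; transitivity (Gc q t * (1 - emb (Cmult (cis t) (RtoC q)) * Q))%A.
- rewrite emb_mul; ring.
- apply HG; rewrite Cmod_cis_mul; lra.
Qed.

Lemma nrm_apow_cis t (x : A) n : nrm ((emb (cis t) * x) ^ n)%A <= nrm (x ^ n)%A.
Proof.
rewrite apow_mul, <- emb_pow, cis_pow.
eapply Rle_trans; [apply nrm_emb_mul|]; rewrite Cmod_cis; lra.
Qed.

Lemma tail_bound (x y W0 : A) (g u v : R) (J : nat) t :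
  nrm x <= g -> nrm y <= u * v ->
  nrm (x * ((emb (cis t) * W0) ^ J * y))%A <= g * (u * (v * nrm (W0 ^ J)%A)).
Proof.
intros Hx Hy; apply nrm_mul_le; [exact Hx|].
replace (u * (v * nrm (W0 ^ J)%A)) with (nrm (W0 ^ J)%A * (u * v)) by ring.
apply nrm_mul_le; [apply nrm_apow_cis|exact Hy].
Qed.

Section Inversion.
Variables (q s : R) (L0 : nat).
Hypothesis Hq : 0 <= q < 1.
Hypothesis Hgeo : geometric (W q).
Hypothesis Havg : forall L, (L0 <= L)%nat -> (0 < L)%nat ->
  rsum (fun l => nrm (Gc q (node L l)) ^ 2) L <= INR L * s.

Lemma nrm_Gc t : nrm (Gc q t) <= a / (1 - q).
Proof.
apply Rmult_le_reg_r with (1 - q); [lra|].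
unfold Rdiv; rewrite Rmult_assoc, Rinv_l, Rmult_1_r by lra.
pose proof (HGa (Cmult (cis t) (RtoC q))) as H; rewrite Cmod_cis_mul in H; lra.
Qed.

Lemma nrm_cisW t : nrm (emb (cis t) * W q)%A <= nrm (W q).
Proof. eapply Rle_trans; [apply nrm_emb_mul|]; rewrite Cmod_cis; lra. Qed.

(** [(k + 1) (q Q)^k] is the [k]-th Taylor coefficient of [(1 - z q Q)^-2], whose norm at a node is
    at most the squared norm of [G]. The average [s] is a parameter since two values are used: a
    crude one to propagate [geometric], then the sharp one. *)
Lemma power_of_average k : INR (S k) * nrm (W q ^ k)%A <= s.
Proof.
set (g := a / (1 - q)).
assert (Hg : forall t, nrm (Gc q t) <= g) by apply nrm_Gc.
assert (Hg0 : 0 <= g) by (eapply Rle_trans; [apply nrm_ge_0|apply (Hg 0)]).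
set (w := nrm (W q)); assert (Hw : 0 <= w) by apply nrm_ge_0.
set (e0 := g * g * (1 + w)).
assert (He0 : 0 <= e0) by (unfold e0; apply Rmult_le_pos; nra).
apply le_epsilon; intros e He.
(* [J] is both the number of terms kept and the number of nodes: it must exceed [k], reach [L0], and
   make the tail at most [e]. *)
destruct (geometric_tail _ Hgeo (e / (e0 + 1)) (S k + L0)%nat) as [J [HJ HJe]].
{ apply Rdiv_lt_0_compat; lra. }
assert (HJ1 : 0 < INR J) by (apply lt_0_INR; lia).
assert (Htail : forall l, nrm (Gc q (node J l) * Gc q (node J l)
   - asum (fun j => (embn j + 1) * (emb (cis (node J l)) * W q) ^ j) J)%A <= e).
{ intros l; set (t := node J l).
  set (z := (emb (cis t) * W q)%A).
  set (x := Gc q t).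
  assert (Hx : (x * (1 - z) = 1)%A) by (apply Gc_inv; exact Hq).
  replace (x * x - asum (fun j => (embn j + 1) * z ^ j) J)%A
    with (x * x * (z ^ J * (embn J + 1 - embn J * z)))%A.
  2:{ transitivity (x * x - x * x * ((1 - z) * (1 - z) * asum (fun j => (embn j + 1) * z ^ j) J))%A.
      - rewrite weighted_geometric2; ring.
      - transitivity (x * x - (x * (1 - z)) * (x * (1 - z)) * asum (fun j => (embn j + 1) * z ^ j) J)%A; [ring|].
        rewrite Hx; ring. }
  eapply Rle_trans; [apply (tail_bound _ _ _ (g * g) (1 + w) ((INR J + 2) ^ 2))|].
  - apply nrm_mul_le; apply Hg.
  - apply Rle_trans with (INR J + 1 + INR J * w).
    + apply nrm_sub_le; [apply nrm_add_le; [apply nrm_embn|apply nrm_1]|].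
      apply nrm_mul_le; [apply nrm_embn|apply nrm_cisW].
    + apply Rle_trans with ((1 + w) * (INR J + 1)); [nra|].
      apply Rmult_le_compat_l; nra.
  - apply Rle_trans with (e0 * (e / (e0 + 1))).
    + unfold e0 at 1; rewrite (Rmult_assoc (g * g)).
      apply Rmult_le_compat_l; [nra|]; apply Rmult_le_compat_l; [lra|exact HJe].
    + apply Rmult_le_reg_r with (e0 + 1); [lra|].
      replace (e0 * (e / (e0 + 1)) * (e0 + 1)) with (e0 * e) by (field; lra); nra. }
pose proof (coef_average (W q) (fun j => embn j + 1)%A
  (fun l => Gc q (node J l) * Gc q (node J l))%A J J k e ltac:(lia) (le_n J) Htail) as H; cbv beta in H.
replace (nrm ((embn k + 1) * W q ^ k)%A) with (INR (S k) * nrm (W q ^ k)%A) in H.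
2:{ rewrite <- embn_S, nrm_emb_cancel; [rewrite Cmod_R, Rabs_pos_eq; [reflexivity|apply pos_INR]|].
    intros E; apply RtoC_inj in E; now apply not_0_INR in E. }
apply Rmult_le_reg_l with (INR J); [exact HJ1|].
eapply Rle_trans; [exact H|].
rewrite Rmult_plus_distr_l; apply Rplus_le_compat_r.
eapply Rle_trans; [|apply (Havg J); lia].
apply rsum_le; intros l _; simpl; rewrite Rmult_1_r; apply nrm_mul.
Qed.

(** The coefficients of [2 (Q - 1) (1 - z q Q)^-3]. One of the three resolvents is paired with
    [Q - 1] and bounded by [d], so the same average of two resolvents as before suffices, while the
    coefficient gains a further factor [k + 2]. *)
Lemma difference_of_average k :
  INR (S k) * INR (S (S k)) * nrm ((Q - 1) * W q ^ k)%A <= 2 * d * s.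
Proof.
set (g := a / (1 - q)).
assert (Hg : forall t, nrm (Gc q t) <= g) by apply nrm_Gc.
assert (Hg0 : 0 <= g) by (eapply Rle_trans; [apply nrm_ge_0|apply (Hg 0)]).
assert (HQG : forall t, nrm ((Q - 1) * Gc q t)%A <= d).
{ intros t; apply HGd; rewrite Cmod_cis_mul; lra. }
assert (Hd0 : 0 <= d) by (eapply Rle_trans; [apply nrm_ge_0|apply (HQG 0)]).
set (w := nrm (W q)); assert (Hw : 0 <= w) by apply nrm_ge_0.
set (e0 := d * (g * g) * (2 * (1 + w) ^ 2)).
assert (He0 : 0 <= e0) by (unfold e0; pose proof (pow2_ge_0 (1 + w)); apply Rmult_le_pos; [apply Rmult_le_pos; nra|lra]).
apply le_epsilon; intros e He.
destruct (geometric_tail _ Hgeo (e / (e0 + 1)) (S k + L0)%nat) as [J [HJ HJe]].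
{ apply Rdiv_lt_0_compat; lra. }
assert (HJ1 : 0 < INR J) by (apply lt_0_INR; lia).
set (cj := fun j => ((embn j + 1) * (embn j + 1 + 1) * (Q - 1) : A)%A).
assert (Htail : forall l, nrm ((1 + 1) * ((Q - 1) * Gc q (node J l)) * (Gc q (node J l) * Gc q (node J l))
   - asum (fun j => cj j * (emb (cis (node J l)) * W q) ^ j) J)%A <= e).
{ intros l; set (t := node J l).
  set (z := (emb (cis t) * W q)%A).
  set (x := Gc q t).
  assert (Hx : (x * (1 - z) = 1)%A) by (apply Gc_inv; exact Hq).
  set (s3 := asum (fun j => (embn j + 1) * (embn j + 1 + 1) * z ^ j)%A J).
  replace (asum (fun j => cj j * z ^ j)%A J) with ((Q - 1) * s3)%A.
  2:{ unfold s3; rewrite <- asum_scal; apply asum_ext; intros; unfold cj; ring. }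
  set (r := ((embn J + 1) * (embn J + 1 + 1) - (1 + 1) * embn J * (embn J + 1 + 1) * z
     + embn J * (embn J + 1) * (z * z))%A).
  assert (Hs3 : ((1 - z) * (1 - z) * (1 - z) * s3 = (1 + 1) - z ^ J * r)%A)
    by apply weighted_geometric3.
  replace ((1 + 1) * ((Q - 1) * x) * (x * x) - (Q - 1) * s3)%A
    with ((Q - 1) * x * (x * x) * (z ^ J * r))%A.
  2:{ transitivity ((Q - 1) * x * (x * x) * ((1 + 1) - (1 - z) * (1 - z) * (1 - z) * s3))%A.
      - rewrite Hs3; ring.
      - transitivity ((1 + 1) * ((Q - 1) * x) * (x * x)
          - (Q - 1) * ((x * (1 - z)) * (x * (1 - z)) * (x * (1 - z)) * s3))%A; [ring|].
        rewrite Hx; ring. }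
  eapply Rle_trans; [apply (tail_bound _ _ _ (d * (g * g)) (2 * (1 + w) ^ 2) ((INR J + 2) ^ 2))|].
  - apply nrm_mul_le; [apply HQG|apply nrm_mul_le; apply Hg].
  - set (n := INR J) in *.
    assert (Hz : nrm z <= w) by apply nrm_cisW.
    assert (H1 : nrm (embn J + 1 : A)%A <= n + 1) by (apply nrm_add_le; [apply nrm_embn|apply nrm_1]).
    assert (H2 : nrm (embn J + 1 + 1 : A)%A <= n + 1 + 1) by (apply nrm_add_le; [exact H1|apply nrm_1]).
    apply Rle_trans with ((n + 1) * (n + 1 + 1) + 2 * n * (n + 1 + 1) * w + n * (n + 1) * (w * w)).
    + unfold r; apply nrm_add_le; [apply nrm_sub_le|].
      * now apply nrm_mul_le.
      * apply nrm_mul_le; [apply nrm_mul_le; [apply nrm_mul_le; [apply nrm_two|apply nrm_embn]|]|]; assumption.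
      * apply nrm_mul_le; apply nrm_mul_le; try assumption; apply nrm_embn.
    + assert (0 <= n * w) by nra. assert (0 <= n * (w * w)) by nra.
      assert (0 <= n * n) by nra. assert (0 <= n * n * w) by nra. assert (0 <= n * n * (w * w)) by nra.
      nra.
  - apply Rle_trans with (e0 * (e / (e0 + 1))).
    + unfold e0 at 1; rewrite (Rmult_assoc (d * (g * g))).
      apply Rmult_le_compat_l; [apply Rmult_le_pos; nra|].
      apply Rmult_le_compat_l; [pose proof (pow2_ge_0 (1 + w)); lra|exact HJe].
    + apply Rmult_le_reg_r with (e0 + 1); [lra|].
      replace (e0 * (e / (e0 + 1)) * (e0 + 1)) with (e0 * e) by (field; lra); nra. }
pose proof (coef_average (W q) cj _ J J k e ltac:(lia) (le_n J) Htail) as H.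
replace (nrm (cj k * W q ^ k)%A) with (INR (S k) * INR (S (S k)) * nrm ((Q - 1) * W q ^ k)%A) in H.
2:{ unfold cj; rewrite <- !embn_S.
    replace (embn (S k) * embn (S (S k)) * (Q - 1) * W q ^ k)%A
      with (emb (Cmult (RtoC (INR (S k))) (RtoC (INR (S (S k))))) * ((Q - 1) * W q ^ k))%A
      by (rewrite emb_mul; ring).
    rewrite <- RtoC_mult, nrm_emb_cancel.
    - rewrite Cmod_R, Rabs_pos_eq; [reflexivity|apply Rmult_le_pos; apply pos_INR].
    - intros E; apply RtoC_inj in E;
      apply Rmult_integral in E; destruct E as [E|E]; now apply not_0_INR in E. }
apply Rmult_le_reg_l with (INR J); [exact HJ1|].
eapply Rle_trans; [exact H|].
rewrite Rmult_plus_distr_l; apply Rplus_le_compat_r.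
apply Rle_trans with (2 * d * (INR J * s)); [|right; ring].
eapply Rle_trans; [|apply Rmult_le_compat_l; [nra|apply (Havg J); lia]].
rewrite <- rsum_scal.
apply rsum_le; intros l _; apply nrm_mul_le; [apply nrm_mul_le; [apply nrm_two|apply HQG]|].
simpl; rewrite Rmult_1_r; apply nrm_mul.
Qed.
End Inversion.

Lemma W_pow q n : (W q ^ n = emb (RtoC (q ^ n)) * Q ^ n)%A.
Proof. now rewrite apow_mul, <- emb_pow, RtoC_pow. Qed.

Lemma nrm_W_pow q n : 0 <= q -> nrm (W q ^ n)%A <= q ^ n * nrm (Q ^ n)%A.
Proof.
intros Hq; rewrite W_pow; eapply Rle_trans; [apply nrm_emb_mul|].
rewrite Cmod_R, Rabs_pos_eq; [lra|now apply pow_le].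
Qed.

Lemma nrm_W_pow_eq q n : 0 < q -> nrm (W q ^ n)%A = q ^ n * nrm (Q ^ n)%A.
Proof.
intros Hq; assert (0 < q ^ n) by now apply pow_lt.
rewrite W_pow, nrm_emb_cancel; [rewrite Cmod_R, Rabs_pos_eq; lra|].
intros E; apply RtoC_inj in E; lra.
Qed.

Lemma bernoulli_half n : (0 < n)%nat -> / 2 <= (1 - / (2 * INR n)) ^ n.
Proof.
intros Hn; assert (Hn1 : 1 <= INR n) by (apply (le_INR 1); lia).
set (x := / (2 * INR n)).
assert (Hx : 0 < x <= / 2).
{ split; [apply Rinv_0_lt_compat; lra|apply Rinv_le_contravar; lra]. }
assert (H : forall m, 1 - INR m * x <= (1 - x) ^ m).
{ induction m as [|m IH]; [simpl; lra|]; rewrite S_INR; simpl.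
  pose proof (pos_INR m); apply Rle_trans with ((1 - x) * (1 - INR m * x)); [nra|].
  apply Rmult_le_compat_l; lra. }
eapply Rle_trans; [|apply H]; right; unfold x; field; lra.
Qed.

(* Boundedness of [G] on [|w| = q] forces [(k+1) q^k |Q^k|] to be bounded, so that geometric decay
   of [q^k Q^k] persists for a slightly larger [q], by a factor uniform below [q1]. *)
Lemma geometric_all q1 : 0 < q1 < 1 -> geometric (W q1).
Proof.
intros Hq1.
set (g := a / (1 - q1)).
assert (Hg0 : 0 < g) by (apply Rdiv_lt_0_compat; lra).
(* With [k >= 4 g^2], the bound [(k + 1) q^k |Q^k| <= g^2] gives [q^k |Q^k| <= 1/4]. Replacing [q]
   by [q / rho] costs at most a factor 2, as [rho ^ k >= 1/2]. *)
destruct (nfloor_ex (4 * (g * g))) as [k0 Hk0]; [nra|].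
set (k := S k0); assert (Hk : 4 * (g * g) <= INR k) by (unfold k; rewrite S_INR; lra).
assert (HkS : 1 <= INR k) by (apply (le_INR 1); unfold k; lia).
set (rho := 1 - / (2 * INR k)).
assert (Hx : 0 < / (2 * INR k) <= / 2).
{ split; [apply Rinv_0_lt_compat; lra|apply Rinv_le_contravar; lra]. }
assert (Hrho : / 2 <= rho < 1) by (unfold rho; lra).
assert (Hrk : / 2 <= rho ^ k) by (apply bernoulli_half; unfold k; lia).
assert (Hmono : forall q q', 0 < q' <= q -> geometric (W q) -> geometric (W q')).
{ intros q q' Hqq [m [Hm HW]]; exists m; split; [exact Hm|].
  eapply Rle_trans; [apply nrm_W_pow; lra|].
  rewrite nrm_W_pow_eq in HW by lra.
  eapply Rle_trans; [|exact HW].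
  apply Rmult_le_compat_r; [apply nrm_ge_0|]; apply pow_incr; lra. }
assert (Hstep : forall q, 0 < q <= q1 -> geometric (W q) -> geometric (W (q / rho))).
{ intros q Hq Hgq; exists k; split; [unfold k; lia|].
  assert (Hqr : 0 < q / rho) by (apply Rdiv_lt_0_compat; lra).
  assert (Hs : INR (S k) * nrm (W q ^ k)%A <= g * g).
  { apply (power_of_average q (g * g) 0); [lra|exact Hgq|].
    intros L _ _; rewrite <- rsum_const; apply rsum_le; intros l _.
    simpl; rewrite Rmult_1_r.
    assert (H : nrm (Gc q (node L l)) <= g).
    { apply Rle_trans with (a / (1 - q)); [apply nrm_Gc; lra|].
      apply Rmult_le_compat_l; [lra|]; apply Rinv_le_contravar; lra. }
    apply Rmult_le_compat; auto using nrm_ge_0. }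
  rewrite nrm_W_pow_eq in Hs by lra.
  rewrite nrm_W_pow_eq by lra.
  set (N := nrm (Q ^ k)%A) in *.
  assert (HqN : 0 <= q ^ k * N) by (apply Rmult_le_pos; [apply pow_le; lra|apply nrm_ge_0]).
  assert (Hs2 : q ^ k * N <= / 4).
  { rewrite S_INR in Hs; nra. }
  unfold Rdiv; rewrite Rpow_mult_distr, pow_inv.
  apply Rmult_le_reg_r with (rho ^ k); [lra|].
  replace (q ^ k * / rho ^ k * N * rho ^ k) with (q ^ k * N) by (field; lra).
  lra. }
(* The starting radius is so small that the first power of [q0 Q] already has norm at most [1/2]. *)
set (q0 := Rmin q1 (/ (2 * (nrm Q + 1)))).
assert (HnQ := nrm_ge_0 A Q).
assert (Hi : 0 < / (2 * (nrm Q + 1))) by (apply Rinv_0_lt_compat; lra).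
assert (Hq0 : 0 < q0 <= q1).
{ split; [apply Rmin_pos; lra|apply Rmin_l]. }
assert (Hg00 : geometric (W q0)).
{ exists 1%nat; split; [lia|].
  eapply Rle_trans; [apply nrm_W_pow; lra|]; simpl.
  replace (Q * 1)%A with Q by ring.
  apply Rle_trans with (/ (2 * (nrm Q + 1)) * nrm Q).
  - rewrite Rmult_1_r; apply Rmult_le_compat_r; [exact HnQ|apply Rmin_r].
  - apply Rmult_le_reg_l with (2 * (nrm Q + 1)); [lra|].
    rewrite <- Rmult_assoc, Rinv_r by lra; lra. }
assert (Hall : forall j, geometric (W (Rmin q1 (q0 / rho ^ j)))).
{ induction j as [|j IH].
  - simpl; unfold Rdiv; rewrite Rinv_1, Rmult_1_r, Rmin_right; [exact Hg00|lra].
  - set (x := Rmin q1 (q0 / rho ^ j)) in *.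
    assert (Hrj : 0 < rho ^ j) by (apply pow_lt; lra).
    assert (Hxp : 0 < x) by (apply Rmin_pos; [lra|apply Rdiv_lt_0_compat; lra]).
    assert (Hx1 : x <= q1) by apply Rmin_l.
    apply (Hmono (x / rho)); [|apply Hstep; [lra|exact IH]].
    assert (E : q0 / rho ^ S j = (q0 / rho ^ j) / rho) by (simpl; field; split; [apply pow_nonzero|]; lra).
    split; [apply Rmin_pos; [lra|rewrite E; apply Rdiv_lt_0_compat; [apply Rdiv_lt_0_compat|]; lra]|].
    rewrite E; unfold x; unfold Rmin at 2; destruct (Rle_dec q1 (q0 / rho ^ j)).
    + eapply Rle_trans; [apply Rmin_l|].
      apply Rmult_le_reg_r with rho; [lra|]; unfold Rdiv; rewrite Rmult_assoc, Rinv_l by lra; nra.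
    + apply Rmin_r. }
destruct (pow_lt_1_zero rho ltac:(rewrite Rabs_pos_eq; lra) q0 ltac:(lra)) as [j Hj].
specialize (Hj j (le_n j)); rewrite Rabs_pos_eq in Hj by (apply pow_le; lra).
specialize (Hall j); rewrite Rmin_left in Hall; [exact Hall|].
assert (Hrj : 0 < rho ^ j) by (apply pow_lt; lra).
apply Rmult_le_reg_r with (rho ^ j); [lra|].
unfold Rdiv; rewrite Rmult_assoc, Rinv_l by lra; nra.
Qed.

(** With [q = 1 - 1 / (2 (k + 1))] one has [q^k >= 1/2], and the average of the squared norm of [G]
    is at most [4 a b / (1 - q) = 8 a b (k + 1)]. The linear growth cancels against the factor
    [k + 1] of the coefficient; the bound [HGa] alone would give quadratic growth. *)
Lemma power_and_difference_bounds k :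
  nrm (Q ^ k)%A <= 16 * a * b /\ INR (S k) * nrm ((Q - 1) * Q ^ k)%A <= 32 * a * b * d.
Proof.
set (n := INR (S k)).
assert (Hn : 1 <= n) by (apply (le_INR 1); lia).
set (q := 1 - / (2 * n)).
assert (Hi : 0 < / (2 * n) <= / 2).
{ split; [apply Rinv_0_lt_compat; lra|apply Rinv_le_contravar; lra]. }
assert (Hq : / 2 <= q < 1) by (unfold q; lra).
assert (Hqk : / 2 <= q ^ k).
{ apply Rle_trans with (q ^ S k); [apply bernoulli_half; lia|].
  simpl; rewrite <- (Rmult_1_l (q ^ k)) at 2; apply Rmult_le_compat_r; [apply pow_le|]; lra. }
destruct (rsum_min_sqr q a b ltac:(lra) Ha Hb) as [L0 HL0].
assert (Havg : forall L, (L0 <= L)%nat -> (0 < L)%nat ->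
  rsum (fun l => nrm (Gc q (node L l)) ^ 2) L <= INR L * (4 * a * b / (1 - q))).
{ intros L H1 H2; apply (HL0 L (fun t => nrm (Gc q t)) H1 H2).
  intros t; set (w := Cmult (cis t) (RtoC q)).
  assert (Hw : Cmod w = q) by (apply Cmod_cis_mul; lra).
  split; [apply nrm_ge_0|split].
  - pose proof (HGa w) as H; rewrite Hw in H; apply H; lra.
  - replace (1 + q ^ 2 - 2 * q * cos t) with (Cmod (Cminus (RtoC 1) w) ^ 2).
    + rewrite <- Rpow_mult_distr; apply pow_incr; split.
      * apply Rmult_le_pos; [apply nrm_ge_0|apply Cmod_ge_0].
      * apply HGb; lra.
    + rewrite Cmod2_alt; unfold w, cis; simpl.
      pose proof (sin2_cos2 t) as Hsc; unfold Rsqr in Hsc.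
      transitivity (1 - 2 * q * cos t + q ^ 2 * (sin t * sin t + cos t * cos t)); [ring|].
      rewrite Hsc; ring. }
assert (E : 4 * a * b / (1 - q) = 8 * a * b * n) by (unfold q; field; lra).
rewrite E in Havg.
assert (Hgeo := geometric_all q ltac:(lra)).
pose proof (power_of_average q _ L0 ltac:(lra) Hgeo Havg k) as H1.
pose proof (difference_of_average q _ L0 ltac:(lra) Hgeo Havg k) as H2.
rewrite nrm_W_pow_eq in H1 by lra.
replace (nrm ((Q - 1) * W q ^ k)%A) with (q ^ k * nrm ((Q - 1) * Q ^ k)%A) in H2.
2:{ rewrite W_pow.
    replace ((Q - 1) * (emb (RtoC (q ^ k)) * Q ^ k))%A with (emb (RtoC (q ^ k)) * ((Q - 1) * Q ^ k))%A by ring.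
    rewrite nrm_emb_cancel; [rewrite Cmod_R, Rabs_pos_eq; lra|].
    intros E0; apply RtoC_inj in E0; lra. }
fold n in H1, H2; rewrite (S_INR (S k)) in H2; fold n in H2.
set (x := nrm (Q ^ k)%A) in *; set (y := nrm ((Q - 1) * Q ^ k)%A) in *.
assert (Hx : 0 <= x) by apply nrm_ge_0; assert (Hy : 0 <= y) by apply nrm_ge_0.
split.
- apply Rmult_le_reg_l with (n * / 2); [nra|].
  replace (n * / 2 * (16 * a * b)) with (8 * a * b * n) by field.
  eapply Rle_trans; [|exact H1].
  rewrite Rmult_assoc; apply Rmult_le_compat_l; [lra|]; apply Rmult_le_compat_r; lra.
- apply Rmult_le_reg_l with (n * / 2); [nra|].
  replace (n * / 2 * (32 * a * b * d)) with (2 * d * (8 * a * b * n)) by field.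
  eapply Rle_trans; [|exact H2].
  replace (n * / 2 * (n * y)) with (n * n * (/ 2 * y)) by ring.
  apply Rmult_le_compat; [nra|nra|nra|apply Rmult_le_compat_r; lra].
Qed.
End Powers.

(** * From the resolvent of a generator to the Euler approximants *)

Lemma choice_fun (U V : Type) (P : U -> V -> Prop) :
  (forall x, exists y, P x y) -> exists f, forall x, P x (f x).
Proof.
intros H; exists (fun x => proj1_sig (constructive_indefinite_description _ (H x))).
intros x; apply proj2_sig.
Qed.

Definition cone (kappa : R) (h : C) : Prop := 0 < Re h /\ Rabs (Im h) <= kappa * Re h.

Lemma Cmod_Re_Im_le h : Cmod h <= Rabs (Re h) + Rabs (Im h).
Proof.
apply Rsqr_incr_0_var; [|pose proof (Rabs_pos (Re h)); pose proof (Rabs_pos (Im h)); lra].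
replace (Rsqr (Cmod h)) with (Cmod h ^ 2) by (unfold Rsqr; ring).
rewrite Cmod2_alt, <- (pow2_abs (Re h)), <- (pow2_abs (Im h)); unfold Rsqr.
pose proof (Rabs_pos (Re h)); pose proof (Rabs_pos (Im h)); nra.
Qed.

Lemma Re_le_Cmod h : Re h <= Cmod h.
Proof. eapply Rle_trans; [apply Rle_abs|apply re_le_Cmod]. Qed.

Lemma cone_neq_0 k h : cone k h -> h <> RtoC 0.
Proof. intros [H _] E; rewrite E in H; simpl in H; lra. Qed.

Lemma cone_Cmod_pos k h : cone k h -> 0 < Cmod h.
Proof. intros H; apply Cmod_gt_0; eapply cone_neq_0; eassumption. Qed.

Lemma Re_Cinv_pos h : 0 < Re h -> 0 < Re (Cinv h).
Proof.
destruct h as [x y]; simpl; intros H; apply Rdiv_lt_0_compat; [exact H|].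
assert (0 < x * x) by nra; assert (0 <= y * y) by nra; nra.
Qed.

(** Both [|h| - Re h] and the imaginary part are at most [|Im h| <= k Re h]. *)
Lemma cone_dist_Cmod k h : cone k h -> Cmod (Cminus h (RtoC (Cmod h))) <= 2 * k * Cmod h.
Proof.
intros [H1 H2].
assert (Hm : Re h <= Cmod h) by apply Re_le_Cmod.
assert (Hs : Cmod h <= Re h + Rabs (Im h)).
{ pose proof (Cmod_Re_Im_le h) as H; rewrite (Rabs_pos_eq (Re h)) in H by lra; exact H. }
eapply Rle_trans; [apply Cmod_Re_Im_le|].
replace (Re (Cminus h (RtoC (Cmod h)))) with (Re h - Cmod h) by (destruct h; unfold Re, Cminus, Cplus, Copp, RtoC; simpl; ring).
replace (Im (Cminus h (RtoC (Cmod h)))) with (Im h) by (destruct h; unfold Im, Cminus, Cplus, Copp, RtoC; simpl; ring).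
rewrite (Rabs_left1 (Re h - Cmod h)) by lra.
assert (0 <= k) by (pose proof (Rabs_pos (Im h)); nra).
nra.
Qed.

Section Resolvent.
Variable A : cbalg.
Add Ring cba_ring4 : (aring A).
Variables (R0 : C -> A) (a b : R).
Hypothesis Ha : 0 < a.
Hypothesis Hb : 0 < b.
Hypothesis resolvent_id : forall m n, 0 < Re m -> 0 < Re n ->
  (R0 m - R0 n = emb (Cminus n m) * (R0 m * R0 n))%A.
Hypothesis resolvent_Re : forall m, 0 < Re m -> nrm (R0 m) * Re m <= a.
Hypothesis resolvent_mod : forall m, 0 < Re m -> Cmod m * nrm (R0 m) <= b.

(* The resolvent [(1 - h A)^-1] of the generator [A], which itself never appears; [yosida h] is
   [A (1 - h A)^-1]. *)
Definition euler_op (h : C) : A := (emb (Cinv h) * R0 (Cinv h))%A.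

(* [1 + w (1 - w - h A)^-1]; the resolvent at [(1 - w) / h] is reached from the one at
   [(1 - w) / |h|], in the right half-plane, by a Neumann series. *)
Lemma one_minus_euler_inverse (h w : C) : cone (/ (4 * b)) h -> Cmod w < 1 ->
  exists G : A, (G * (1 - emb w * euler_op h) = 1)%A /\
    nrm G * (1 - Cmod w) <= 1 + 2 * a /\
    nrm G * Cmod (Cminus (RtoC 1) w) <= 2 + 2 * b /\
    nrm ((euler_op h - 1) * G)%A <= 2 * b + 1.
Proof.
intros Hh Hw.
assert (Hr : 0 < Cmod h) by (eapply cone_Cmod_pos; eassumption).
assert (Hh0 : h <> RtoC 0) by (eapply cone_neq_0; eassumption).
assert (Hr0 : RtoC (Cmod h) <> RtoC 0) by (intros E; apply RtoC_inj in E; lra).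
pose proof (Re_le_Cmod w) as HRw.
pose proof (Cmod_ge_0 w) as Hw0.
set (r := Cmod h) in *.
set (m := Cmult (RtoC (/ r)) (Cminus (RtoC 1) w)).
set (u := Cmod (Cminus (RtoC 1) w)).
assert (Hmod : Cmod m = / r * u).
{ unfold m, u; rewrite Cmod_mult, Cmod_R, Rabs_pos_eq; [reflexivity|]; apply Rlt_le, Rinv_0_lt_compat; exact Hr. }
assert (Hir : 0 < / r) by now apply Rinv_0_lt_compat.
assert (HRm : Re m = / r * (1 - Re w)).
{ unfold m, Re, Cmult, Cminus, Cplus, Copp, RtoC; simpl; ring. }
assert (HRm0 : 0 < Re m) by (rewrite HRm; apply Rmult_lt_0_compat; lra).
set (n := Cinv h).
assert (Hn0 : 0 < Re n) by (apply Re_Cinv_pos, Hh).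
(* [m - c = (1 - w) / h], so [c] is the displacement for the Neumann series. In the cone
   [|1 - r / h| <= 2 / (4 b)], which with [|m| |R0 m| <= b] gives [1/2]; this dictates the opening
   [1 / (4 b)]. *)
set (c := Cmult (Cminus (RtoC 1) (Cmult (RtoC r) n)) m).
assert (Hc : nrm (emb c * R0 m)%A <= / 2).
{ eapply Rle_trans; [apply nrm_emb_mul|].
  unfold c; rewrite Cmod_mult.
  assert (H1 : Cmod (Cminus (RtoC 1) (Cmult (RtoC r) n)) <= / (2 * b)).
  { replace (Cminus (RtoC 1) (Cmult (RtoC r) n)) with (Cmult (Cminus h (RtoC r)) n)
      by (unfold n; field; exact Hh0).
    rewrite Cmod_mult; unfold n; rewrite Cmod_inv by exact Hh0; fold r.
    apply Rmult_le_reg_r with r; [exact Hr|]; rewrite Rmult_assoc, Rinv_l, Rmult_1_r by lra.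
    eapply Rle_trans; [apply (cone_dist_Cmod _ _ Hh)|]; fold r; right; field; lra. }
  apply Rle_trans with (/ (2 * b) * b); [|right; field; lra].
  rewrite Rmult_assoc; apply Rmult_le_compat; [apply Cmod_ge_0| |exact H1|apply resolvent_mod, HRm0].
  apply Rmult_le_pos; [apply Cmod_ge_0|apply nrm_ge_0]. }
destruct (neumann A _ Hc) as [E [HE HE2]].
set (q := R0 m) in *; set (p := R0 n).
(* This is the resolvent identity between [1 / h] and [(1 - w) / h], with [q * E] as the resolvent
   at the latter point. That point may leave the right half-plane, so [R0] is not evaluated
   there. *)
assert (Hp : (p = E * (q - emb (Cmult w n) * (p * q)))%A).
{ transitivity (p * (E * (1 - emb c * q)))%A; [rewrite HE; ring|].
  transitivity (E * (p - emb c * (p * q)))%A; [ring|]; f_equal.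
  assert (Hri : (p - q = emb (Cminus m n) * (p * q))%A) by (apply resolvent_id; assumption).
  transitivity (q + (p - q) - emb c * (p * q))%A; [ring|]; rewrite Hri.
  transitivity (q - (emb c - emb (Cminus m n)) * (p * q))%A; [ring|].
  rewrite <- emb_sub; do 3 f_equal.
  unfold c, m, n; rewrite RtoC_inv by lra; field; split; assumption. }
set (X := (emb n * (q * E))%A).
set (G := (1 + emb w * X)%A).
assert (HQG : (euler_op h * G = X)%A).
{ unfold G, X, euler_op; fold n; fold p.
  transitivity (emb n * (p + emb w * emb n * (p * q * E)))%A; [ring|].
  rewrite <- emb_mul; f_equal; rewrite Hp at 1; ring. }
assert (HX : nrm X <= 2 * / r * nrm q).
{ unfold X; eapply Rle_trans; [apply nrm_emb_mul|].
  unfold n; rewrite Cmod_inv by exact Hh0; fold r.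
  replace (2 * / r * nrm q) with (/ r * (nrm q * 2)) by ring.
  apply Rmult_le_compat_l; [lra|]; apply nrm_mul_le; [lra|exact HE2]. }
assert (Hqa : / r * nrm q * (1 - Cmod w) <= a).
{ eapply Rle_trans; [|apply (resolvent_Re m HRm0)]; fold q; rewrite HRm.
  replace (nrm q * (/ r * (1 - Re w))) with (/ r * nrm q * (1 - Re w)) by ring.
  apply Rmult_le_compat_l; [apply Rmult_le_pos; [lra|apply nrm_ge_0]|lra]. }
assert (Hqb : / r * nrm q * u <= b).
{ eapply Rle_trans; [|apply (resolvent_mod m HRm0)]; fold q; rewrite Hmod; right; ring. }
assert (HG : nrm G <= 1 + nrm X).
{ unfold G; apply nrm_add_le; [apply nrm_1|].
  eapply Rle_trans; [apply nrm_emb_mul|].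
  rewrite <- (Rmult_1_l (nrm X)) at 2; apply Rmult_le_compat_r; [apply nrm_ge_0|lra]. }
assert (Hu : 0 <= u <= 2).
{ split; [apply Cmod_ge_0|]; unfold u, Cminus.
  eapply Rle_trans; [apply Cmod_triangle|]; rewrite Cmod_opp, Cmod_1; lra. }
exists G; split; [|split; [|split]].
- transitivity (G - emb w * (euler_op h * G))%A; [ring|].
  rewrite HQG; unfold G; ring.
- apply Rle_trans with ((1 + 2 * / r * nrm q) * (1 - Cmod w)); [apply Rmult_le_compat_r; lra|].
  lra.
- apply Rle_trans with ((1 + 2 * / r * nrm q) * u); [apply Rmult_le_compat_r; lra|].
  lra.
- replace ((euler_op h - 1) * G)%A with (emb (Cminus (RtoC 1) w) * X - 1)%A.
  2:{ transitivity (euler_op h * G - G)%A; [|ring]; rewrite HQG; unfold G.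
      rewrite emb_sub, emb_1; ring. }
  apply nrm_sub_le; [|apply nrm_1].
  eapply Rle_trans; [apply nrm_emb_mul|]; fold u.
  apply Rle_trans with (u * (2 * / r * nrm q)); [apply Rmult_le_compat_l; lra|lra].
Qed.

Lemma euler_bounds (h : C) (k : nat) : cone (/ (4 * b)) h ->
  nrm (euler_op h ^ k)%A <= 32 * (1 + 2 * a) * (1 + b) /\
  INR (S k) * nrm ((euler_op h - 1) * euler_op h ^ k)%A <=
    64 * (1 + 2 * a) * (1 + b) * (2 * b + 1).
Proof.
intros Hh.
assert (HG : exists G : C -> A, forall w, Cmod w < 1 ->
    (G w * (1 - emb w * euler_op h) = 1)%A /\
    nrm (G w) * (1 - Cmod w) <= 1 + 2 * a /\
    nrm (G w) * Cmod (Cminus (RtoC 1) w) <= 2 + 2 * b /\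
    nrm ((euler_op h - 1) * G w)%A <= 2 * b + 1).
{ apply (choice_fun C A (fun w g => Cmod w < 1 -> (g * (1 - emb w * euler_op h) = 1)%A /\
    nrm g * (1 - Cmod w) <= 1 + 2 * a /\
    nrm g * Cmod (Cminus (RtoC 1) w) <= 2 + 2 * b /\
    nrm ((euler_op h - 1) * g)%A <= 2 * b + 1)); intros w.
  destruct (classic (Cmod w < 1)) as [Hw|Hw].
  - destruct (one_minus_euler_inverse h w Hh Hw) as [G HG]; exists G; intros _; exact HG.
  - exists 0%A; intros Hw'; contradiction. }
destruct HG as [G HG].
replace (32 * (1 + 2 * a) * (1 + b)) with (16 * (1 + 2 * a) * (2 + 2 * b)) by ring.
replace (64 * (1 + 2 * a) * (1 + b) * (2 * b + 1)) with (32 * (1 + 2 * a) * (2 + 2 * b) * (2 * b + 1)) by ring.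
apply (power_and_difference_bounds A (euler_op h) G); try lra; intros w Hw; apply (HG w Hw).
Qed.

Definition yosida (h : C) : A := (emb (Cinv h) * (euler_op h - 1))%A.

(** Both sides are [A (1 - h A)^-1 (1 - h' A)^-1]. This lets the unbounded factor [A] be moved from
    one step size to another. *)
Lemma yosida_euler_comm (h h' : C) : 0 < Re h -> 0 < Re h' ->
  (yosida h * euler_op h' = euler_op h * yosida h')%A.
Proof.
intros Hh Hh'; unfold yosida, euler_op.
set (n := Cinv h); set (n' := Cinv h').
pose proof (resolvent_id n n' (Re_Cinv_pos h Hh) (Re_Cinv_pos h' Hh')) as H.
set (p := R0 n) in *; set (p' := R0 n') in *.
rewrite emb_sub in H.
transitivity (emb n * (emb n * p) * (emb n' * p') + emb n * emb n' * ((p - p') - p))%A; [ring|].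
rewrite H; ring.
Qed.
End Resolvent.

(** * Convergence of the Euler approximants in a sector *)

Lemma cone_add k h1 h2 : cone k h1 -> cone k h2 -> cone k (Cplus h1 h2).
Proof.
destruct h1 as [x1 y1], h2 as [x2 y2]; unfold cone, Re, Im; simpl; intros [H1 H2] [H3 H4].
split; [lra|]; pose proof (Rabs_triang y1 y2); lra.
Qed.

Lemma cone_scale k t h : 0 < t -> cone k h -> cone k (Cmult (RtoC t) h).
Proof.
destruct h as [x y]; unfold cone, Re, Im; simpl; intros Ht [H1 H2].
replace (t * x - 0 * y) with (t * x) by ring; replace (t * y + 0 * x) with (t * y) by ring.
split; [nra|]; rewrite Rabs_mult, (Rabs_pos_eq t) by lra; nra.
Qed.

(** For an opening [k <= 1] the two vectors form an angle of at most a right angle, so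
    [|h1|^2 + |h2|^2 <= |h1 + h2|^2]. *)
Lemma cone_mul_le k h1 h2 : 0 <= k <= 1 -> cone k h1 -> cone k h2 ->
  Cmod h1 * Cmod h2 <= Cmod (Cplus h1 h2) ^ 2.
Proof.
intros Hk [H1 H2] [H3 H4].
assert (H : Cmod h1 ^ 2 + Cmod h2 ^ 2 <= Cmod (Cplus h1 h2) ^ 2).
{ rewrite !Cmod2_alt.
  destruct h1 as [x1 y1], h2 as [x2 y2]; unfold Re, Im in *; simpl in *.
  assert (Hy1 : Rabs y1 <= x1) by nra. assert (Hy2 : Rabs y2 <= x2) by nra.
  assert (Hyy : Rabs (y1 * y2) <= x1 * x2).
  { rewrite Rabs_mult; apply Rmult_le_compat; auto using Rabs_pos. }
  pose proof (Rabs_maj2 (y1 * y2)); lra. }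
pose proof (Cmod_ge_0 h1); pose proof (Cmod_ge_0 h2); nra.
Qed.

Section Extension.
Variable A : cbalg.
Add Ring cba_ring5 : (aring A).
Variables (Q : C -> A) (kappa B K : R).
Hypothesis Hkappa : 0 <= kappa <= 1.
Hypothesis HB : 1 <= B.
Local Notation cone := (cone kappa).
Local Notation Y h := (emb (Cinv h) * (Q h - 1))%A.
Hypothesis Q_pow : forall h n, cone h -> nrm (Q h ^ n)%A <= B.
Hypothesis Q_diff : forall h n, cone h -> INR (S n) * nrm ((Q h - 1) * Q h ^ n)%A <= K.
Hypothesis YQ_comm : forall h h', cone h -> cone h' -> (Y h * Q h' = Q h * Y h')%A.

Lemma K_ge_0 : 0 <= K.
Proof.
assert (H1 : cone (RtoC 1)).
{ split; unfold Re, Im, RtoC; simpl; [lra|rewrite Rabs_R0; lra]. }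
eapply Rle_trans; [|apply (Q_diff (RtoC 1) 0 H1)].
apply Rmult_le_pos; [apply pos_INR|apply nrm_ge_0].
Qed.

Lemma nrm_YQ h n : cone h -> nrm (Y h * Q h ^ n)%A <= K / (INR (S n) * Cmod h).
Proof.
intros Hh; assert (Hm := cone_Cmod_pos _ _ Hh).
assert (Hn : 0 < INR (S n)) by (apply lt_0_INR; lia).
replace (Y h * Q h ^ n)%A with (emb (Cinv h) * ((Q h - 1) * Q h ^ n))%A by ring.
eapply Rle_trans; [apply nrm_emb_mul|].
rewrite Cmod_inv by (eapply cone_neq_0; exact Hh).
replace (K / (INR (S n) * Cmod h)) with (/ Cmod h * (K / INR (S n))) by (field; lra).
apply Rmult_le_compat_l; [apply Rlt_le, Rinv_0_lt_compat, Hm|].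
apply Rmult_le_reg_l with (INR (S n)); [exact Hn|].
replace (INR (S n) * (K / INR (S n))) with K by (field; lra); now apply Q_diff.
Qed.

(** Each factor [Y] is smoothed by one half of the factors [Q]. *)
Lemma nrm_YYQ h n : cone h -> nrm (Y h * Y h * Q h ^ n)%A <= 4 * K ^ 2 / (INR (S n) * Cmod h) ^ 2.
Proof.
intros Hh; assert (Hm := cone_Cmod_pos _ _ Hh).
assert (Hn : 0 < INR (S n)) by (apply lt_0_INR; lia).
assert (HK := K_ge_0).
set (n1 := (n / 2)%nat); set (n2 := (n - n1)%nat).
assert (Hn12 : (n1 + n2 = n /\ n <= 2 * n1 + 1 /\ 2 * n1 <= n)%nat).
{ unfold n2, n1; pose proof (Nat.div_mod_eq n 2); pose proof (Nat.mod_upper_bound n 2); lia. }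
assert (Hb : forall m, (n <= 2 * m + 1)%nat -> nrm (Y h * Q h ^ m)%A <= 2 * K / (INR (S n) * Cmod h)).
{ intros m Hmn; eapply Rle_trans; [apply nrm_YQ, Hh|].
  assert (Hle : INR (S n) <= 2 * INR (S m)).
  { replace 2 with (INR 2) by reflexivity; rewrite <- mult_INR; apply le_INR; lia. }
  assert (Hm0 : 0 < INR (S m)) by (apply lt_0_INR; lia).
  replace (2 * K / (INR (S n) * Cmod h)) with (K * / (INR (S n) * Cmod h / 2)) by (field; lra).
  apply Rmult_le_compat_l; [exact HK|]; apply Rinv_le_contravar; nra. }
replace (Y h * Y h * Q h ^ n)%A with ((Y h * Q h ^ n1) * (Y h * Q h ^ n2))%A.
2:{ replace n with (n1 + n2)%nat by lia; rewrite apow_add; ring. }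
replace (4 * K ^ 2 / (INR (S n) * Cmod h) ^ 2)
  with (2 * K / (INR (S n) * Cmod h) * (2 * K / (INR (S n) * Cmod h))) by (field; lra).
apply nrm_mul_le; apply Hb; lia.
Qed.

Lemma nrm_YYQ_quarter h n k : cone h -> (k <= 4 * S n)%nat -> (0 < k)%nat ->
  nrm (Y h * Y h * Q h ^ n)%A <= 64 * K ^ 2 / (INR k * Cmod h) ^ 2.
Proof.
intros Hh Hk Hk0; eapply Rle_trans; [apply nrm_YYQ, Hh|].
assert (Hm := cone_Cmod_pos _ _ Hh).
assert (Hkp : 0 < INR k) by (apply lt_0_INR; lia).
assert (Hle : INR k <= 4 * INR (S n)).
{ replace 4 with (INR 4) by (simpl; ring); rewrite <- mult_INR; apply le_INR; lia. }
replace (64 * K ^ 2 / (INR k * Cmod h) ^ 2)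
  with (4 * K ^ 2 * / (INR k * Cmod h / 4) ^ 2) by (field; lra).
apply Rmult_le_compat_l; [pose proof (pow2_ge_0 K); lra|].
apply Rinv_le_contravar; [apply pow_lt; nra|apply pow_incr; nra].
Qed.

Lemma euler_eq h : cone h -> (Q h = 1 + emb h * Y h)%A.
Proof.
intros Hh; transitivity (1 + (emb h * emb (Cinv h)) * (Q h - 1))%A; [|ring].
rewrite <- emb_mul, Cinv_r, emb_1 by (eapply cone_neq_0; exact Hh); ring.
Qed.

(* The Euler scheme is additive in the step up to [h1 h2 A^2], which the smoothing bound
   [nrm_YYQ] makes summable. *)
Lemma euler_product h1 h2 : cone h1 -> cone h2 ->
  (Q h1 * Q h2 - Q (Cplus h1 h2) =
   - (emb (Cmult h1 h2) * (Y h1 * Y h2 * Q (Cplus h1 h2))))%A.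
Proof.
intros H1 H2; set (h := Cplus h1 h2).
assert (H : cone h) by now apply cone_add.
pose proof (euler_eq h1 H1) as E1; pose proof (euler_eq h2 H2) as E2.
pose proof (euler_eq h H) as E.
pose proof (YQ_comm h1 h H1 H) as C1; pose proof (YQ_comm h2 h H2 H) as C2.
rewrite emb_mul.
set (y1 := Y h1) in *; set (y2 := Y h2) in *; set (y := Y h) in *.
set (q1 := Q h1) in *; set (q2 := Q h2) in *; set (q := Q h) in *.
assert (E' : (q1 * q2 = q1 * q2 * q - emb h1 * q2 * (y1 * q) - emb h2 * q1 * (y2 * q))%A).
{ rewrite C1, C2.
  transitivity (q1 * q2 * (q - (emb h1 + emb h2) * y))%A; [|ring].
  unfold h in E; rewrite emb_add in E; rewrite E; ring. }
rewrite E'.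
transitivity (q * (q1 * q2 - emb h1 * y1 * q2 - emb h2 * y2 * q1 - 1))%A; [ring|].
rewrite E1, E2; ring.
Qed.

Definition euler_pow (k : nat) (z : C) : A := (Q (Cmult (RtoC (/ INR k)) z) ^ k)%A.

Lemma step_cone k z : (0 < k)%nat -> cone z -> cone (Cmult (RtoC (/ INR k)) z).
Proof. intros Hk; apply cone_scale, Rinv_0_lt_compat, lt_0_INR, Hk. Qed.

Lemma step_Cmod k z : (0 < k)%nat -> Cmod (Cmult (RtoC (/ INR k)) z) = Cmod z / INR k.
Proof.
intros Hk; assert (0 < INR k) by now apply lt_0_INR.
rewrite Cmod_mult, Cmod_R, Rabs_pos_eq; [unfold Rdiv; ring|].
now apply Rlt_le, Rinv_0_lt_compat.
Qed.

Lemma nrm_euler_pow k z : (0 < k)%nat -> cone z -> nrm (euler_pow k z) <= B.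
Proof. intros; apply Q_pow; now apply step_cone. Qed.

(** The difference of [k]-th powers telescopes into [k] terms. Each carries [h1 h2 A^2] from
    [euler_product], and at least about half of its steps are available to smooth [A^2] down to
    [O(1 / (k^2 |h1| |h2|))]. The sum is [O(1 / k)]. *)
Lemma euler_pow_product k z1 z2 : (2 <= k)%nat -> cone z1 -> cone z2 ->
  nrm (euler_pow k z1 * euler_pow k z2 - euler_pow k (Cplus z1 z2))%A
    <= 64 * K ^ 2 * B ^ 2 / INR k.
Proof.
intros Hk Hz1 Hz2.
assert (Hk0 : 0 < INR k) by (apply lt_0_INR; lia).
assert (HK := K_ge_0).
set (h1 := Cmult (RtoC (/ INR k)) z1); set (h2 := Cmult (RtoC (/ INR k)) z2).
assert (H1 : cone h1) by (apply step_cone; [lia|assumption]).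
assert (H2 : cone h2) by (apply step_cone; [lia|assumption]).
set (h := Cplus h1 h2).
assert (H : cone h) by now apply cone_add.
assert (Hm1 := cone_Cmod_pos _ _ H1). assert (Hm2 := cone_Cmod_pos _ _ H2).
assert (Hm := cone_Cmod_pos _ _ H).
assert (Hmm : Cmod h1 * Cmod h2 <= Cmod h ^ 2) by (apply (cone_mul_le kappa); assumption).
unfold euler_pow; fold h1 h2.
replace (Cmult (RtoC (/ INR k)) (Cplus z1 z2)) with h by (unfold h, h1, h2; ring).
rewrite <- apow_mul, apow_sub.
unfold h at 1; rewrite euler_product by assumption; fold h.
set (y1 := Y h1); set (y2 := Y h2); set (q1 := Q h1); set (q2 := Q h2); set (q := Q h).
assert (Hterm : forall i, (i < k)%nat ->
  nrm (y1 * y2 * q * ((q1 * q2) ^ i * q ^ (k - 1 - i)))%A <=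
  64 * K ^ 2 * B ^ 2 / (INR k ^ 2 * (Cmod h1 * Cmod h2))).
{ intros i Hi; destruct (Nat.le_gt_cases k (2 * i)) as [Hik|Hik].
  - replace (y1 * y2 * q * ((q1 * q2) ^ i * q ^ (k - 1 - i)))%A
      with (y1 * q1 ^ i * (y2 * q2 ^ i) * q ^ S (k - 1 - i))%A
      by (simpl; rewrite apow_mul; ring).
    assert (Hle : INR k <= 2 * INR (S i)).
    { replace 2 with (INR 2) by reflexivity; rewrite <- mult_INR; apply le_INR; lia. }
    assert (Hy : forall g, cone g -> 0 < Cmod g -> nrm (Y g * Q g ^ i)%A <= 2 * K / (INR k * Cmod g)).
    { intros g Hg Hg0; eapply Rle_trans; [apply nrm_YQ, Hg|].
      replace (2 * K / (INR k * Cmod g)) with (K * / (INR k * Cmod g / 2)) by (field; lra).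
      apply Rmult_le_compat_l; [exact HK|]; apply Rinv_le_contravar; nra. }
    apply Rle_trans with (2 * K / (INR k * Cmod h1) * (2 * K / (INR k * Cmod h2)) * B).
    + apply nrm_mul_le; [apply nrm_mul_le; apply Hy; assumption|apply Q_pow, H].
    + replace (2 * K / (INR k * Cmod h1) * (2 * K / (INR k * Cmod h2)) * B)
        with ((4 * K ^ 2 * B) * / (INR k ^ 2 * (Cmod h1 * Cmod h2))) by (field; lra).
      apply Rmult_le_compat_r.
      * apply Rlt_le, Rinv_0_lt_compat, Rmult_lt_0_compat; [apply pow_lt; lra|nra].
      * assert (0 <= K ^ 2) by apply pow2_ge_0.
        replace (64 * K ^ 2 * B ^ 2) with (K ^ 2 * (64 * B ^ 2)) by ring.
        replace (4 * K ^ 2 * B) with (K ^ 2 * (4 * B)) by ring.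
        apply Rmult_le_compat_l; nra.
  (* For small [i] the smoothing must come from the powers of [q], so both unbounded factors are
     moved to the step [h = h1 + h2]; [cone_mul_le] then compares [|h|^2] with [|h1| |h2|]. *)
  - set (y := Y h).
    assert (C1 : (y1 * q = q1 * y)%A) by (apply YQ_comm; assumption).
    assert (C2 : (y2 * q = q2 * y)%A) by (apply YQ_comm; assumption).
    replace (y1 * y2 * q * ((q1 * q2) ^ i * q ^ (k - 1 - i)))%A
      with (y * y * q ^ (k - 2 - i) * (q1 ^ S i * q2 ^ S i))%A.
    2:{ replace (k - 1 - i)%nat with (S (k - 2 - i)) by lia; simpl; rewrite apow_mul.
        transitivity ((y1 * q) * (y2 * q) * (q1 ^ i * q2 ^ i * q ^ (k - 2 - i)))%A; [|ring].
        rewrite C1, C2; ring. }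
    apply Rle_trans with (64 * K ^ 2 / (INR k * Cmod h) ^ 2 * (B * B)).
    + apply nrm_mul_le; [apply nrm_YYQ_quarter; [exact H|lia|lia]|].
      apply nrm_mul_le; apply Q_pow; assumption.
    + replace (64 * K ^ 2 / (INR k * Cmod h) ^ 2 * (B * B))
        with ((64 * K ^ 2 * B ^ 2) * / (INR k ^ 2 * Cmod h ^ 2)) by (field; lra).
      apply Rmult_le_compat_l; [apply Rmult_le_pos; [pose proof (pow2_ge_0 K); lra|apply pow2_ge_0]|].
      apply Rinv_le_contravar; [apply Rmult_lt_0_compat; [apply pow_lt; lra|nra]|].
      apply Rmult_le_compat_l; [apply pow2_ge_0|exact Hmm]. }
replace (- (emb (Cmult h1 h2) * (y1 * y2 * q)) * asum (fun i => (q1 * q2) ^ i * q ^ (k - 1 - i)) k)%A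
  with (- (emb (Cmult h1 h2) * asum (fun i => y1 * y2 * q * ((q1 * q2) ^ i * q ^ (k - 1 - i))) k))%A
  by (rewrite asum_scal; ring).
rewrite nrm_opp; eapply Rle_trans; [apply nrm_emb_mul|].
rewrite Cmod_mult.
apply Rle_trans with (Cmod h1 * Cmod h2 *
  (INR k * (64 * K ^ 2 * B ^ 2 / (INR k ^ 2 * (Cmod h1 * Cmod h2))))).
- apply Rmult_le_compat_l; [nra|]; now apply nrm_asum_const.
- right; field; lra.
Qed.

Lemma euler_difference h h' : cone h -> cone h' ->
  (Q h' - Q h = emb (Cminus h' h) * (Y h * Q h'))%A.
Proof.
intros H H'; rewrite emb_sub.
pose proof (euler_eq h H) as E; pose proof (euler_eq h' H') as E'.
pose proof (YQ_comm h h' H H') as Cm.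
set (y := Y h) in *; set (y' := Y h') in *; set (v := Q h) in *; set (u := Q h') in *.
transitivity (u * (v - emb h * y) - v * (u - emb h' * y'))%A.
- rewrite E at 2; rewrite E' at 3; ring.
- transitivity (emb h' * (v * y') - emb h * (y * u))%A; [ring|rewrite <- Cm; ring].
Qed.

(** The derivative of [(1 - (z / k) A)^-k] in [z] is [A (1 - (z / k) A)^-(k+1)]. The remainder is
    uniform in [k], so it survives the limit and yields holomorphy of the limit with its derivative.
    The relation between [|z|] and [|z'|] turns bounds at [h'] into bounds at [h], at the price of a
    factor 4. *)
Lemma euler_pow_taylor k z z' : (2 <= k)%nat -> cone z -> cone z' -> Cmod z <= 2 * Cmod z' ->
  nrm (euler_pow k z' - euler_pow k z -
       emb (Cminus z' z) * (Y (Cmult (RtoC (/ INR k)) z) * euler_pow k z))%A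
    <= 256 * K ^ 2 * B * Cmod (Cminus z' z) ^ 2 / Cmod z ^ 2.
Proof.
intros Hk Hz Hz' Hzz.
assert (Hk0 : 0 < INR k) by (apply lt_0_INR; lia).
assert (HK := K_ge_0).
assert (Hmz := cone_Cmod_pos _ _ Hz).
set (h := Cmult (RtoC (/ INR k)) z); set (h' := Cmult (RtoC (/ INR k)) z').
assert (H : cone h) by (apply step_cone; [lia|assumption]).
assert (H' : cone h') by (apply step_cone; [lia|assumption]).
assert (Hm := cone_Cmod_pos _ _ H). assert (Hm' := cone_Cmod_pos _ _ H').
assert (Eh : Cmod h = Cmod z / INR k) by (apply step_Cmod; lia).
assert (Eh' : Cmod h' = Cmod z' / INR k) by (apply step_Cmod; lia).
assert (Hhh : Cmod h / 2 <= Cmod h').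
{ rewrite Eh, Eh'; apply Rmult_le_reg_r with (INR k); [exact Hk0|].
  replace (Cmod z / INR k / 2 * INR k) with (Cmod z / 2) by (field; lra).
  replace (Cmod z' / INR k * INR k) with (Cmod z') by (field; lra); lra. }
set (dh := Cminus h' h).
assert (Edh : Cmod dh = Cmod (Cminus z' z) / INR k).
{ replace dh with (Cmult (RtoC (/ INR k)) (Cminus z' z)) by (unfold dh, h, h'; ring).
  apply step_Cmod; lia. }
unfold euler_pow; fold h h'.
set (y := Y h); set (y' := Y h'); set (u := Q h'); set (v := Q h).
assert (Euv : (u - v = emb dh * (y * u))%A) by (apply euler_difference; assumption).
assert (Cm : (y * u = v * y')%A) by (apply YQ_comm; assumption).
assert (Hw : (emb (Cminus z' z) * (y * v ^ k) = emb dh * y * asum (fun _ => v ^ k) k)%A).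
{ assert (Hs : forall n, asum (fun _ => v ^ k)%A n = (emb (RtoC (INR n)) * v ^ k)%A).
  { induction n as [|n IH]; [simpl; rewrite emb_0; ring|].
    rewrite embn_S; cbn [asum]; rewrite IH; ring. }
  rewrite Hs.
  transitivity (emb (Cmult dh (RtoC (INR k))) * (y * v ^ k))%A; [|rewrite emb_mul; ring].
  do 2 f_equal; unfold dh, h, h'; rewrite RtoC_inv by lra; field.
  intros E; apply RtoC_inj in E; lra. }
(* Telescoping twice leaves a double sum of at most [k^2] such terms, each of size
   [O(1 / (k |h|)^2)]. *)
set (T := fun l => (y * y * u ^ S l * v ^ (k - 1 - l))%A).
assert (E : (u ^ k - v ^ k - emb (Cminus z' z) * (y * v ^ k) =
   emb (Cmult dh dh) * asum (fun i => asum T (S i)) k)%A).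
{ rewrite Hw, apow_sub, Euv, emb_mul.
  transitivity (emb dh * y * asum (fun i => u ^ S i * v ^ (k - 1 - i) - v ^ k) k)%A.
  - rewrite (asum_ext _ (fun i => u ^ S i * v ^ (k - 1 - i) - v ^ k)%A
      (fun i => u * (u ^ i * v ^ (k - 1 - i)) + (emb (Copp (RtoC 1))) * v ^ k)%A).
    2:{ intros i _; rewrite emb_opp, emb_1; simpl; ring. }
    rewrite asum_add, !asum_scal, emb_opp, emb_1; ring.
  - rewrite <- !asum_scal; apply asum_ext; intros i Hi.
    transitivity (emb dh * y * ((u ^ S i - v ^ S i) * v ^ (k - 1 - i)))%A.
    { f_equal; transitivity (u ^ S i * v ^ (k - 1 - i) - v ^ (S i + (k - 1 - i)))%A.
      - do 2 f_equal; lia.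
      - rewrite apow_add; ring. }
    rewrite apow_sub, Euv.
    transitivity (emb dh * emb dh * (y * y * u * v ^ (k - 1 - i) *
      asum (fun l => u ^ l * v ^ (S i - 1 - l)) (S i)))%A; [ring|].
    f_equal; rewrite <- asum_scal; apply asum_ext; intros l Hl; unfold T.
    replace (k - 1 - l)%nat with ((k - 1 - i) + (S i - 1 - l))%nat by lia.
    rewrite apow_add; simpl; ring. }
rewrite E; eapply Rle_trans; [apply nrm_emb_mul|]; rewrite Cmod_mult, Edh.
set (t := 256 * K ^ 2 * B / (INR k * Cmod h) ^ 2).
assert (Ht : forall l, (l < k)%nat -> nrm (T l) <= t).
{ intros l Hl; unfold T; destruct (Nat.le_gt_cases k (2 * l)) as [Hlk|Hlk].
  (* Most of the factors are now [u], so [A^2] is moved from [h] to [h'] by [y u = v y']. *)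
  - replace (y * y * u ^ S l * v ^ (k - 1 - l))%A
      with (y' * y' * u ^ (l - 1) * v ^ (2 + (k - 1 - l)))%A.
    2:{ replace (S l) with (2 + (l - 1))%nat by lia; rewrite !apow_add; simpl.
        transitivity ((v * y') * (v * y') * (u ^ (l - 1) * v ^ (k - 1 - l)))%A; [ring|].
        rewrite <- Cm; ring. }
    apply Rle_trans with (64 * K ^ 2 / (INR k * Cmod h') ^ 2 * B).
    + apply nrm_mul_le; [apply nrm_YYQ_quarter; [exact H'|lia|lia]|apply Q_pow, H].
    + replace t with (64 * K ^ 2 * / (INR k * (Cmod h / 2)) ^ 2 * B) by (unfold t; field; lra).
      apply Rmult_le_compat_r; [lra|].
      apply Rmult_le_compat_l; [pose proof (pow2_ge_0 K); lra|].
      apply Rinv_le_contravar; [apply pow_lt; nra|apply pow_incr; nra].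
  - replace (y * y * u ^ S l * v ^ (k - 1 - l))%A
      with (y * y * v ^ (k - 1 - l) * u ^ S l)%A by ring.
    apply Rle_trans with (64 * K ^ 2 / (INR k * Cmod h) ^ 2 * B).
    + apply nrm_mul_le; [apply nrm_YYQ_quarter; [exact H|lia|lia]|apply Q_pow, H'].
    + replace t with (256 * K ^ 2 / (INR k * Cmod h) ^ 2 * B) by (unfold t; field; lra).
      apply Rmult_le_compat_r; [lra|].
      apply Rmult_le_compat_r; [apply Rlt_le, Rinv_0_lt_compat, pow_lt; nra|].
      pose proof (pow2_ge_0 K); lra. }
assert (Ht0 : 0 <= t) by (eapply Rle_trans; [apply nrm_ge_0|apply (Ht 0%nat); lia]).
apply Rle_trans with (Cmod (Cminus z' z) / INR k * (Cmod (Cminus z' z) / INR k) * (INR k * (INR k * t))).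
- apply Rmult_le_compat_l.
  { assert (0 <= Cmod (Cminus z' z) / INR k) by (rewrite <- Edh; apply Cmod_ge_0); nra. }
  apply nrm_asum_const; intros i Hi.
  apply Rle_trans with (INR (S i) * t).
  + apply nrm_asum_const; intros l Hl; apply Ht; lia.
  + apply Rmult_le_compat_r; [exact Ht0|apply le_INR; lia].
- right; unfold t; rewrite Eh; field; lra.
Qed.

(** Doubling [k] amounts to squaring: the approximant of order [2 k] at [z] is the square of that of
    order [k] at [z / 2]. Hence [euler_pow_product] bounds the consecutive differences along
    [k = 2^j] by a geometric sequence. *)
Lemma euler_pow_limit z : cone z -> exists l, alim (fun j => euler_pow (2 ^ j) z) l.
Proof.
intros Hz; apply (alim_of_steps A _ (64 * K ^ 2 * B ^ 2) 1); intros j Hj.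
assert (Hp : (2 <= 2 ^ j)%nat).
{ replace j with (S (j - 1)) by lia; simpl; pose proof (Nat.pow_nonzero 2 (j - 1)); lia. }
set (z2 := Cmult (RtoC (/ 2)) z).
assert (Hz2 : cone z2) by (apply cone_scale; [lra|exact Hz]).
replace (euler_pow (2 ^ S j) z) with (euler_pow (2 ^ j) z2 * euler_pow (2 ^ j) z2)%A.
- pose proof (euler_pow_product (2 ^ j) z2 z2 Hp Hz2 Hz2) as H.
  replace (Cplus z2 z2) with z in H.
  + eapply Rle_trans; [exact H|]; right; rewrite pow_inv, pow_INR; reflexivity.
  + unfold z2; transitivity (Cmult (RtoC (/ 2 + / 2)) z).
    * replace (/ 2 + / 2) with 1 by field; ring.
    * rewrite RtoC_plus; ring.
- unfold euler_pow.
  replace (2 ^ S j)%nat with (2 ^ j + 2 ^ j)%nat by (simpl; lia).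
  rewrite apow_add.
  assert (E : Cmult (RtoC (/ INR (2 ^ j + 2 ^ j))) z = Cmult (RtoC (/ INR (2 ^ j))) z2).
  { unfold z2; rewrite Cmult_assoc, <- RtoC_mult, plus_INR; do 2 f_equal.
    assert (0 < INR (2 ^ j)) by (apply lt_0_INR; lia); field; lra. }
  rewrite E; reflexivity.
Qed.

(** By the uniform Taylor estimate, all late derivative approximants lie within [e / 2] of one fixed
    difference quotient of the limit function, so they form a Cauchy sequence. *)
Lemma derivative_limit z : cone z ->
  exists D, alim (fun j => Y (Cmult (RtoC (/ INR (2 ^ j))) z) * euler_pow (2 ^ j) z)%A D.
Proof.
intros Hz; assert (Hm := cone_Cmod_pos _ _ Hz); assert (HK := K_ge_0).
apply nrm_complete; intros e He.
set (c := 256 * K ^ 2 * B).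
assert (Hc : 0 <= c) by (unfold c; pose proof (pow2_ge_0 K); nra).
(* The increment [w = s z] makes the Taylor remainder, divided by [|w|], at most [e / 4]; the other
   [e / 4] is the convergence at [z] and at [z']. *)
set (s := Rmin 1 (e * Cmod z / (4 * (c + 1)))).
assert (Hs : 0 < s).
{ apply Rmin_pos; [lra|apply Rdiv_lt_0_compat; nra]. }
set (w := Cmult (RtoC s) z); set (z' := Cplus z w).
assert (Hw : cone w) by (apply cone_scale; assumption).
assert (Hz' : cone z') by now apply cone_add.
assert (Ew : Cminus z' z = w) by (unfold z'; ring).
assert (Hmw : Cmod w = s * Cmod z) by (unfold w; rewrite Cmod_mult, Cmod_R, Rabs_pos_eq; lra).
assert (Hzz : Cmod z <= 2 * Cmod z').
{ replace z' with (Cmult (RtoC (1 + s)) z) by (unfold z', w; rewrite RtoC_plus; ring).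
  rewrite Cmod_mult, Cmod_R, Rabs_pos_eq; nra. }
assert (Hw0 : w <> RtoC 0) by (eapply cone_neq_0; exact Hw).
destruct (euler_pow_limit z Hz) as [l Hl], (euler_pow_limit z' Hz') as [l' Hl'].
destruct (alim_sub _ _ _ _ _ Hl' Hl (s * Cmod z * e / 4)) as [N HN].
{ apply Rdiv_lt_0_compat; [apply Rmult_lt_0_compat; [nra|exact He]|lra]. }
exists (S N).
assert (HD : forall n, (S N <= n)%nat ->
  nrm (Y (Cmult (RtoC (/ INR (2 ^ n))) z) * euler_pow (2 ^ n) z - emb (Cinv w) * (l' - l))%A <= e / 2).
{ intros n Hn; specialize (HN n ltac:(lia)).
  assert (Hp : (2 <= 2 ^ n)%nat).
  { replace n with (S (n - 1)) by lia; simpl; pose proof (Nat.pow_nonzero 2 (n - 1)); lia. }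
  pose proof (euler_pow_taylor (2 ^ n) z z' Hp Hz Hz' Hzz) as Ht; rewrite Ew in Ht.
  set (D := (Y (Cmult (RtoC (/ INR (2 ^ n))) z) * euler_pow (2 ^ n) z)%A) in *.
  assert (Hmw0 : 0 < Cmod w) by now apply Cmod_gt_0.
  apply Rmult_le_reg_l with (Cmod w); [exact Hmw0|].
  rewrite <- nrm_emb_cancel by exact Hw0.
  set (d := (euler_pow (2 ^ n) z' - euler_pow (2 ^ n) z)%A) in *.
  replace (emb w * (D - emb (Cinv w) * (l' - l)))%A with ((d - (l' - l)) - (d - emb w * D))%A.
  2:{ transitivity (emb w * D - (emb w * emb (Cinv w)) * (l' - l))%A; [|ring].
      rewrite <- emb_mul, Cinv_r, emb_1 by exact Hw0; ring. }
  eapply Rle_trans; [apply nrm_sub_le; [exact HN|exact Ht]|].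
  fold c; rewrite Hmw.
  replace (c * (s * Cmod z) ^ 2 / Cmod z ^ 2) with (s * (c * s)) by (field; lra).
  assert (Hcs : c * s <= Cmod z * e / 4).
  { apply Rle_trans with (c * (e * Cmod z / (4 * (c + 1)))); [apply Rmult_le_compat_l; [exact Hc|apply Rmin_r]|].
    apply Rmult_le_reg_r with (4 * (c + 1)); [lra|].
    replace (c * (e * Cmod z / (4 * (c + 1))) * (4 * (c + 1))) with (c * (e * Cmod z)) by (field; lra).
    assert (0 < e * Cmod z) by nra; nra. }
  nra. }
intros n m Hn Hm'.
set (x := (emb (Cinv w) * (l' - l))%A) in HD.
eapply Rle_trans; [apply (nrm_le_trans A _ x)|].
rewrite (nrm_sub_sym A x).
pose proof (HD n Hn); pose proof (HD m Hm'); lra.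
Qed.

Lemma two_pow_ge j : (1 <= j)%nat -> (2 <= 2 ^ j)%nat.
Proof.
intros Hj; replace j with (S (j - 1)) by lia; simpl; pose proof (Nat.pow_nonzero 2 (j - 1)); lia.
Qed.

Lemma holomorphic_extension : exists S : C -> A,
  (forall z, cone z -> alim (fun j => euler_pow (2 ^ j) z) (S z)) /\
  (forall z, cone z -> nrm (S z) <= B) /\
  (forall z1 z2, cone z1 -> cone z2 -> S (Cplus z1 z2) = (S z1 * S z2)%A) /\
  (forall z, cone z -> exists D, nrm D <= K / Cmod z /\
     forall z', cone z' -> Cmod z <= 2 * Cmod z' ->
       nrm (S z' - S z - emb (Cminus z' z) * D)%A <=
         256 * K ^ 2 * B * Cmod (Cminus z' z) ^ 2 / Cmod z ^ 2).
Proof.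
destruct (choice_fun C A (fun z l => cone z -> alim (fun j => euler_pow (2 ^ j) z) l)) as [S HS].
{ intros z; destruct (excluded_middle_informative (cone z)) as [Hz|Hz].
  - destruct (euler_pow_limit z Hz) as [l Hl]; exists l; auto.
  - exists 0%A; intros; contradiction. }
exists S; split; [exact HS|split; [|split]].
- intros z Hz; apply (alim_nrm_le A _ _ _ 0 (HS z Hz)); intros n _.
  apply nrm_euler_pow; [apply Nat.neq_0_lt_0, Nat.pow_nonzero; lia|exact Hz].
- intros z1 z2 H1 H2.
  pose proof (HS _ (cone_add _ _ _ H1 H2)) as H12.
  pose proof (alim_sub _ _ _ _ _ (alim_mul _ _ _ _ _ (HS z1 H1) (HS z2 H2)) H12) as Hd.
  assert (E : (S z1 * S z2 - S (Cplus z1 z2) = 0)%A).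
  { apply (alim_unique _ _ _ _ Hd); intros e He.
    destruct (half_pow_small (64 * K ^ 2 * B ^ 2) e He) as [N HN].
    exists (Nat.max 1 N); intros n Hn.
    replace (euler_pow (2 ^ n) z1 * euler_pow (2 ^ n) z2 - euler_pow (2 ^ n) (Cplus z1 z2) - 0)%A
      with (euler_pow (2 ^ n) z1 * euler_pow (2 ^ n) z2 - euler_pow (2 ^ n) (Cplus z1 z2))%A by ring.
    eapply Rle_trans; [apply euler_pow_product; [apply two_pow_ge; lia|assumption|assumption]|].
    eapply Rle_trans; [|apply (HN n); lia].
    right; rewrite pow_inv, pow_INR; reflexivity. }
  transitivity (S z1 * S z2 - (S z1 * S z2 - S (Cplus z1 z2)))%A; [ring|rewrite E; ring].
- intros z Hz; assert (Hm := cone_Cmod_pos _ _ Hz); assert (HK := K_ge_0).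
  destruct (derivative_limit z Hz) as [D HD]; exists D; split.
  + apply (alim_nrm_le A _ _ _ 0 HD); intros n _.
    assert (Hp : (0 < 2 ^ n)%nat) by (apply Nat.neq_0_lt_0, Nat.pow_nonzero; lia).
    assert (Hp1 : 0 < INR (2 ^ n)) by now apply lt_0_INR.
    eapply Rle_trans; [apply nrm_YQ, step_cone; assumption|].
    rewrite step_Cmod by exact Hp; rewrite S_INR.
    apply Rmult_le_compat_l; [exact HK|]; apply Rinv_le_contravar; [exact Hm|].
    replace ((INR (2 ^ n) + 1) * (Cmod z / INR (2 ^ n))) with (Cmod z + Cmod z / INR (2 ^ n)) by (field; lra).
    assert (0 < Cmod z / INR (2 ^ n)) by (apply Rdiv_lt_0_compat; lra); lra.
  + intros z' Hz' Hzz.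
    apply (alim_nrm_le A (fun j => euler_pow (2 ^ j) z' - euler_pow (2 ^ j) z -
       emb (Cminus z' z) * (Y (Cmult (RtoC (/ INR (2 ^ j))) z) * euler_pow (2 ^ j) z))%A _ _ 1).
    * apply alim_sub; [apply alim_sub; auto|].
      apply (alim_mul A (fun _ => emb (Cminus z' z))); [apply alim_const|exact HD].
    * intros n Hn; apply euler_pow_taylor; auto using two_pow_ge.
Qed.
End Extension.

(** * The bicommutant of a family of operators *)

Definition norm_complete (X : NormedModule C_AbsRing) : Prop :=
  forall u : nat -> X,
  (forall e, 0 < e -> exists N, forall n m, (N <= n)%nat -> (N <= m)%nat ->
     norm (minus (u n) (u m)) <= e) ->
  exists l : X, forall e, 0 < e -> exists N, forall n, (N <= n)%nat -> norm (minus (u n) l) <= e.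

Lemma complete_norm_complete (X : CompleteNormedModule C_AbsRing) : norm_complete X.
Proof.
intros u H.
destruct (proj1 (filterlim_locally_cauchy (F := eventually) u)) as [l Hl].
- intros e; destruct (H (e / 2)) as [N HN].
  { pose proof (cond_pos e); lra. }
  exists (fun n => (N <= n)%nat); split; [exists N; auto|].
  intros n m Hn Hm; apply (@norm_compat1 C_AbsRing X).
  eapply Rle_lt_trans; [exact (HN m n Hm Hn)|pose proof (cond_pos e); lra].
- exists l; intros e He.
  assert (Hf : 0 < @norm_factor C_AbsRing X) by apply norm_factor_gt_0.
  assert (He' : 0 < e / @norm_factor C_AbsRing X) by now apply Rdiv_lt_0_compat.
  destruct (proj1 (filterlim_locally u l) Hl (mkposreal _ He')) as [N HN].
  exists N; intros n Hn; specialize (HN n Hn); apply (@norm_compat2 C_AbsRing X) in HN; simpl in HN.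
  apply Rlt_le; eapply Rlt_le_trans; [exact HN|right; field; lra].
Qed.

Section Operators.
Variable X : NormedModule C_AbsRing.
Hypothesis X_complete : norm_complete X.
Local Notation op := (bounded_op X).
Local Notation "A '**' B" := (bop_comp A B) (at level 40).
Local Notation dist x y := (norm (minus (x : X) (y : X))).

Lemma normdist_triangle (x y z : X) : dist x z <= dist x y + dist y z.
Proof. rewrite (minus_trans y x z); apply (norm_triangle (minus x y)). Qed.

Lemma normdist_sym (x y : X) : dist x y = dist y x.
Proof. rewrite <- (opp_minus x y); symmetry; apply (@norm_opp C_AbsRing X). Qed.

Lemma minus_plus (x y : X) : plus (minus x y) y = x.
Proof. unfold minus; rewrite <- plus_assoc, plus_opp_l; apply plus_zero_r. Qed.

Lemma normdist_eq (x y : X) : (forall e, 0 < e -> dist x y <= e) -> x = y.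
Proof.
intros H.
assert (E : minus x y = zero).
{ apply norm_eq_zero, Rle_antisym; [|apply norm_ge_0].
  apply Rnot_lt_le; intros Hp; specialize (H (dist x y / 2) ltac:(lra)); lra. }
rewrite <- (minus_plus x y), E; apply plus_zero_l.
Qed.

Lemma norm_le_dist (x y : X) : norm x <= dist x y + norm y.
Proof.
rewrite <- (minus_plus x y) at 1; apply (@norm_triangle C_AbsRing X).
Qed.

Lemma bop_add (B : op) (x y : X) : B (plus x y) = plus (B x) (B y).
Proof. apply (linear_plus _ (bop_linear B)). Qed.

Lemma bop_scalr (B : op) (c : C) (x : X) : B (scal c x) = scal c (B x).
Proof. exact (linear_scal _ (bop_linear B) c x). Qed.

Lemma bop_oppr (B : op) (x : X) : B (opp x) = opp (B x).
Proof. apply (linear_opp _ x (bop_linear B)). Qed.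

Lemma bop_minus (B : op) (x y : X) : B (minus x y) = minus (B x) (B y).
Proof. unfold minus; now rewrite bop_add, bop_oppr. Qed.

Lemma opnorm_comp (A B : op) : opnorm (A ** B) <= opnorm A * opnorm B.
Proof.
apply opnorm_le.
- apply Rmult_le_pos; apply opnorm_ge_0.
- intros x; simpl; eapply Rle_trans; [apply opnorm_bound|].
  rewrite Rmult_assoc; apply Rmult_le_compat_l; [apply opnorm_ge_0|apply opnorm_bound].
Qed.

Lemma plus_interchange (a b c d : X) :
  plus (plus a b) (plus c d) = plus (plus a c) (plus b d).
Proof. rewrite <- !plus_assoc; f_equal; rewrite !plus_assoc; f_equal; apply plus_comm. Qed.

Lemma dist_scal_plus (c : C) (x y x' y' : X) :
  dist (plus (scal c x) y) (plus (scal c x') y') <= Cmod c * dist x x' + dist y y'.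
Proof.
apply Rle_trans with (norm (plus (scal c (minus x x')) (minus y y') : X)).
- right; f_equal; symmetry.
  transitivity (plus (plus (scal c x) (opp (scal c x'))) (plus y (opp y'))).
  + unfold minus; f_equal.
    exact (eq_trans (@scal_distr_l C_Ring X c x (opp x')) (f_equal (plus _) (scal_opp_r c x'))).
  + rewrite plus_interchange; unfold minus; f_equal; symmetry; apply (@opp_plus X).
- eapply Rle_trans; [apply (@norm_triangle C_AbsRing X)|].
  apply Rplus_le_compat_r, (@norm_scal C_AbsRing X).
Qed.

(** Letting [m] grow at fixed [x] in the Cauchy estimate bounds [dist (u n x) (l x)] by
    [e * norm x]. This gives both the boundedness of the pointwise limit and the convergence in
    operator norm. *)
Lemma bop_complete (u : nat -> op) :
  (forall e, 0 < e -> exists N, forall n m, (N <= n)%nat -> (N <= m)%nat ->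
     opnorm (minus (u n) (u m)) <= e) ->
  exists l : op, forall e, 0 < e -> exists N, forall n, (N <= n)%nat ->
     opnorm (minus (u n) l) <= e.
Proof.
intros Hu.
assert (Hx : forall x : X, exists y : X, forall e, 0 < e -> exists N, forall n, (N <= n)%nat ->
  dist (u n x) y <= e).
{ intros x; apply X_complete; intros e He.
  assert (Hn : 0 < norm x + 1) by (pose proof (norm_ge_0 x); lra).
  destruct (Hu (e / (norm x + 1))) as [N HN]; [now apply Rdiv_lt_0_compat|].
  exists N; intros n m H1 H2.
  eapply Rle_trans; [apply (opnorm_bound (minus (u n) (u m)) x)|].
  apply Rle_trans with (e / (norm x + 1) * (norm x + 1)); [|right; field; lra].
  apply Rmult_le_compat; [apply opnorm_ge_0|apply norm_ge_0|now apply HN|lra]. }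
destruct (choice_fun X X _ Hx) as [l Hl]; clear Hx.
assert (Hlim : forall x y e, 0 < e -> exists N, forall n, (N <= n)%nat ->
  dist (u n x) (l x) <= e /\ dist (u n y) (l y) <= e).
{ intros x y e He; destruct (Hl x e He) as [N1 H1], (Hl y e He) as [N2 H2].
  exists (Nat.max N1 N2); intros n Hn; split; [apply H1|apply H2]; lia. }
assert (Hlin : forall (c : C) x y, l (plus (scal c x) y) = plus (scal c (l x)) (l y)).
{ intros c x y; apply normdist_eq; intros e He.
  pose proof (Cmod_ge_0 c).
  set (d := e / (Cmod c + 2)); assert (Hd : 0 < d) by (apply Rdiv_lt_0_compat; lra).
  destruct (Hlim x y d Hd) as [N1 H1], (Hl (plus (scal c x) y) d Hd) as [N2 H2].
  set (n := Nat.max N1 N2).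
  eapply Rle_trans; [apply (normdist_triangle _ (u n (plus (scal c x) y)))|].
  rewrite normdist_sym, bop_add, bop_scalr.
  pose proof (dist_scal_plus c (u n x) (u n y) (l x) (l y)) as H3.
  destruct (H1 n ltac:(lia)) as [H4 H5].
  assert (H6 := H2 n ltac:(lia)); rewrite bop_add, bop_scalr in H6.
  apply Rle_trans with (d + (Cmod c * d + d)).
  - apply Rplus_le_compat; [exact H6|]; eapply Rle_trans; [exact H3|].
    apply Rplus_le_compat; [apply Rmult_le_compat_l|]; assumption.
  - unfold d; right; field; lra. }
assert (Hadd : forall x y, l (plus x y) = plus (l x) (l y)).
{ intros x y; pose proof (Hlin (RtoC 1) x y) as H.
  change (RtoC 1) with (@one C_Ring) in H; rewrite !scal_one in H; exact H. }
assert (H0 : l zero = zero).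
{ pose proof (Hadd zero zero) as H; rewrite plus_zero_l in H.
  apply (plus_reg_l (l zero)); rewrite plus_zero_r; symmetry; exact H. }
assert (Hsc : forall (c : C) x, l (scal c x) = scal c (l x)).
{ intros c x; transitivity (l (plus (scal c x) zero)); [f_equal; symmetry; apply plus_zero_r|].
  eapply eq_trans; [apply Hlin|].
  transitivity (plus (scal c (l x)) zero); [f_equal; exact H0|apply plus_zero_r]. }
destruct (Hu 1 ltac:(lra)) as [N0 HN0].
assert (Hb : forall e N, 0 < e -> (forall n m, (N <= n)%nat -> (N <= m)%nat ->
     opnorm (minus (u n) (u m)) <= e) -> forall n x, (N <= n)%nat -> dist (u n x) (l x) <= e * norm x).
{ intros e N He HN n x Hn; apply le_epsilon; intros d Hd.
  destruct (Hl x d Hd) as [N2 H2].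
  set (m := Nat.max N N2).
  eapply Rle_trans; [apply (normdist_triangle _ (u m x))|].
  apply Rplus_le_compat; [|apply H2; lia].
  eapply Rle_trans; [apply (opnorm_bound (minus (u n) (u m)) x)|].
  apply Rmult_le_compat_r; [apply norm_ge_0|apply HN; lia]. }
assert (HL : is_linear l).
{ split; [exact Hadd|exact Hsc|].
  exists (1 + opnorm (u N0)); split; [pose proof (opnorm_ge_0 (u N0)); lra|].
  intros x; eapply Rle_trans; [apply (norm_le_dist _ (u N0 x))|].
  rewrite normdist_sym.
  pose proof (Hb 1 N0 ltac:(lra) HN0 N0 x (le_n _)); pose proof (opnorm_bound (u N0) x); lra. }
exists (BoundedOp HL); intros e He.
destruct (Hu e He) as [N HN]; exists N; intros n Hn.
apply opnorm_le; [lra|]; intros x; exact (Hb e N He HN n x Hn).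
Qed.

Variable F : op -> Prop.
Definition commutant (D : op) : Prop := forall E, F E -> D ** E = E ** D.
Definition bicommutant (B : op) : Prop := forall D, commutant D -> D ** B = B ** D.

Lemma bicommutant_gen E : F E -> bicommutant E.
Proof. intros HE D HD; now apply HD. Qed.

Lemma bicommutant_id : bicommutant (bop_id X).
Proof. intros D _; apply bop_ext; reflexivity. Qed.

Lemma bicommutant_zero : bicommutant (bop_zero X).
Proof.
intros D _; apply bop_ext; intros x; simpl.
exact (linear_zero _ (bop_linear D)).
Qed.

Lemma bicommutant_plus B B' : bicommutant B -> bicommutant B' -> bicommutant (bop_plus B B').
Proof.
intros H H' D HD; apply bop_ext; intros x; simpl; rewrite bop_add.
change (plus ((D ** B) x) ((D ** B') x) = plus ((B ** D) x) ((B' ** D) x)).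
now rewrite H, H'.
Qed.

Lemma bicommutant_scal c B : bicommutant B -> bicommutant (bop_scal c B).
Proof.
intros H D HD; apply bop_ext; intros x; simpl; rewrite bop_scalr.
change (scal c ((D ** B) x) = scal c ((B ** D) x)); now rewrite H.
Qed.

Lemma bicommutant_opp B : bicommutant B -> bicommutant (bop_opp B).
Proof.
intros H D HD; apply bop_ext; intros x; simpl; rewrite bop_oppr.
change (opp ((D ** B) x) = opp ((B ** D) x)); now rewrite H.
Qed.

Lemma bicommutant_comp B B' : bicommutant B -> bicommutant B' -> bicommutant (B ** B').
Proof.
intros H H' D HD; apply bop_ext; intros x; simpl.
change ((D ** B) (B' x) = B ((B' ** D) x)); rewrite H, <- H' by assumption; reflexivity.
Qed.

Hypothesis F_comm : forall E E', F E -> F E' -> E ** E' = E' ** E.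

(** As [F] is commutative it lies in its commutant, so the bicommutant lies in the commutant as
    well, and [B'] commutes with everything there. *)
Lemma bicommutant_comm B B' : bicommutant B -> bicommutant B' -> B ** B' = B' ** B.
Proof.
intros H H'; apply H'; intros E HE; symmetry; apply H; intros E' HE'; now apply F_comm.
Qed.

Lemma bicommutant_limit (u : nat -> op) l : (forall n, bicommutant (u n)) ->
  (forall e, 0 < e -> exists N, forall n, (N <= n)%nat -> opnorm (minus (u n) l) <= e) ->
  bicommutant l.
Proof.
intros Hu Hl D HD; apply bop_ext; intros x; simpl; apply normdist_eq; intros e He.
pose proof (norm_ge_0 x) as Hx0; pose proof (norm_ge_0 (D x)) as HDx.
pose proof (opnorm_ge_0 D) as HD0.
set (c := opnorm D * norm x + norm (D x) + 1).
assert (Hc : 0 < c) by (unfold c; nra).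
destruct (Hl (e / c)) as [N HN]; [now apply Rdiv_lt_0_compat|].
specialize (HN N (le_n N)).
assert (Hy : forall y, dist (u N y) (l y) <= e / c * norm y).
{ intros y; eapply Rle_trans; [apply (opnorm_bound (minus (u N) l) y)|].
  apply Rmult_le_compat_r; [apply norm_ge_0|exact HN]. }
eapply Rle_trans; [apply (normdist_triangle _ (D (u N x)))|].
replace (D (u N x)) with (u N (D x)) at 2 by (symmetry; apply (f_equal (fun E : op => E x) (Hu N D HD))).
rewrite normdist_sym, <- bop_minus.
apply Rle_trans with (opnorm D * (e / c * norm x) + e / c * norm (D x)).
- apply Rplus_le_compat; [|apply Hy].
  eapply Rle_trans; [apply opnorm_bound|]; apply Rmult_le_compat_l; [exact HD0|apply Hy].
- apply Rle_trans with (e / c * c); [|right; field; lra].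
  replace (opnorm D * (e / c * norm x) + e / c * norm (D x))
    with (e / c * (opnorm D * norm x + norm (D x))) by ring.
  apply Rmult_le_compat_l; [apply Rlt_le; now apply Rdiv_lt_0_compat|unfold c; lra].
Qed.

Definition bic : Type := {B : op | bicommutant B}.

Lemma bic_eq (B B' : bic) : proj1_sig B = proj1_sig B' -> B = B'.
Proof.
destruct B as [B HB], B' as [B' HB']; simpl; intros E; subst B'.
f_equal; apply proof_irrelevance.
Qed.

Definition bic_mk B (H : bicommutant B) : bic := exist _ B H.
Definition bic_add (B B' : bic) : bic := bic_mk _ (bicommutant_plus _ _ (proj2_sig B) (proj2_sig B')).
Definition bic_mul (B B' : bic) : bic := bic_mk _ (bicommutant_comp _ _ (proj2_sig B) (proj2_sig B')).
Definition bic_opp (B : bic) : bic := bic_mk _ (bicommutant_opp _ (proj2_sig B)).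
Definition bic_emb (c : C) : bic := bic_mk _ (bicommutant_scal c _ bicommutant_id).

Lemma bic_ring_theory : ring_theory (bic_mk _ bicommutant_zero) (bic_mk _ bicommutant_id)
  bic_add bic_mul (fun B B' => bic_add B (bic_opp B')) bic_opp eq.
Proof.
split; intros; apply bic_eq; try (apply bop_ext; intros v; simpl).
- apply plus_zero_l.
- apply plus_comm.
- apply plus_assoc.
- reflexivity.
- exact (f_equal (fun E : op => E v) (bicommutant_comm _ _ (proj2_sig x) (proj2_sig y))).
- reflexivity.
- reflexivity.
- reflexivity.
- exact (plus_opp_r (proj1_sig x v)).
Qed.

Definition bicommutant_algebra : cbalg.
Proof.
refine (@CBAlg bic (bic_mk _ bicommutant_zero) (bic_mk _ bicommutant_id)
  bic_add bic_mul (fun B B' => bic_add B (bic_opp B')) bic_opp bic_ring_theory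
  bic_emb _ _ _ (fun B => opnorm (proj1_sig B)) _ _ _ _ _ _).
- apply bic_eq, bop_ext; intros v; exact (scal_one v).
- intros c d; apply bic_eq, bop_ext; intros v; exact (@scal_distr_r C_Ring X c d v).
- intros c d; apply bic_eq, bop_ext; intros v; symmetry; exact (scal_assoc c d v).
- intros B; apply opnorm_ge_0.
- intros B B'; apply opnorm_triangle.
- intros B B'; apply opnorm_comp.
- intros c; simpl; apply opnorm_le; [apply Cmod_ge_0|].
  intros v; exact (@norm_scal C_AbsRing X c v).
- intros B HB; apply bic_eq; exact (opnorm_eq_0 HB).
- intros u Hu; destruct (bop_complete (fun n => proj1_sig (u n)) Hu) as [l Hl].
  exists (bic_mk l (bicommutant_limit _ l (fun n => proj2_sig (u n)) Hl)); exact Hl.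
Defined.
End Operators.

(** * Laplace integrals of a strongly continuous semigroup *)

Lemma exp_le_compat x y : x <= y -> exp x <= exp y.
Proof. intros [H | ->]; [left; now apply exp_increasing|apply Rle_refl]. Qed.

(** The number [e^{-l s}], split into modulus and phase. *)
Definition cexp_neg (l : C) (s : R) : C := Cmult (RtoC (exp (- Re l * s))) (cis (- Im l * s)).

Lemma cexp_neg_0 l : cexp_neg l 0 = RtoC 1.
Proof. unfold cexp_neg; rewrite !Rmult_0_r, exp_0, cis_0; ring. Qed.

Lemma cexp_neg_add l s t : cexp_neg l (s + t) = Cmult (cexp_neg l s) (cexp_neg l t).
Proof. unfold cexp_neg; rewrite !Rmult_plus_distr_l, exp_plus, cis_add, RtoC_mult; ring. Qed.

Lemma cexp_neg_plus l m s : cexp_neg (Cplus l m) s = Cmult (cexp_neg l s) (cexp_neg m s).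
Proof.
unfold cexp_neg.
replace (- Re (Cplus l m) * s) with (- Re l * s + - Re m * s) by (unfold Re, Cplus; simpl; ring).
replace (- Im (Cplus l m) * s) with (- Im l * s + - Im m * s) by (unfold Im, Cplus; simpl; ring).
rewrite exp_plus, cis_add, RtoC_mult; ring.
Qed.

Lemma Cmod_cexp_neg l s : Cmod (cexp_neg l s) = exp (- Re l * s).
Proof.
unfold cexp_neg; rewrite Cmod_mult, Cmod_cis, Cmod_R, Rabs_pos_eq; [ring|left; apply exp_pos].
Qed.

Lemma cexp_neg_components l s :
  Re (cexp_neg l s) = exp (- Re l * s) * cos (- Im l * s) /\
  Im (cexp_neg l s) = exp (- Re l * s) * sin (- Im l * s).
Proof. unfold cexp_neg, cis, Re, Im, Cmult, RtoC; simpl; split; ring. Qed.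

Lemma cexp_neg_continuous l s e : 0 < e ->
  exists d, 0 < d /\ forall s', Rabs (s' - s) < d -> Cmod (Cminus (cexp_neg l s') (cexp_neg l s)) <= e.
Proof.
intros He.
set (f := fun s => exp (- Re l * s) * cos (- Im l * s)).
set (g := fun s => exp (- Re l * s) * sin (- Im l * s)).
assert (Hf : continuity_pt f s).
{ apply continuity_pt_filterlim, (ex_derive_continuous f); unfold f; auto_derive; exact I. }
assert (Hg : continuity_pt g s).
{ apply continuity_pt_filterlim, (ex_derive_continuous g); unfold g; auto_derive; exact I. }
destruct (Hf (e / 2) ltac:(lra)) as [d1 [Hd1 H1]], (Hg (e / 2) ltac:(lra)) as [d2 [Hd2 H2]].
exists (Rmin d1 d2); split; [now apply Rmin_pos|]; intros s' Hs.
assert (Hs1 : Rabs (s' - s) < d1) by (eapply Rlt_le_trans; [exact Hs|apply Rmin_l]).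
assert (Hs2 : Rabs (s' - s) < d2) by (eapply Rlt_le_trans; [exact Hs|apply Rmin_r]).
destruct (Req_dec s s') as [E|E].
{ subst s'; replace (Cminus (cexp_neg l s) (cexp_neg l s)) with (RtoC 0) by ring; rewrite Cmod_0; lra. }
assert (K1 : Rabs (f s' - f s) < e / 2) by (apply H1; repeat split; auto).
assert (K2 : Rabs (g s' - g s) < e / 2) by (apply H2; repeat split; auto).
eapply Rle_trans; [apply Cmod_Re_Im_le|].
replace (Re (Cminus (cexp_neg l s') (cexp_neg l s))) with (f s' - f s).
2:{ unfold f; destruct (cexp_neg_components l s') as [<- _], (cexp_neg_components l s) as [<- _]; reflexivity. }
replace (Im (Cminus (cexp_neg l s') (cexp_neg l s))) with (g s' - g s); [lra|].
unfold g; destruct (cexp_neg_components l s') as [_ <-], (cexp_neg_components l s) as [_ <-]; reflexivity.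
Qed.

Lemma cexp_neg_derivative_0 l e : 0 < e ->
  exists d, 0 < d /\ forall s, 0 < s < d ->
    Cmod (Cplus (Cminus (cexp_neg l s) (RtoC 1)) (Cmult l (RtoC s))) <= e * s.
Proof.
intros He.
set (f := fun s => exp (- Re l * s) * cos (- Im l * s)).
set (g := fun s => exp (- Re l * s) * sin (- Im l * s)).
assert (Hf : derivable_pt_lim f 0 (- Re l)).
{ apply is_derive_Reals; unfold f; auto_derive; [exact I|].
  rewrite !Rmult_0_r, exp_0, cos_0, sin_0; ring. }
assert (Hg : derivable_pt_lim g 0 (- Im l)).
{ apply is_derive_Reals; unfold g; auto_derive; [exact I|].
  rewrite !Rmult_0_r, exp_0, cos_0, sin_0; ring. }
destruct (Hf (e / 2) ltac:(lra)) as [d1 H1], (Hg (e / 2) ltac:(lra)) as [d2 H2].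
exists (Rmin d1 d2); split; [apply Rmin_pos; apply cond_pos|]; intros s [Hs0 Hs].
assert (Hs1 : Rabs s < d1) by (rewrite Rabs_pos_eq by lra; eapply Rlt_le_trans; [exact Hs|apply Rmin_l]).
assert (Hs2 : Rabs s < d2) by (rewrite Rabs_pos_eq by lra; eapply Rlt_le_trans; [exact Hs|apply Rmin_r]).
assert (Hgen : forall y y0 k, Rabs ((y - y0) / s - k) < e / 2 -> Rabs (y - y0 - k * s) <= e / 2 * s).
{ intros y y0 k H; replace (y - y0 - k * s) with (((y - y0) / s - k) * s) by (field; lra).
  rewrite Rabs_mult, (Rabs_pos_eq s) by lra; apply Rmult_le_compat_r; lra. }
specialize (H1 s ltac:(lra) Hs1); specialize (H2 s ltac:(lra) Hs2).
rewrite Rplus_0_l in H1, H2; apply Hgen in H1; apply Hgen in H2.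
eapply Rle_trans; [apply Cmod_Re_Im_le|].
assert (E0 : f 0 = 1 /\ g 0 = 0).
{ unfold f, g; rewrite !Rmult_0_r, exp_0, cos_0, sin_0; split; ring. }
destruct E0 as [E0 E1]; rewrite E0 in H1; rewrite E1 in H2.
replace (Re (Cplus (Cminus (cexp_neg l s) (RtoC 1)) (Cmult l (RtoC s)))) with (f s - 1 - - Re l * s).
2:{ unfold f; destruct (cexp_neg_components l s) as [<- _].
    unfold Re, Cplus, Cminus, Copp, Cmult, RtoC; simpl; ring. }
replace (Im (Cplus (Cminus (cexp_neg l s) (RtoC 1)) (Cmult l (RtoC s)))) with (g s - 0 - - Im l * s); [lra|].
unfold g; destruct (cexp_neg_components l s) as [_ <-].
unfold Im, Cplus, Cminus, Copp, Cmult, RtoC; simpl; ring.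
Qed.

(** * Riemann integrals with values in a complex Banach space *)

Definition restr_R_complete (X : CompleteNormedModule C_AbsRing) : CompleteNormedModule R_AbsRing :=
  CompleteNormedModule.Pack R_AbsRing X
    (CompleteNormedModule.Class R_AbsRing X (NormedModule.class _ (restr_R X))
      (CompleteSpace.mixin _ (CompleteSpace.class (CompleteNormedModule.CompleteSpace _ X)))) X.

Lemma is_linear_restr (X : NormedModule C_AbsRing) (B : bounded_op X) :
  @is_linear R_AbsRing (restr_R X) (restr_R X) B.
Proof.
destruct (bop_linear B) as [H1 H2 H3]; split; [exact H1| |exact H3].
intros k x; exact (H2 (RtoC k) x).
Qed.

Lemma is_RInt_bop (X : NormedModule C_AbsRing) (B : bounded_op X) (f : R -> X) a b (l : X) :
  @is_RInt (restr_R X) f a b l -> @is_RInt (restr_R X) (fun s => B (f s)) a b (B l).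
Proof.
intros H; unfold is_RInt.
assert (HL := is_linear_restr X B).
assert (E : forall ptd, B (@scal R_AbsRing (restr_R X) (sign (b - a)) (@Riemann_sum (restr_R X) f ptd)) =
   @scal R_AbsRing (restr_R X) (sign (b - a)) (@Riemann_sum (restr_R X) (fun s => B (f s)) ptd)).
{ intros ptd; eapply eq_trans; [apply (linear_scal _ HL)|]; f_equal.
  apply (SF_cons_ind (fun s => B (@Riemann_sum (restr_R X) f s) = @Riemann_sum (restr_R X) (fun t => B (f t)) s)).
  - intros x0; exact (linear_zero _ HL).
  - intros h s IH; rewrite !Riemann_sum_cons.
    eapply eq_trans; [apply (linear_plus _ HL)|].
    rewrite IH; f_equal; apply (linear_scal _ HL). }
eapply filterlim_ext; [exact E|].
eapply filterlim_comp; [exact H|].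
apply (@linear_cont R_AbsRing (restr_R X) (restr_R X) B l HL).
Qed.

Section Integral.
Variable X : CompleteNormedModule C_AbsRing.
Variables (T : R -> bounded_op X) (M : R).
Hypothesis HT : is_C0_semigroup T.
Hypothesis HM1 : 1 <= M.
Hypothesis HM : forall t, 0 <= t -> opnorm (T t) <= M.
Local Notation dist x y := (@norm C_AbsRing X (@minus (NormedModule.AbelianGroup C_AbsRing X) x y)).
Local Notation nX := (@norm C_AbsRing X).
Local Notation sc c x := (@scal C_AbsRing X c x).

Lemma T_bound t x : 0 <= t -> nX (T t x) <= M * nX x.
Proof.
intros Ht; eapply Rle_trans; [apply opnorm_bound|].
apply Rmult_le_compat_r; [apply norm_ge_0|now apply HM].
Qed.

Lemma T_add s t x : 0 <= s -> 0 <= t -> T (s + t) x = T s (T t x).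
Proof. intros Hs Ht; destruct HT as [_ [H _]]; rewrite H by assumption; reflexivity. Qed.

Lemma T_strong x e : 0 < e ->
  exists d, 0 < d /\ forall h, 0 <= h < d -> dist (T h x) x <= e.
Proof.
intros He; destruct HT as [H0 [_ H]]; specialize (H x).
assert (Hf : 0 < @norm_factor C_AbsRing X) by apply norm_factor_gt_0.
assert (He' : 0 < e / @norm_factor C_AbsRing X) by now apply Rdiv_lt_0_compat.
destruct (proj1 (filterlim_locally _ _) H (mkposreal _ He')) as [d Hd].
exists d; split; [apply cond_pos|]; intros h [Hh0 Hh].
destruct Hh0 as [Hh0|<-].
- assert (Hb : ball 0 d h).
  { unfold ball; simpl; unfold AbsRing_ball, abs, minus, plus, opp; simpl.
    rewrite Rabs_pos_eq; lra. }
  specialize (Hd h Hb Hh0); apply (@norm_compat2 C_AbsRing X) in Hd; simpl in Hd.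
  apply Rlt_le; eapply Rlt_le_trans; [exact Hd|right; field; lra].
- rewrite H0; apply Rle_trans with 0; [right|lra].
  exact (eq_trans (f_equal (@norm C_AbsRing X) (minus_eq_zero (x : X))) (@norm_zero C_AbsRing X)).
Qed.

(* Frozen for negative times, so that the integrands are continuous on all of [R]. *)
Definition te (s : R) : bounded_op X := T (Rmax 0 s).

Lemma te_diff s h x : 0 <= h -> dist (te (s + h) x) (te s x) <= M * dist (T (Rmax 0 (s + h) - Rmax 0 s) x) x.
Proof.
intros Hh; unfold te.
assert (H1 : 0 <= Rmax 0 s) by apply Rmax_l.
assert (H2 : Rmax 0 s <= Rmax 0 (s + h)) by (apply Rle_max_compat_l; lra).
replace (Rmax 0 (s + h)) with (Rmax 0 s + (Rmax 0 (s + h) - Rmax 0 s)) at 1 by ring.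
rewrite T_add by lra.
rewrite <- (bop_minus X); now apply T_bound.
Qed.

Lemma Rmax_diff s h : 0 <= h -> 0 <= Rmax 0 (s + h) - Rmax 0 s <= h.
Proof. intros Hh; unfold Rmax; destruct (Rle_dec 0 s), (Rle_dec 0 (s + h)); lra. Qed.

Lemma te_continuous s x e : 0 < e ->
  exists d, 0 < d /\ forall s', Rabs (s' - s) < d -> dist (te s' x) (te s x) <= e.
Proof.
intros He; destruct (T_strong x (e / M)) as [d [Hd H]]; [apply Rdiv_lt_0_compat; lra|].
exists d; split; [exact Hd|]; intros s' Hs.
assert (Hgen : forall t h, 0 <= h < d -> dist (te (t + h) x) (te t x) <= e).
{ intros t h Hh; eapply Rle_trans; [apply te_diff; lra|].
  pose proof (Rmax_diff t h ltac:(lra)).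
  apply Rle_trans with (M * (e / M)); [apply Rmult_le_compat_l; [lra|apply H; lra]|right; field; lra]. }
apply Rabs_def2 in Hs; destruct (Rle_lt_dec s s').
- replace s' with (s + (s' - s)) by ring; apply Hgen; lra.
- rewrite (normdist_sym X); replace s with (s' + (s - s')) by ring; apply Hgen; lra.
Qed.

Definition integrand (l : C) (x : X) (s : R) : X := sc (cexp_neg l s) (te s x).

Lemma te_bound s x : nX (te s x) <= M * nX x.
Proof. apply T_bound, Rmax_l. Qed.

Lemma integrand_continuous l x s : @continuous R_UniformSpace (restr_R X) (integrand l x) s.
Proof.
apply filterlim_locally; intros e.
set (K := M * nX x + 1).
assert (HK : 0 < K) by (unfold K; pose proof (@norm_ge_0 C_AbsRing X x); nra).
set (E := Cmod (cexp_neg l s) + 1); assert (HE : 0 < E) by (unfold E; pose proof (Cmod_ge_0 (cexp_neg l s)); lra).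
destruct (cexp_neg_continuous l s (e / (4 * K))) as [d1 [Hd1 H1]]; [apply Rdiv_lt_0_compat; [apply cond_pos|lra]|].
destruct (te_continuous s x (e / (4 * E))) as [d2 [Hd2 H2]]; [apply Rdiv_lt_0_compat; [apply cond_pos|lra]|].
assert (Hd : 0 < Rmin d1 d2) by now apply Rmin_pos.
exists (mkposreal _ Hd); intros s' Hs; simpl in Hs.
assert (Hs' : Rabs (s' - s) < Rmin d1 d2) by exact Hs.
apply (@norm_compat1 C_AbsRing X).
specialize (H1 s' (Rlt_le_trans _ _ _ Hs' (Rmin_l _ _))).
specialize (H2 s' (Rlt_le_trans _ _ _ Hs' (Rmin_r _ _))).
apply Rle_lt_trans with (e / (4 * K) * K + Cmod (cexp_neg l s) * (e / (4 * E))).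
- unfold integrand.
  apply Rle_trans with (nX (plus (sc (Cminus (cexp_neg l s') (cexp_neg l s)) (te s' x)) (sc (cexp_neg l s) (minus (te s' x) (te s x))))).
  + right; f_equal.
    set (a := te s' x); set (b := te s x); set (p := cexp_neg l s'); set (q := cexp_neg l s).
    eapply eq_trans; [apply (minus_trans (sc q a : X))|]; f_equal; symmetry.
    * exact (eq_trans (@scal_distr_r C_Ring X p (opp (q : C_Ring)) a)
        (f_equal (plus _) (@scal_opp_l C_Ring X q a))).
    * exact (eq_trans (@scal_distr_l C_Ring X q a (opp b))
        (f_equal (plus _) (@scal_opp_r C_Ring X q b))).
  + eapply Rle_trans; [apply (@norm_triangle C_AbsRing X)|]; apply Rplus_le_compat.
    * eapply Rle_trans; [apply (@norm_scal C_AbsRing X)|].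
      apply Rmult_le_compat; [apply Cmod_ge_0|apply norm_ge_0|exact H1|].
      pose proof (te_bound s' x); unfold K; lra.
    * eapply Rle_trans; [apply (@norm_scal C_AbsRing X)|].
      apply Rmult_le_compat_l; [apply Cmod_ge_0|exact H2].
- apply Rle_lt_trans with (e / 4 + e / 4); [|pose proof (cond_pos e); lra].
  apply Rplus_le_compat; [right; field; lra|].
  apply Rle_trans with (E * (e / (4 * E))); [|right; field; lra].
  apply Rmult_le_compat_r; [apply Rlt_le, Rdiv_lt_0_compat; [apply cond_pos|lra]|unfold E; lra].
Qed.

(** The Laplace integral is truncated at [t]; the full transform is recovered algebraically as
    [R0]. *)
Definition laplace (l : C) (t : R) (x : X) : X := @RInt (restr_R_complete X) (integrand l x) 0 t.

Lemma is_RInt_integrand l x a b :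
  @is_RInt (restr_R X) (integrand l x) a b (@RInt (restr_R_complete X) (integrand l x) a b).
Proof.
apply (@RInt_correct (restr_R_complete X)), (@ex_RInt_continuous (restr_R_complete X)).
intros; apply integrand_continuous.
Qed.

Lemma laplace_unique l t x y : @is_RInt (restr_R X) (integrand l x) 0 t y -> laplace l t x = y.
Proof. apply (@is_RInt_unique (restr_R_complete X)). Qed.

Lemma integrand_bound l x s : 0 <= Re l -> 0 <= s -> nX (integrand l x s) <= exp (- Re l * s) * (M * nX x).
Proof.
intros Hl Hs; eapply Rle_trans; [apply (@norm_scal C_AbsRing X)|].
change (Cmod (cexp_neg l s) * nX (te s x) <= exp (- Re l * s) * (M * nX x)).
rewrite Cmod_cexp_neg; apply Rmult_le_compat_l; [left; apply exp_pos|apply te_bound].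
Qed.

Lemma laplace_bound l t x : 0 <= Re l -> 0 <= t -> nX (laplace l t x) <= M * t * nX x.
Proof.
intros Hl Ht.
replace (M * t * nX x) with (scal (t - 0) (M * nX x)) by (unfold scal; simpl; unfold mult; simpl; ring).
apply (@norm_RInt_le (restr_R X) (integrand l x) (fun _ => M * nX x) 0 t); [exact Ht| |apply is_RInt_integrand|apply (@is_RInt_const R_NormedModule)].
intros s Hs; eapply Rle_trans; [apply integrand_bound; lra|].
rewrite <- (Rmult_1_l (M * nX x)) at 2; apply Rmult_le_compat_r.
- apply Rmult_le_pos; [lra|apply norm_ge_0].
- rewrite <- exp_0; apply exp_le_compat; nra.
Qed.

Lemma laplace_bound_Re l t x : 0 < Re l -> 0 <= t -> nX (laplace l t x) <= M / Re l * nX x.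
Proof.
intros Hl Ht; set (a := Re l) in *.
set (c := M * nX x).
assert (Hc : 0 <= c) by (apply Rmult_le_pos; [lra|apply norm_ge_0]).
assert (Hi : is_RInt (fun s => exp (- a * s) * c) 0 t
  (minus (- (exp (- a * t) * c / a)) (- (exp (- a * 0) * c / a)))).
{ apply (is_RInt_derive (fun s => - (exp (- a * s) * c / a))).
  - intros s _; auto_derive; [exact I|field; lra].
  - intros s _; apply (ex_derive_continuous (fun s => exp (- a * s) * c)); auto_derive; exact I. }
apply Rle_trans with (minus (- (exp (- a * t) * c / a)) (- (exp (- a * 0) * c / a))).
- refine (@norm_RInt_le (restr_R X) (integrand l x) _ 0 t _ _ Ht _ (is_RInt_integrand l x 0 t) Hi).
  intros s Hs; apply integrand_bound; unfold a in Hl; lra.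
- unfold minus, plus, opp; simpl; rewrite Rmult_0_r, exp_0.
  apply Rle_trans with (c / a); [|right; unfold c, Rdiv; ring].
  assert (0 <= exp (- a * t) * c / a).
  { apply Rmult_le_pos; [apply Rmult_le_pos; [left; apply exp_pos|exact Hc]|left; now apply Rinv_0_lt_compat]. }
  unfold Rdiv in *; lra.
Qed.

Lemma integrand_plus l x y s : integrand l (plus x y) s = plus (integrand l x s) (integrand l y s).
Proof.
unfold integrand; rewrite (bop_add X); exact (@scal_distr_l C_Ring X (cexp_neg l s) (te s x) (te s y)).
Qed.

Lemma laplace_plus l t x y : laplace l t (plus x y) = plus (laplace l t x) (laplace l t y).
Proof.
apply laplace_unique; eapply is_RInt_ext; [intros s _; symmetry; apply integrand_plus|].
apply (@is_RInt_plus (restr_R X)); apply is_RInt_integrand.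
Qed.

(** Used with [B] a scalar, for homogeneity of the integral, and with [B] in the commutant of [T],
    to place the integral in the bicommutant. *)
Lemma laplace_bop l t (B : bounded_op X) x : 0 <= t ->
  (forall s, 0 <= s -> B (T s x) = T s (B x)) -> laplace l t (B x) = B (laplace l t x).
Proof.
intros Ht HB; apply laplace_unique.
apply (@is_RInt_ext (restr_R X) (fun s => B (integrand l x s))).
- intros s _; unfold integrand; rewrite (bop_scalr X); f_equal; unfold te; apply HB, Rmax_l.
- apply is_RInt_bop, is_RInt_integrand.
Qed.

Lemma laplace_linear l t : 0 <= Re l -> 0 <= t -> @is_linear C_AbsRing X X (laplace l t).
Proof.
intros Hl Ht; split.
- apply laplace_plus.
- intros c x; apply (laplace_bop l t (bop_scal c (bop_id X)) x Ht).
  intros s _; symmetry; apply (bop_scalr X).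
- exists (M * t + 1); split; [nra|]; intros x.
  pose proof (laplace_bound l t x Hl Ht); pose proof (@norm_ge_0 C_AbsRing X x); nra.
Qed.

(** Applying [e^{-ls} T(s)] translates the integrand, so the left side is the integral over
    [[s, s + t]]. *)
Lemma laplace_shift l s t x : 0 <= s -> 0 <= t ->
  sc (cexp_neg l s) (T s (laplace l t x)) = minus (laplace l (s + t) x) (laplace l s x).
Proof.
intros Hs Ht.
assert (H1 : @is_RInt (restr_R X) (fun r => bop_scal (cexp_neg l s) (T s) (integrand l x r)) 0 t
   (bop_scal (cexp_neg l s) (T s) (laplace l t x))) by apply is_RInt_bop, is_RInt_integrand.
assert (H2 : @is_RInt (restr_R X) (integrand l x) s (s + t)
  (plus (opp (laplace l s x) : restr_R X) (laplace l (s + t) x))).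
{ apply (@is_RInt_Chasles (restr_R X) _ s 0).
  - apply (@is_RInt_swap (restr_R X)), is_RInt_integrand.
  - apply is_RInt_integrand. }
assert (H3 : @is_RInt (restr_R X) (fun r => @scal R_Ring (restr_R X) 1 (integrand l x (1 * r + s))) 0 t
  (plus (opp (laplace l s x) : restr_R X) (laplace l (s + t) x))).
{ apply (@is_RInt_comp_lin (restr_R X)).
  replace (1 * 0 + s) with s by ring; replace (1 * t + s) with (s + t) by ring; exact H2. }
assert (H4 : @is_RInt (restr_R X) (fun r => bop_scal (cexp_neg l s) (T s) (integrand l x r)) 0 t
  (plus (opp (laplace l s x) : restr_R X) (laplace l (s + t) x))).
{ eapply is_RInt_ext; [|exact H3]; intros r Hr.
  rewrite Rmin_left, Rmax_right in Hr by lra.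
  eapply eq_trans; [apply (@scal_one R_Ring (restr_R X))|].
  unfold integrand, te; simpl bop_fun.
  rewrite (bop_scalr X), !Rmax_right by lra.
  replace (1 * r + s) with (s + r) by ring.
  rewrite T_add, cexp_neg_add by lra.
  symmetry; apply (@scal_assoc C_Ring X). }
apply (@is_RInt_unique (restr_R_complete X)) in H1.
apply (@is_RInt_unique (restr_R_complete X)) in H4.
change (bop_scal (cexp_neg l s) (T s) (laplace l t x) = minus (laplace l (s + t) x) (laplace l s x)).
rewrite <- H1; eapply eq_trans; [exact H4|]; unfold minus; apply plus_comm.
Qed.

Lemma laplace_near l h x e : 0 <= h ->
  (forall s, 0 <= s <= h -> dist (sc (cexp_neg l s) (T s x)) x <= e) ->
  dist (laplace l h x) (sc (RtoC h) x) <= h * e.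
Proof.
intros Hh He.
assert (H : @is_RInt (restr_R X) (fun s => minus (integrand l x s : restr_R X) x) 0 h
  (minus (laplace l h x : restr_R X) (scal (h - 0) (x : restr_R X)))).
{ apply (@is_RInt_minus (restr_R X)); [apply is_RInt_integrand|apply (@is_RInt_const (restr_R X))]. }
rewrite Rminus_0_r in H.
replace (h * e) with (scal (h - 0) e) by (unfold scal; simpl; unfold mult; simpl; ring).
refine (@norm_RInt_le (restr_R X) _ (fun _ => e) 0 h _ _ Hh _ H (@is_RInt_const R_NormedModule 0 h e)).
intros s Hs; unfold integrand, te; rewrite Rmax_right by lra; exact (He s Hs).
Qed.
End Integral.

(** * Resolvent bounds and the extension, in the algebra *)

Lemma exp_neg_small a c e : 0 < a -> 0 <= c -> 0 < e ->
  exists t, 0 <= t /\ exp (- a * t) * c <= e.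
Proof.
intros Ha Hc He; exists (c / (e * a)).
assert (Hea : 0 < e * a) by nra.
assert (Hx : 0 <= c / e) by (apply Rmult_le_pos; [exact Hc|left; now apply Rinv_0_lt_compat]).
split; [apply Rmult_le_pos; [exact Hc|left; now apply Rinv_0_lt_compat]|].
replace (- a * (c / (e * a))) with (- (c / e)) by (field; lra).
rewrite exp_Ropp.
pose proof (exp_ineq1_le (c / e)) as H.
apply Rle_trans with (/ (1 + c / e) * c).
- apply Rmult_le_compat_r; [exact Hc|]; apply Rinv_le_contravar; lra.
- apply Rmult_le_reg_l with (1 + c / e); [lra|].
  rewrite <- Rmult_assoc, Rinv_r by lra.
  replace ((1 + c / e) * e) with (e + c) by (field; lra); lra.
Qed.

Section Semigroup.
Variable A : cbalg.
Add Ring cba_ring8 : (aring A).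
Variables (U : R -> A) (F : C -> R -> A) (M eps : R).
Hypothesis HM : 1 <= M.
Hypothesis Heps : 0 < eps <= 2.
Hypothesis U_0 : U 0 = 1%A.
Hypothesis U_add : forall s t, 0 <= s -> 0 <= t -> U (s + t) = (U s * U t)%A.
Hypothesis U_bound : forall t, 0 <= t -> nrm (U t) <= M.
Hypothesis U_eps : forall t, 0 < t -> nrm (U t - 1)%A <= 2 - eps.
Local Notation V l s := (emb (cexp_neg l s) * U s)%A.
Hypothesis F_shift : forall l s t, 0 < Re l -> 0 <= s -> 0 <= t ->
  (V l s * F l t = F l (s + t) - F l s)%A.
Hypothesis F_bound : forall l t, 0 < Re l -> 0 <= t -> nrm (F l t) <= M * t.
Hypothesis F_bound_Re : forall l t, 0 < Re l -> 0 <= t -> nrm (F l t) <= M / Re l.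
Hypothesis F_near : forall l h e (E : A), 0 < Re l -> 0 <= h ->
  (forall s, 0 <= s <= h -> nrm ((V l s - 1) * E)%A <= e) ->
  nrm ((F l h - emb (RtoC h)) * E)%A <= h * e.
(** Expresses in the algebra that the ranges of the operators [F 1 h] together are dense. *)
Hypothesis F_sep : forall W : A,
  (forall h, 0 < h -> (W * F (RtoC 1) h = 0)%A) -> W = 0%A.

Lemma nrm_V l s : 0 <= s -> nrm (V l s) <= exp (- Re l * s) * M.
Proof.
intros Hs; eapply Rle_trans; [apply nrm_emb_mul|]; rewrite Cmod_cexp_neg.
apply Rmult_le_compat_l; [left; apply exp_pos|now apply U_bound].
Qed.

Lemma nrm_V_le l s : 0 < Re l -> 0 <= s -> nrm (V l s) <= M.
Proof.
intros Hl Hs; eapply Rle_trans; [now apply nrm_V|].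
rewrite <- (Rmult_1_l M) at 2; apply Rmult_le_compat_r; [lra|].
rewrite <- exp_0; apply exp_le_compat.
assert (0 <= Re l * s) by (apply Rmult_le_pos; lra); lra.
Qed.

Lemma F_exchange l s t : 0 < Re l -> 0 <= s -> 0 <= t ->
  ((1 - V l t) * F l s = (1 - V l s) * F l t)%A.
Proof.
intros Hl Hs Ht.
transitivity (F l s - V l t * F l s)%A; [ring|].
transitivity (F l t - V l s * F l t)%A; [|ring].
rewrite !F_shift, (Rplus_comm s t) by assumption; ring.
Qed.

(** For large [tau] the norm of [V l tau] is at most [1/2], and [F l tau (1 - V l tau)^-1] sums the
    integrals over [[n tau, (n + 1) tau]], which is the Laplace transform. [F_exchange] carries the
    defining equation from [tau] to every [t]. *)
Lemma resolvent_exists : exists R0 : C -> A, forall l t, 0 < Re l -> 0 <= t ->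
  ((1 - V l t) * R0 l = F l t)%A.
Proof.
destruct (choice_fun C A (fun l r => 0 < Re l -> forall t, 0 <= t -> ((1 - V l t) * r = F l t)%A))
  as [R0 HR].
- intros l; destruct (excluded_middle_informative (0 < Re l)) as [Hl|Hl].
  2:{ exists 0%A; intros; contradiction. }
  destruct (exp_neg_small (Re l) M (/ 2) Hl ltac:(lra) ltac:(lra)) as [tau [Htau H]].
  destruct (neumann A (V l tau)) as [E [HE _]].
  { eapply Rle_trans; [now apply nrm_V|exact H]. }
  exists (F l tau * E)%A; intros _ t Ht.
  transitivity ((1 - V l t) * F l tau * E)%A; [ring|].
  rewrite F_exchange by assumption.
  transitivity (F l t * (E * (1 - V l tau)))%A; [ring|rewrite HE; ring].
- exists R0; intros l t Hl Ht; now apply HR.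
Qed.

Section Resolvent.
Variable R0 : C -> A.
Hypothesis R0_spec : forall l t, 0 < Re l -> 0 <= t -> ((1 - V l t) * R0 l = F l t)%A.

Lemma R0_eq l t : 0 < Re l -> 0 <= t -> (R0 l = F l t + V l t * R0 l)%A.
Proof. intros Hl Ht; rewrite <- R0_spec by assumption; ring. Qed.

Lemma R0_bound_Re l : 0 < Re l -> nrm (R0 l) * Re l <= M.
Proof.
intros Hl; apply Rmult_le_reg_r with (/ Re l); [now apply Rinv_0_lt_compat|].
rewrite Rmult_assoc, Rinv_r, Rmult_1_r by lra.
change (nrm (R0 l) <= M / Re l).
apply le_epsilon; intros e He.
assert (Hr := nrm_ge_0 A (R0 l)).
destruct (exp_neg_small (Re l) (M * nrm (R0 l)) e Hl ltac:(nra) He) as [t [Ht H]].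
rewrite (R0_eq l t Hl Ht); apply nrm_add_le; [now apply F_bound_Re|].
apply Rle_trans with (exp (- Re l * t) * M * nrm (R0 l)); [|lra].
apply nrm_mul_le; [now apply nrm_V|apply Rle_refl].
Qed.

(* For [t = PI / |Im l|] one has [exp (- l t) T(t) = - q T(t)] with [0 < q <= 1], and
   [1 + q T(t)] is bounded below by [1 + q - q (2 - eps) >= eps / 2]. *)
Lemma R0_bound_Im l : 0 < Re l -> nrm (R0 l) * Rabs (Im l) <= 8 * M / eps.
Proof.
intros Hl; assert (Hr := nrm_ge_0 A (R0 l)).
destruct (Req_dec (Im l) 0) as [E|E].
{ rewrite E, Rabs_R0, Rmult_0_r; apply Rlt_le, Rdiv_lt_0_compat; lra. }
assert (Hb : 0 < Rabs (Im l)) by now apply Rabs_pos_lt.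
assert (Hpi := PI_RGT_0).
set (t := PI / Rabs (Im l)).
assert (Ht : 0 < t) by now apply Rdiv_lt_0_compat.
set (q := exp (- Re l * t)).
assert (Hq : 0 < q <= 1).
{ split; [apply exp_pos|]; unfold q; rewrite <- exp_0; apply exp_le_compat; nra. }
assert (Ew : cexp_neg l t = Copp (RtoC q)).
{ unfold cexp_neg; fold q.
  assert (Ec : cis (- Im l * t) = Copp (RtoC 1)).
  { unfold cis, t; destruct (Rcase_abs (Im l)) as [Hn|Hp].
    - rewrite Rabs_left by lra; replace (- Im l * (PI / - Im l)) with PI by (field; lra).
      rewrite cos_PI, sin_PI; unfold Copp, RtoC; simpl; f_equal; ring.
    - rewrite Rabs_right by lra; replace (- Im l * (PI / Im l)) with (- PI) by (field; lra).
      rewrite cos_neg, sin_neg, cos_PI, sin_PI; unfold Copp, RtoC; simpl; f_equal; ring. }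
  rewrite Ec; ring. }
assert (H : (emb (RtoC (1 + q)) * R0 l = F l t + emb (RtoC q) * ((1 - U t) * R0 l))%A).
{ rewrite RtoC_plus, emb_add, emb_1.
  transitivity (R0 l + emb (RtoC q) * R0 l)%A; [ring|].
  rewrite (R0_eq l t Hl ltac:(lra)) at 1; rewrite Ew, emb_opp; ring. }
assert (Hn : (1 + q) * nrm (R0 l) <= M * t + q * ((2 - eps) * nrm (R0 l))).
{ replace ((1 + q) * nrm (R0 l)) with (nrm (emb (RtoC (1 + q)) * R0 l)%A).
  - rewrite H; apply nrm_add_le; [apply F_bound; lra|].
    eapply Rle_trans; [apply nrm_emb_mul|]; rewrite Cmod_R, Rabs_pos_eq by lra.
    apply Rmult_le_compat_l; [lra|]; apply nrm_mul_le; [|apply Rle_refl].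
    rewrite nrm_sub_sym; now apply U_eps.
  - rewrite nrm_emb_cancel; [rewrite Cmod_R, Rabs_pos_eq; lra|].
    intros E0; apply RtoC_inj in E0; lra. }
assert (Hn2 : eps / 2 * nrm (R0 l) <= M * t).
{ apply Rle_trans with ((1 + q - q * (2 - eps)) * nrm (R0 l)); [|lra].
  apply Rmult_le_compat_r; [exact Hr|nra]. }
apply Rmult_le_reg_l with (eps / 2); [lra|].
replace (eps / 2 * (8 * M / eps)) with (4 * M) by (field; lra).
apply Rle_trans with (M * t * Rabs (Im l)); [nra|].
unfold t; replace (M * (PI / Rabs (Im l)) * Rabs (Im l)) with (M * PI) by (field; lra).
(* [PI <= 4] is the origin of the constant 8. *)
pose proof PI_4; nra.
Qed.

Lemma R0_bound_mod l : 0 < Re l -> Cmod l * nrm (R0 l) <= 10 * M / eps.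
Proof.
intros Hl; pose proof (R0_bound_Re l Hl); pose proof (R0_bound_Im l Hl).
assert (Hr := nrm_ge_0 A (R0 l)).
apply Rle_trans with ((Rabs (Re l) + Rabs (Im l)) * nrm (R0 l)).
- apply Rmult_le_compat_r; [exact Hr|apply Cmod_Re_Im_le].
- rewrite (Rabs_pos_eq (Re l)) by lra.
  assert (M <= 2 * M / eps).
  { apply Rmult_le_reg_r with eps; [lra|]; unfold Rdiv; rewrite Rmult_assoc, Rinv_l by lra; nra. }
  replace (10 * M / eps) with (8 * M / eps + 2 * M / eps) by (field; lra); nra.
Qed.

Local Notation one_C := (RtoC 1).

Lemma Re_one : 0 < Re one_C.
Proof. unfold Re, RtoC; simpl; lra. Qed.

(* On the range of [F 1 d] the semigroup is Lipschitz at 0 in operator norm, so that strong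
   limits at 0 become norm limits. *)
Lemma V_near_one l d e : 0 < d -> 0 < e ->
  exists h0, 0 < h0 /\ forall s, 0 <= s < h0 -> nrm ((V l s - 1) * F one_C d)%A <= e.
Proof.
intros Hd He; assert (H1 := Re_one).
set (E := F one_C d); assert (HE := nrm_ge_0 A E).
set (c := (1 + M) * M).
set (m := Cminus l one_C).
set (e' := Rmin 1 (e / (2 * (nrm E + 1)))).
assert (He' : 0 < e') by (apply Rmin_pos; [lra|apply Rdiv_lt_0_compat; lra]).
destruct (cexp_neg_continuous m 0 e' He') as [h1 [Hh1 Hew]].
assert (Hc : 0 < c) by (unfold c; nra).
exists (Rmin h1 (e / (4 * c))); split; [apply Rmin_pos; [exact Hh1|apply Rdiv_lt_0_compat; lra]|].
intros s [Hs0 Hs].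
assert (Hs1 : s < h1) by (eapply Rlt_le_trans; [exact Hs|apply Rmin_l]).
assert (Hs2 : s < e / (4 * c)) by (eapply Rlt_le_trans; [exact Hs|apply Rmin_r]).
specialize (Hew s); rewrite Rminus_0_r, Rabs_pos_eq, cexp_neg_0 in Hew by lra.
specialize (Hew Hs1).
assert (HL : nrm ((V one_C s - 1) * E)%A <= e / 4).
(* Exchanging the roles of [s] and [d] moves the small time into [F 1 s], of norm at most [M s].
   Passing from 1 to [l] only costs the scalar [e^{-(l-1)s}]. *)
{ replace ((V one_C s - 1) * E)%A with (- ((1 - V one_C d) * F one_C s))%A.
  2:{ rewrite F_exchange by lra; fold E; ring. }
  rewrite nrm_opp; apply Rle_trans with ((1 + M) * (M * s)).
  - apply nrm_mul_le; [|apply F_bound; lra].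
    apply nrm_sub_le; [apply nrm_1|].
    apply nrm_V_le; lra.
  - apply Rle_trans with (c * (e / (4 * c))); [|right; field; lra].
    rewrite <- Rmult_assoc; fold c; apply Rmult_le_compat_l; lra. }
replace ((V l s - 1) * E)%A
  with (emb (cexp_neg m s) * ((V one_C s - 1) * E) + emb (Cminus (cexp_neg m s) one_C) * E)%A.
2:{ replace l with (Cplus m one_C) at 1 by (unfold m; ring).
    rewrite cexp_neg_plus, emb_mul, emb_sub, emb_1; ring. }
apply Rle_trans with (2 * (e / 4) + e / (2 * (nrm E + 1)) * nrm E).
- apply nrm_add_le; (eapply Rle_trans; [apply nrm_emb_mul|]).
  + apply Rmult_le_compat; [apply Cmod_ge_0|apply nrm_ge_0| |exact HL].
    replace (cexp_neg m s) with (Cplus (Cminus (cexp_neg m s) one_C) one_C) by ring.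
    eapply Rle_trans; [apply Cmod_triangle|]; rewrite Cmod_1.
    assert (e' <= 1) by apply Rmin_l; lra.
  + apply Rmult_le_compat_r; [exact HE|].
    eapply Rle_trans; [exact Hew|apply Rmin_r].
- assert (e / (2 * (nrm E + 1)) * nrm E <= e / 2); [|lra].
  apply Rmult_le_reg_r with (2 * (nrm E + 1)); [lra|].
  replace (e / (2 * (nrm E + 1)) * nrm E * (2 * (nrm E + 1))) with (e * nrm E) by (field; lra).
  nra.
Qed.

(** Exactly, [rm * F l h - rl * F m h = (e^{-nh} - 1) * rm * rl * V l h] with [n = m - l]. Divided
    by [h], this tends to the identity because [F l h] and [F m h] behave like [h]. The limit holds
    in norm only on the range of [E = F 1 d], and [F_sep] removes [E]. *)
Lemma R0_identity l m : 0 < Re l -> 0 < Re m ->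
  (R0 l - R0 m = emb (Cminus m l) * (R0 l * R0 m))%A.
Proof.
intros Hl Hm.
set (rl := R0 l); set (rm := R0 m); set (n := Cminus m l).
set (W := (rl - rm - emb n * (rl * rm))%A).
cut (W = 0%A).
{ intros H; transitivity (W + emb n * (rl * rm))%A; [unfold W; ring|rewrite H; ring]. }
apply F_sep; intros d Hd; apply nrm_eq_0, Rle_antisym; [|apply nrm_ge_0].
apply le_epsilon; intros e He.
set (E := F one_C d).
assert (Hrl := nrm_ge_0 A rl); assert (Hrm := nrm_ge_0 A rm); assert (HE := nrm_ge_0 A E).
assert (Hn := Cmod_ge_0 n).
assert (Hrr : 0 <= nrm rm * nrm rl) by nra.
assert (H0 : 0 <= nrm rm * nrm rl * M * nrm E) by (apply Rmult_le_pos; [apply Rmult_le_pos|]; lra).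
assert (H0' : 0 <= Cmod n * (nrm rm * nrm rl)) by nra.
set (c := nrm rl + nrm rm + nrm rm * nrm rl * M * nrm E + Cmod n * (nrm rm * nrm rl) + 1).
assert (Hc : 0 < c) by (unfold c; lra).
set (g := e / c); assert (Hg : 0 < g) by now apply Rdiv_lt_0_compat.
destruct (V_near_one l d g Hd Hg) as [h1 [Hh1 H1]].
destruct (V_near_one m d g Hd Hg) as [h2 [Hh2 H2]].
destruct (cexp_neg_derivative_0 n g Hg) as [h3 [Hh3 H3]].
set (h := Rmin h1 (Rmin h2 h3) / 2).
assert (Hh : 0 < h /\ h < h1 /\ h < h2 /\ h < h3).
{ assert (0 < Rmin h1 (Rmin h2 h3)) by (repeat apply Rmin_pos; assumption).
  pose proof (Rmin_l h1 (Rmin h2 h3)); pose proof (Rmin_r h1 (Rmin h2 h3)).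
  pose proof (Rmin_l h2 h3); pose proof (Rmin_r h2 h3); unfold h; lra. }
destruct Hh as [Hh [Hhh1 [Hhh2 Hhh3]]].
assert (K1 : nrm ((F l h - emb (RtoC h)) * E)%A <= h * g).
{ apply F_near; [lra|lra|]; intros s Hs; apply H1; lra. }
assert (K2 : nrm ((F m h - emb (RtoC h)) * E)%A <= h * g).
{ apply F_near; [lra|lra|]; intros s Hs; apply H2; lra. }
specialize (H1 h ltac:(lra)); specialize (H3 h ltac:(lra)).
assert (El : ((1 - V l h) * rl = F l h)%A) by (apply R0_spec; lra).
assert (Em : ((1 - V m h) * rm = F m h)%A) by (apply R0_spec; lra).
assert (EV : (V m h = emb (cexp_neg n h) * V l h)%A).
{ replace m with (Cplus n l) at 1 by (unfold n; ring); rewrite cexp_neg_plus, emb_mul; ring. }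
set (k := (Cplus (Cminus (cexp_neg n h) one_C) (Cmult n (RtoC h)))) in *.
set (v := V l h) in *.
assert (EW : (emb (RtoC h) * (W * E) =
  rm * ((F l h - emb (RtoC h)) * E) - rl * ((F m h - emb (RtoC h)) * E)
  - emb k * (rm * rl * v * E) + emb n * (emb (RtoC h) * (rm * rl * ((v - 1) * E))))%A).
{ rewrite <- El, <- Em, EV; unfold k, W; rewrite emb_add, emb_sub, emb_mul, emb_1; ring. }
apply Rmult_le_reg_l with h; [exact Hh|].
replace (h * nrm (W * E)%A) with (nrm (emb (RtoC h) * (W * E))%A).
2:{ rewrite nrm_emb_cancel; [rewrite Cmod_R, Rabs_pos_eq; lra|].
    intros E0; apply RtoC_inj in E0; lra. }
rewrite EW.
apply Rle_trans with (nrm rm * (h * g) + nrm rl * (h * g)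
  + g * h * (nrm rm * nrm rl * M * nrm E) + Cmod n * (h * (nrm rm * nrm rl * g))).
- apply nrm_add_le; [apply nrm_sub_le; [apply nrm_sub_le|]|].
  + apply nrm_mul_le; [apply Rle_refl|exact K1].
  + apply nrm_mul_le; [apply Rle_refl|exact K2].
  + eapply Rle_trans; [apply nrm_emb_mul|].
    apply Rmult_le_compat; [apply Cmod_ge_0|apply nrm_ge_0|exact H3|].
    apply nrm_mul_le; [apply nrm_mul_le; [apply nrm_mul_le; apply Rle_refl|apply nrm_V_le; lra]|apply Rle_refl].
  + eapply Rle_trans; [apply nrm_emb_mul|]; apply Rmult_le_compat_l; [exact Hn|].
    eapply Rle_trans; [apply nrm_emb_mul|]; rewrite Cmod_R, Rabs_pos_eq by lra.
    apply Rmult_le_compat_l; [lra|]; apply nrm_mul_le; [apply nrm_mul_le; apply Rle_refl|exact H1].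
- apply Rle_trans with (h * (g * (c - 1))); [right; unfold c; ring|].
  apply Rmult_le_compat_l; [lra|].
  rewrite Rplus_0_l; apply Rle_trans with (g * c); [nra|right; unfold g; field; lra].
Qed.

(** * The Euler scheme and its agreement with the semigroup *)

Local Notation b := (10 * M / eps).
Local Notation kappa := (/ (4 * b)).
Local Notation Q := (euler_op A R0).
Local Notation J := (R0 one_C).

Lemma b_ge : 5 * M <= b.
Proof.
apply Rmult_le_reg_r with eps; [lra|]; replace (b * eps) with (10 * M) by (field; lra); nra.
Qed.

Lemma kappa_bounds : 0 <= kappa <= 1.
Proof.
pose proof b_ge; split; [left; apply Rinv_0_lt_compat; lra|].
rewrite <- Rinv_1; apply Rinv_le_contravar; lra.
Qed.

Definition power_const : R := 32 * (1 + 2 * M) * (1 + b).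
Definition derivative_const : R := 64 * (1 + 2 * M) * (1 + b) * (2 * b + 1).

Lemma power_const_ge : 1 <= power_const.
Proof. pose proof b_ge; unfold power_const; nra. Qed.

Lemma Q_bounds h k : cone kappa h ->
  nrm (Q h ^ k)%A <= power_const /\ INR (S k) * nrm ((Q h - 1) * Q h ^ k)%A <= derivative_const.
Proof.
pose proof b_ge.
apply (euler_bounds A R0 M b); [lra|lra|apply R0_identity|apply R0_bound_Re|apply R0_bound_mod].
Qed.

Lemma J_euler : Q one_C = J.
Proof.
unfold euler_op; replace (Cinv one_C) with one_C by (field; intros E; apply RtoC_inj in E; lra).
rewrite emb_1; ring.
Qed.

Lemma cone_real t : 0 < t -> cone kappa (RtoC t).
Proof.
intros Ht; split; unfold Re, Im, RtoC; simpl; [exact Ht|].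
rewrite Rabs_R0; apply Rmult_le_pos; [apply kappa_bounds|lra].
Qed.

(** As [J = (1 - A)^-1], the product [A J = J - 1] is bounded; thus [Q h - 1 = h A Q h] is of order
    [h] on the range of [J]. *)
Lemma Q_minus_one_J h : cone kappa h -> ((Q h - 1) * J = emb h * (Q h * (J - 1)))%A.
Proof.
intros Hh.
pose proof (yosida_euler_comm A R0 R0_identity h one_C (proj1 Hh) Re_one) as H.
unfold yosida in H; rewrite J_euler in H.
replace (Cinv one_C) with one_C in H by (field; intros E; apply RtoC_inj in E; lra).
rewrite emb_1 in H.
transitivity (emb h * (emb (Cinv h) * (Q h - 1) * J))%A.
- transitivity (emb (Cmult h (Cinv h)) * ((Q h - 1) * J))%A; [|rewrite emb_mul; ring].
  rewrite Cinv_r, emb_1 by (eapply cone_neq_0; exact Hh); ring.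
- rewrite H; ring.
Qed.

(** With [h = z / k] the bound is a multiple of [|z|] independent of [k]; it gives strong continuity
    of the extension at 0. *)
Lemma apow_minus_one_J h k : cone kappa h ->
  nrm ((Q h ^ k - 1) * J)%A <= INR k * Cmod h * (power_const * power_const * (nrm J + 1)).
Proof.
intros Hh; assert (HB := power_const_ge).
replace ((Q h ^ k - 1) * J)%A with (emb h * asum (fun i => Q h ^ i * (Q h * (J - 1))) k)%A.
2:{ rewrite (asum_rmul A (fun i => Q h ^ i)%A).
    pose proof (apow_sub A (Q h) 1%A k) as H; rewrite apow_1 in H; rewrite H.
    rewrite (asum_ext A (fun i => Q h ^ i * 1 ^ (k - 1 - i))%A (fun i => Q h ^ i)%A).
    2:{ intros; rewrite apow_1; ring. }
    transitivity ((Q h - 1) * J * asum (fun i => Q h ^ i) k)%A; [|ring].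
    rewrite Q_minus_one_J by exact Hh; ring. }
eapply Rle_trans; [apply nrm_emb_mul|].
apply Rle_trans with (Cmod h * (INR k * (power_const * (power_const * (nrm J + 1))))); [|right; ring].
apply Rmult_le_compat_l; [apply Cmod_ge_0|]; apply nrm_asum_const; intros i _.
apply nrm_mul_le; [now apply Q_bounds|]; apply nrm_mul_le.
- replace (Q h) with (Q h ^ 1)%A by (simpl; ring); now apply Q_bounds.
- apply nrm_sub_le; [apply Rle_refl|apply nrm_1].
Qed.

Lemma exp_le_quadratic h : 0 <= h <= / 2 -> 1 + h <= exp h <= 1 + h + 2 * h ^ 2.
Proof.
intros Hh; split; [apply exp_ineq1_le|].
pose proof (exp_ineq1_le (- h)) as H; rewrite exp_Ropp in H; pose proof (exp_pos h) as Hp.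
assert (H1 : (1 - h) * exp h <= 1).
{ apply Rle_trans with (/ exp h * exp h); [apply Rmult_le_compat_r; lra|right; field; lra]. }
assert (H2 : 1 <= (1 - h) * (1 + h + 2 * h ^ 2)) by nra.
nra.
Qed.

Definition local_const : R :=
  2 * (nrm J * nrm J) + 2 * M + 2 * nrm J + power_const * ((nrm J + 1) * (nrm J + 1)).

(** Consistency of the implicit Euler scheme: on the range of [J^2], which lies in the domain of
    [A^2], both [U h] and [Q h] agree with [1 + h A] up to order [h^2]. *)
Lemma U_minus_Q_JJ h : 0 < h <= / 2 ->
  nrm ((U h - Q (RtoC h)) * (J * J))%A <= local_const * h ^ 2.
Proof.
intros Hh; assert (HB := power_const_ge); assert (HJ := nrm_ge_0 A J); assert (H1 := Re_one).
destruct (exp_le_quadratic h ltac:(lra)) as [He1 He2].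
assert (Hc : cone kappa (RtoC h)) by (apply cone_real; lra).
set (x := RtoC (exp h)).
assert (Ex : Cmult x (cexp_neg one_C h) = one_C).
{ unfold cexp_neg.
  replace (- Re one_C * h) with (- h) by (unfold Re, RtoC; simpl; ring).
  replace (- Im one_C * h) with 0 by (unfold Im, RtoC; simpl; ring).
  rewrite cis_0, exp_Ropp; unfold x.
  transitivity (Cmult (RtoC (exp h)) (RtoC (/ exp h))); [ring|].
  rewrite <- RtoC_mult, Rinv_r; [reflexivity|apply Rgt_not_eq, exp_pos]. }
assert (EU : (U h * J = emb x * (J - F one_C h))%A).
{ rewrite <- R0_spec by lra.
  transitivity (emb (Cmult x (cexp_neg one_C h)) * (U h * J))%A; [rewrite Ex, emb_1; ring|].
  rewrite emb_mul; ring. }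
assert (EQ := Q_minus_one_J (RtoC h) Hc).
assert (EQ2 : ((Q (RtoC h) - 1) * (J * J) = emb (RtoC h) * (J * (J - 1))
  + emb (RtoC h) * (emb (RtoC h) * (Q (RtoC h) * ((J - 1) * (J - 1)))))%A).
{ transitivity ((Q (RtoC h) - 1) * J * J)%A; [ring|]; rewrite EQ.
  transitivity (emb (RtoC h) * (J * (J - 1)) + emb (RtoC h) * ((Q (RtoC h) - 1) * J * (J - 1)))%A; [ring|].
  rewrite EQ; ring. }
set (y := Cminus (Cminus x one_C) (RtoC h)).
replace ((U h - Q (RtoC h)) * (J * J))%A with
  (emb y * (J * J) - emb x * ((F one_C h - emb (RtoC h)) * J) - emb (Cminus x one_C) * (emb (RtoC h) * J)
    - emb (RtoC h) * (emb (RtoC h) * (Q (RtoC h) * ((J - 1) * (J - 1)))))%A.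
2:{ transitivity ((U h * J) * J - (Q (RtoC h) - 1) * (J * J) - J * J)%A; [|ring].
    rewrite EU, EQ2; unfold y; rewrite !emb_sub, emb_1; ring. }
assert (HF : nrm ((F one_C h - emb (RtoC h)) * J)%A <= h * (M * h)).
{ apply F_near; [exact H1|lra|]; intros s Hs.
  replace ((V one_C s - 1) * J)%A with (- F one_C s)%A by (rewrite <- R0_spec by lra; ring).
  rewrite nrm_opp; eapply Rle_trans; [apply F_bound; lra|nra]. }
assert (Hx : Cmod x <= 2).
{ unfold x; rewrite Cmod_R, Rabs_pos_eq; [nra|left; apply exp_pos]. }
assert (Hx1 : Cmod (Cminus x one_C) <= 2 * h).
{ unfold x; rewrite <- RtoC_minus, Cmod_R, Rabs_pos_eq; nra. }
assert (Hy : Cmod y <= 2 * h ^ 2).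
{ unfold y, x; rewrite <- !RtoC_minus, Cmod_R, Rabs_pos_eq; lra. }
assert (Hhm : Cmod (RtoC h) = h) by (rewrite Cmod_R, Rabs_pos_eq; lra).
apply Rle_trans with (2 * h ^ 2 * (nrm J * nrm J) + 2 * (h * (M * h)) + 2 * h * (h * nrm J)
  + h * (h * (power_const * ((nrm J + 1) * (nrm J + 1))))); [|right; unfold local_const; ring].
assert (HJ1 : nrm (J - 1)%A <= nrm J + 1) by (apply nrm_sub_le; [apply Rle_refl|apply nrm_1]).
repeat apply nrm_sub_le; (eapply Rle_trans; [apply nrm_emb_mul|]).
- apply Rmult_le_compat; [apply Cmod_ge_0|apply nrm_ge_0|exact Hy|apply nrm_mul].
- apply Rmult_le_compat; [apply Cmod_ge_0|apply nrm_ge_0|exact Hx|exact HF].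
- apply Rmult_le_compat; [apply Cmod_ge_0|apply nrm_ge_0|exact Hx1|].
  rewrite <- Hhm at 2; apply nrm_emb_mul.
- rewrite Hhm; apply Rmult_le_compat_l; [lra|].
  eapply Rle_trans; [apply nrm_emb_mul|]; rewrite Hhm; apply Rmult_le_compat_l; [lra|].
  apply nrm_mul_le; [replace (Q (RtoC h)) with (Q (RtoC h) ^ 1)%A by (simpl; ring); now apply Q_bounds|].
  now apply nrm_mul_le.
Qed.

Lemma U_pow h k : 0 <= h -> (U h ^ k)%A = U (INR k * h).
Proof.
intros Hh; induction k as [|k IH]; [simpl; rewrite Rmult_0_l, U_0; reflexivity|].
change (U h * U h ^ k = U (INR (S k) * h))%A.
rewrite IH, <- U_add by (try apply Rmult_le_pos; auto using pos_INR).
f_equal; rewrite S_INR; ring.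
Qed.

(** Stability and consistency give convergence: the telescoped difference has [k] terms of size
    [h^2] with [h = t / k]. *)
Lemma U_minus_euler_pow_JJ t k : 0 < t -> (0 < k)%nat -> t <= / 2 * INR k ->
  nrm ((U t - euler_pow A Q k (RtoC t)) * (J * J))%A <= M * power_const * local_const * t ^ 2 / INR k.
Proof.
intros Ht Hk Htk; assert (HB := power_const_ge).
assert (Hk0 : 0 < INR k) by now apply lt_0_INR.
set (h := / INR k * t).
assert (Hi : 0 < / INR k) by now apply Rinv_0_lt_compat.
assert (Hh : 0 < h) by (unfold h; nra).
assert (Hh2 : h <= / 2).
{ unfold h; apply Rmult_le_reg_l with (INR k); [exact Hk0|].
  rewrite <- Rmult_assoc, Rinv_r by lra; lra. }
assert (Hc : cone kappa (RtoC h)) by now apply cone_real.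
unfold euler_pow; rewrite <- RtoC_mult; fold h.
replace (U t) with (U h ^ k)%A by (rewrite U_pow by lra; f_equal; unfold h; field; lra).
rewrite apow_sub.
replace ((U h - Q (RtoC h)) * asum (fun i => U h ^ i * Q (RtoC h) ^ (k - 1 - i)) k * (J * J))%A
  with (asum (fun i => U h ^ i * Q (RtoC h) ^ (k - 1 - i) * ((U h - Q (RtoC h)) * (J * J))) k)%A
  by (rewrite asum_rmul; ring).
apply Rle_trans with (INR k * (M * power_const * (local_const * h ^ 2))).
- apply nrm_asum_const; intros i _; apply nrm_mul_le; [apply nrm_mul_le|].
  + rewrite U_pow by lra; apply U_bound, Rmult_le_pos; [apply pos_INR|lra].
  + now apply Q_bounds.
  + apply U_minus_Q_JJ; lra.
- right; unfold h; field; lra.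
Qed.

Lemma F_factor h : 0 <= h -> (F one_C h = J * (1 - V one_C h))%A.
Proof. intros Hh; rewrite <- R0_spec by (apply Re_one || exact Hh); ring. Qed.

Lemma semigroup_extension : exists S : C -> A,
  (forall z, cone kappa z -> nrm (S z) <= power_const) /\
  (forall z1 z2, cone kappa z1 -> cone kappa z2 -> S (Cplus z1 z2) = (S z1 * S z2)%A) /\
  (forall z, cone kappa z -> exists D, nrm D <= derivative_const / Cmod z /\
     forall z', cone kappa z' -> Cmod z <= 2 * Cmod z' ->
       nrm (S z' - S z - emb (Cminus z' z) * D)%A <=
         256 * derivative_const ^ 2 * power_const * Cmod (Cminus z' z) ^ 2 / Cmod z ^ 2) /\
  (forall t, 0 < t -> S (RtoC t) = U t) /\
  (forall z, cone kappa z ->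
     nrm ((S z - 1) * J)%A <= Cmod z * (power_const * power_const * (nrm J + 1))).
Proof.
destruct (holomorphic_extension A Q kappa power_const derivative_const kappa_bounds power_const_ge) as [S [H1 [H2 [H3 H4]]]].
- intros; now apply Q_bounds.
- intros; now apply Q_bounds.
- intros h h' [Hh _] [Hh' _]; exact (yosida_euler_comm A R0 R0_identity h h' Hh Hh').
- exists S; split; [exact H2|split; [exact H3|split; [exact H4|split]]].
  + intros t Ht.
    assert (HJJ : ((U t - S (RtoC t)) * (J * J) = 0)%A).
    { apply (alim_unique A (fun n => (U t - euler_pow A Q (2 ^ n) (RtoC t)) * (J * J))%A).
      - apply alim_mul; [apply alim_sub; [apply alim_const|apply H1, cone_real, Ht]|apply alim_const].
      - intros e He.
        set (c := M * power_const * local_const * t ^ 2).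
        destruct (half_pow_small c e He) as [N1 HN1].
        destruct (half_pow_small t (/ 2) ltac:(lra)) as [N2 HN2].
        exists (Nat.max N1 N2); intros n Hn.
        assert (Hp : (0 < 2 ^ n)%nat) by (apply Nat.neq_0_lt_0, Nat.pow_nonzero; lia).
        assert (Hp0 : 0 < INR (2 ^ n)) by now apply lt_0_INR.
        assert (Ei : (/ 2) ^ n = / INR (2 ^ n)) by (rewrite pow_inv, pow_INR; reflexivity).
        replace ((U t - euler_pow A Q (2 ^ n) (RtoC t)) * (J * J) - 0)%A
          with ((U t - euler_pow A Q (2 ^ n) (RtoC t)) * (J * J))%A by ring.
        eapply Rle_trans; [apply U_minus_euler_pow_JJ; [exact Ht|exact Hp|]|].
        + specialize (HN2 n ltac:(lia)); rewrite Ei in HN2.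
          apply Rmult_le_reg_r with (/ INR (2 ^ n)); [now apply Rinv_0_lt_compat|].
          rewrite Rmult_assoc, Rinv_r by lra; lra.
        + specialize (HN1 n ltac:(lia)); rewrite Ei in HN1; exact HN1. }
    assert (HD : (U t - S (RtoC t) = 0)%A).
    (* Each [F 1 h] contains one factor [J], so two separations cancel [J * J]. *)
    { apply F_sep; intros h Hh; apply F_sep; intros h' Hh'.
      rewrite !F_factor by lra.
      transitivity ((U t - S (RtoC t)) * (J * J) * ((1 - V one_C h) * (1 - V one_C h')))%A; [ring|].
      rewrite HJJ; ring. }
    transitivity (U t - (U t - S (RtoC t)))%A; [ring|rewrite HD; ring].
  + intros z Hz.
    apply (alim_nrm_le A (fun n => (euler_pow A Q (2 ^ n) z - 1) * J)%A _ _ 0).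
    * apply alim_mul; [apply alim_sub; [now apply H1|apply alim_const]|apply alim_const].
    * intros n _.
      assert (Hp : (0 < 2 ^ n)%nat) by (apply Nat.neq_0_lt_0, Nat.pow_nonzero; lia).
      assert (Hp0 : 0 < INR (2 ^ n)) by now apply lt_0_INR.
      unfold euler_pow; eapply Rle_trans; [apply apow_minus_one_J, step_cone; assumption|].
      rewrite step_Cmod by exact Hp; right; field; lra.
Qed.
End Resolvent.
End Semigroup.

(** * Back to operators *)

Section Instance.
Variable X : CompleteNormedModule C_AbsRing.
Variables (T : R -> bounded_op X) (M eps : R).
Hypothesis HT : is_C0_semigroup T.
Hypothesis HM1 : 1 <= M.
Hypothesis HM : forall t, 0 <= t -> opnorm (T t) <= M.
Hypothesis Heps : 0 < eps <= 2.
Hypothesis HTeps : forall t, 0 < t -> opnorm (minus (T t) (bop_id X)) <= 2 - eps.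
Local Notation XN := (CompleteNormedModule.NormedModule C_AbsRing X).
Local Notation dist x y := (@norm C_AbsRing XN (@minus (NormedModule.AbelianGroup C_AbsRing XN) x y)).
Local Notation nX := (@norm C_AbsRing XN).
Local Notation sc c x := (@scal C_AbsRing XN c x).

Definition semigroup_range (E : bounded_op X) : Prop := exists t, 0 <= t /\ E = T t.

Lemma semigroup_range_comm E E' : semigroup_range E -> semigroup_range E' ->
  bop_comp E E' = bop_comp E' E.
Proof.
intros [t [Ht ->]] [s [Hs ->]]; destruct HT as [_ [H _]].
rewrite <- !H by assumption; f_equal; ring.
Qed.

Definition Alg : cbalg :=
  bicommutant_algebra XN (complete_norm_complete X) semigroup_range semigroup_range_comm.

Definition opval (W : Alg) : bounded_op X := proj1_sig W.

Lemma range_te t : semigroup_range (T (Rmax 0 t)).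
Proof. exists (Rmax 0 t); split; [apply Rmax_l|reflexivity]. Qed.

(** Times are clamped at 0 because [T] is unconstrained at negative times and need not lie in the
    bicommutant there. *)
Definition Ualg (t : R) : Alg := bic_mk XN semigroup_range _ (bicommutant_gen XN semigroup_range _ (range_te t)).

Lemma opval_Ualg t : 0 <= t -> opval (Ualg t) = T t.
Proof. intros Ht; simpl; now rewrite Rmax_right. Qed.

Lemma alg_eq (W W' : Alg) : (forall x, opval W x = opval W' x) -> W = W'.
Proof. intros H; apply bic_eq, bop_ext; exact H. Qed.

Lemma nrm_le (W : Alg) c : 0 <= c -> (forall x, nX (opval W x) <= c * nX x) -> nrm W <= c.
Proof. intros Hc H; apply opnorm_le; assumption. Qed.

Lemma nrm_bound (W : Alg) x : nX (opval W x) <= nrm W * nX x.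
Proof. apply opnorm_bound. Qed.

Lemma integral_exists : exists F : C -> R -> Alg, forall l t x, 0 < Re l -> 0 <= t ->
  opval (F l t) x = laplace X T l t x.
Proof.
destruct (choice_fun (C * R) Alg (fun p W => 0 < Re (fst p) -> 0 <= snd p ->
   forall x, opval W x = laplace X T (fst p) (snd p) x)) as [F HF].
- intros [l t]; simpl.
  destruct (excluded_middle_informative (0 < Re l /\ 0 <= t)) as [[Hl Ht]|H].
  2:{ exists (@azero Alg); intros; exfalso; auto. }
  pose proof (laplace_linear X T M HT HM1 HM l t ltac:(lra) Ht) as HL.
  assert (HB : bicommutant XN semigroup_range (BoundedOp HL)).
  { intros D HD; apply bop_ext; intros x; symmetry; simpl.
    apply (laplace_bop X T M HT HM1 HM l t D x Ht); intros s Hs.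
    apply (f_equal (fun E : bounded_op X => E x) (HD (T s) (ex_intro _ s (conj Hs eq_refl)))). }
  exists (bic_mk XN semigroup_range _ HB); reflexivity.
- exists (fun l t => F (l, t)); intros l t x Hl Ht; exact (HF (l, t) Hl Ht x).
Qed.

Lemma V_strong l x e : 0 < e ->
  exists d, 0 < d /\ forall s, 0 <= s < d -> dist (sc (cexp_neg l s) (T s x)) x <= e.
Proof.
intros He.
assert (Hf : 0 < @norm_factor C_AbsRing XN) by apply norm_factor_gt_0.
assert (He' : 0 < e / @norm_factor C_AbsRing XN) by now apply Rdiv_lt_0_compat.
destruct (proj1 (filterlim_locally _ _) (integrand_continuous X T M HT HM1 HM l x 0) (mkposreal _ He')) as [d Hd].
exists d; split; [apply cond_pos|]; intros s [Hs0 Hs].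
assert (Hb : @ball R_UniformSpace 0 d s).
{ unfold ball; simpl; unfold AbsRing_ball, abs, minus, plus, opp; simpl.
  rewrite Rabs_pos_eq; lra. }
specialize (Hd s Hb); apply (@norm_compat2 C_AbsRing XN) in Hd; simpl in Hd.
unfold integrand, te in Hd; rewrite Rmax_right, Rmax_left, cexp_neg_0 in Hd by lra.
assert (E0 : sc (RtoC 1) (T 0 x) = x).
{ destruct HT as [H0 _]; rewrite H0; exact (@scal_one C_Ring XN x). }
apply Rle_trans with (@norm_factor C_AbsRing XN * (e / @norm_factor C_AbsRing XN)); [|right; field; lra].
apply Rlt_le; eapply Rle_lt_trans; [|exact Hd].
right; exact (f_equal (fun y => dist (sc (cexp_neg l s) (T s x)) y) (eq_sym E0)).
Qed.

Lemma F_strong l x e : 0 < Re l -> 0 < e ->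
  exists d, 0 < d /\ forall h, 0 < h < d -> dist (laplace X T l h x) (sc (RtoC h) x) <= h * e.
Proof.
intros Hl He; destruct (V_strong l x e He) as [d [Hd H]].
exists d; split; [exact Hd|]; intros h Hh.
apply (laplace_near X T M HT HM1 HM); [lra|]; intros s Hs; apply H; lra.
Qed.

Lemma norm_scal_R h x : 0 <= h -> nX (sc (RtoC h) x) = h * nX x.
Proof.
intros Hh; apply Rle_antisym.
- eapply Rle_trans; [apply (@norm_scal C_AbsRing XN)|].
  change (Cmod (RtoC h) * nX x <= h * nX x); rewrite Cmod_R, Rabs_pos_eq; lra.
- destruct Hh as [Hh|<-].
  2:{ rewrite Rmult_0_l; apply norm_ge_0. }
  assert (E : x = sc (RtoC (/ h)) (sc (RtoC h) x)).
  { rewrite scal_assoc; change (x = sc (Cmult (RtoC (/ h)) (RtoC h)) x).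
    rewrite <- RtoC_mult, Rinv_l by lra; symmetry; exact (@scal_one C_Ring XN x). }
  rewrite E at 1.
  apply Rle_trans with (h * (/ h * nX (sc (RtoC h) x))); [|right; field; lra].
  apply Rmult_le_compat_l; [lra|].
  eapply Rle_trans; [apply (@norm_scal C_AbsRing XN)|].
  change (Cmod (RtoC (/ h)) * nX (sc (RtoC h) x) <= / h * nX (sc (RtoC h) x)).
  rewrite Cmod_R, Rabs_pos_eq; [lra|left; now apply Rinv_0_lt_compat].
Qed.

Section WithIntegral.
Variable F : C -> R -> Alg.
Hypothesis HF : forall l t x, 0 < Re l -> 0 <= t -> opval (F l t) x = laplace X T l t x.

(** [F 1 h x / h] tends to [x] by strong continuity, and [W] is bounded. *)
Lemma F_separating (W : Alg) : (forall h, 0 < h -> amul W (F (RtoC 1) h) = azero) -> W = azero.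
Proof.
intros H; apply alg_eq; intros x; apply (normdist_eq XN); intros e He.
assert (HW := nrm_ge_0 Alg W).
destruct (F_strong (RtoC 1) x (e / (nrm W + 1)) Re_one) as [d [Hd Hs]]; [apply Rdiv_lt_0_compat; lra|].
set (h := d / 2); specialize (Hs h ltac:(unfold h; lra)).
assert (Hh : 0 < h) by (unfold h; lra).
rewrite <- HF in Hs by (apply Re_one || lra).
assert (E : opval W (opval (F (RtoC 1) h) x) = zero).
{ exact (f_equal (fun Z : Alg => opval Z x) (H h Hh)). }
assert (E1 : nX (opval W (sc (RtoC h) x)) <= nrm W * (h * (e / (nrm W + 1)))).
{ eapply Rle_trans; [apply (norm_le_dist XN _ (opval W (opval (F (RtoC 1) h) x)))|].
  rewrite E at 2; rewrite (@norm_zero C_AbsRing XN), Rplus_0_r.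
  rewrite (normdist_sym XN), <- (bop_minus XN).
  eapply Rle_trans; [apply nrm_bound|]; apply Rmult_le_compat_l; [exact HW|exact Hs]. }
rewrite (bop_scalr XN), norm_scal_R in E1 by lra.
apply Rle_trans with (nX (opval W x)).
{ right; exact (f_equal nX (eq_trans (f_equal (plus (opval W x)) (@opp_zero XN)) (plus_zero_r (opval W x)))). }
apply Rmult_le_reg_l with h; [exact Hh|]; eapply Rle_trans; [exact E1|].
replace (nrm W * (h * (e / (nrm W + 1)))) with (h * (e * (nrm W / (nrm W + 1)))) by (field; lra).
apply Rmult_le_compat_l; [lra|].
rewrite <- (Rmult_1_r e) at 2; apply Rmult_le_compat_l; [lra|].
apply Rmult_le_reg_r with (nrm W + 1); [lra|]; unfold Rdiv; rewrite Rmult_assoc, Rinv_l by lra; lra.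
Qed.

Local Notation b := (10 * M / eps).
Local Notation kappa := (/ (4 * b)).
Local Notation B := (power_const M eps).
Local Notation K := (derivative_const M eps).

Lemma extension_alg : exists (S : C -> Alg) (J : Alg),
  (forall z, cone kappa z -> nrm (S z) <= B) /\
  (forall z1 z2, cone kappa z1 -> cone kappa z2 -> S (Cplus z1 z2) = amul (S z1) (S z2)) /\
  (forall z, cone kappa z -> exists D, nrm D <= K / Cmod z /\
     forall z', cone kappa z' -> Cmod z <= 2 * Cmod z' ->
       nrm (S z' - S z - emb (Cminus z' z) * D)%A <=
         256 * K ^ 2 * B * Cmod (Cminus z' z) ^ 2 / Cmod z ^ 2) /\
  (forall t, 0 < t -> S (RtoC t) = Ualg t) /\
  (exists c, forall z, cone kappa z -> nrm ((S z - 1) * J)%A <= Cmod z * c) /\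
  (forall h, 0 <= h -> F (RtoC 1) h = (J * (1 - emb (cexp_neg (RtoC 1) h) * Ualg h))%A).
Proof.
assert (HFs : forall l s t, 0 < Re l -> 0 <= s -> 0 <= t ->
  (emb (cexp_neg l s) * Ualg s * F l t = F l (s + t) - F l s)%A).
{ intros l s t Hl Hs Ht; apply alg_eq; intros x.
  change (sc (cexp_neg l s) (opval (Ualg s) (opval (F l t) x)) = minus (opval (F l (s + t)) x) (opval (F l s) x)).
  rewrite opval_Ualg, !HF by lra; now apply (laplace_shift X T M HT HM1 HM). }
assert (HFb : forall l t, 0 < Re l -> 0 <= t -> nrm (F l t) <= M * t).
{ intros l t Hl Ht; apply nrm_le; [apply Rmult_le_pos; lra|]; intros x; rewrite HF by lra.
  apply (laplace_bound X T M HT HM1 HM); lra. }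
assert (HFb2 : forall l t, 0 < Re l -> 0 <= t -> nrm (F l t) <= M / Re l).
{ intros l t Hl Ht; apply nrm_le; [apply Rlt_le, Rdiv_lt_0_compat; lra|]; intros x; rewrite HF by lra.
  apply (laplace_bound_Re X T M HT HM1 HM); lra. }
assert (HFn : forall l h e (E : Alg), 0 < Re l -> 0 <= h ->
  (forall s, 0 <= s <= h -> nrm ((emb (cexp_neg l s) * Ualg s - 1) * E)%A <= e) ->
  nrm ((F l h - emb (RtoC h)) * E)%A <= h * e).
{ intros l h e E Hl Hh He.
  assert (He0 : 0 <= e) by (eapply Rle_trans; [apply nrm_ge_0|apply (He 0); lra]).
  apply nrm_le; [nra|]; intros x.
  change (dist (opval (F l h) (opval E x)) (sc (RtoC h) (opval E x)) <= h * e * nX x).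
  rewrite HF, Rmult_assoc by lra; apply (laplace_near X T M HT HM1 HM); [exact Hh|]; intros s Hs.
  eapply Rle_trans; [|apply Rmult_le_compat_r; [apply norm_ge_0|exact (He s Hs)]].
  eapply Rle_trans; [|apply nrm_bound].
  rewrite <- (opval_Ualg s) by lra; apply Rle_refl. }
assert (HU0 : Ualg 0 = 1%A).
{ apply alg_eq; intros x; rewrite opval_Ualg by lra; destruct HT as [H0 _]; rewrite H0; reflexivity. }
assert (HUa : forall s t, 0 <= s -> 0 <= t -> Ualg (s + t) = (Ualg s * Ualg t)%A).
{ intros s t Hs Ht; apply alg_eq; intros x.
  change (opval (Ualg (s + t)) x = opval (Ualg s) (opval (Ualg t) x)).
  rewrite !opval_Ualg by lra; now apply (T_add X T HT). }
assert (HUb : forall t, 0 <= t -> nrm (Ualg t) <= M).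
{ intros t Ht; change (opnorm (opval (Ualg t)) <= M); rewrite opval_Ualg by exact Ht; now apply HM. }
assert (HUe : forall t, 0 < t -> nrm (Ualg t - 1)%A <= 2 - eps).
{ intros t Ht; change (opnorm (minus (opval (Ualg t)) (bop_id X)) <= 2 - eps).
  rewrite opval_Ualg by lra; now apply HTeps. }
destruct (resolvent_exists Alg Ualg F M HM1 HUb HFs) as [R0 HR].
destruct (semigroup_extension Alg Ualg F M eps HM1 Heps HU0 HUa HUb HUe HFs HFb HFb2 HFn F_separating R0 HR)
  as [S [H1 [H2 [H3 [H4 H5]]]]].
exists S, (R0 (RtoC 1)); split; [exact H1|split; [exact H2|split; [exact H3|split; [exact H4|split]]]].
- eexists; exact H5.
- intros h Hh; exact (F_factor Alg Ualg F R0 HR h Hh).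
Qed.
End WithIntegral.

Local Notation b := (10 * M / eps).
Local Notation kappa := (/ (4 * b)).
Local Notation B := (power_const M eps).
Local Notation K := (derivative_const M eps).

Lemma operator_extension : exists S : C -> bounded_op X,
  (forall z, cone kappa z -> opnorm (S z) <= B) /\
  (forall z1 z2, cone kappa z1 -> cone kappa z2 -> S (Cplus z1 z2) = bop_comp (S z1) (S z2)) /\
  (forall z, cone kappa z -> exists D : bounded_op X, opnorm D <= K / Cmod z /\
     forall e, 0 < e -> exists d, 0 < d /\ forall z', cone kappa z' -> Cmod (Cminus z' z) < d ->
       opnorm (minus (minus (S z') (S z)) (bop_scal (Cminus z' z) D)) <= e * Cmod (Cminus z' z)) /\
  (forall t, 0 <= t -> S (RtoC t) = T t) /\
  (forall x e, 0 < e -> exists d, 0 < d /\ forall z, cone kappa z -> Cmod z < d ->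
     dist (S z x) x <= e).
Proof.
destruct integral_exists as [F HF].
destruct (extension_alg F HF) as [S [J [H1 [H2 [H3 [H4 [[c H5] H6]]]]]]].
assert (HB : 1 <= B) by (apply power_const_ge; assumption).
(* The point 0 is outside the cone; the default value there is the identity, which is [T 0]. *)
set (S' := fun z => if excluded_middle_informative (cone kappa z) then opval (S z) else bop_id X).
assert (HS : forall z, cone kappa z -> S' z = opval (S z)).
{ intros z Hz; unfold S'; destruct (excluded_middle_informative _); [reflexivity|contradiction]. }
exists S'; split; [|split; [|split; [|split]]].
- intros z Hz; rewrite HS by exact Hz; now apply H1.
- intros z1 z2 Hz1 Hz2; rewrite !HS by auto using cone_add.
  exact (f_equal opval (H2 z1 z2 Hz1 Hz2)).
- intros z Hz; destruct (H3 z Hz) as [D [HD1 HD2]].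
  assert (Hm := cone_Cmod_pos _ _ Hz).
  exists (opval D); split; [exact HD1|]; intros e He.
  set (q := 256 * K ^ 2 * B / Cmod z ^ 2).
  assert (Hq : 0 <= q).
  { unfold q; apply Rmult_le_pos; [|left; apply Rinv_0_lt_compat, pow_lt, Hm].
    pose proof (pow2_ge_0 K); nra. }
  exists (Rmin (Cmod z / 2) (e / (q + 1))); split.
  { apply Rmin_pos; [lra|apply Rdiv_lt_0_compat; lra]. }
  intros z' Hz' Hd.
  assert (Hd1 : Cmod (Cminus z' z) < Cmod z / 2) by (eapply Rlt_le_trans; [exact Hd|apply Rmin_l]).
  assert (Hd2 : Cmod (Cminus z' z) < e / (q + 1)) by (eapply Rlt_le_trans; [exact Hd|apply Rmin_r]).
  set (w := Cminus z' z) in *.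
  assert (Hzz : Cmod z <= Cmod z' + Cmod w).
  { rewrite <- (Cmod_opp w); replace z with (Cplus z' (Copp w)) at 1 by (unfold w; ring).
    apply Cmod_triangle. }
  rewrite !HS by assumption.
  eapply Rle_trans; [exact (HD2 z' Hz' ltac:(lra))|]; fold w.
  replace (256 * K ^ 2 * B * Cmod w ^ 2 / Cmod z ^ 2) with (q * Cmod w * Cmod w) by (unfold q; field; lra).
  apply Rmult_le_compat_r; [apply Cmod_ge_0|].
  apply Rle_trans with (q * (e / (q + 1))); [apply Rmult_le_compat_l; lra|].
  apply Rmult_le_reg_r with (q + 1); [lra|].
  replace (q * (e / (q + 1)) * (q + 1)) with (q * e) by (field; lra); nra.
- intros t [Ht|<-].
  + rewrite HS, H4, opval_Ualg by (lra || (apply cone_real; assumption)); reflexivity.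
  + unfold S'; destruct (excluded_middle_informative _) as [[Hc _]|_].
    * simpl in Hc; lra.
    * destruct HT as [H0 _]; symmetry; exact H0.
- intros x e He.
  (* [h x] is replaced by [y = F 1 h x], in the range of [J], where [S z - 1] is of order [|z|]. The
     replacement costs [(B + 1) h g], and [g] is chosen to make this at most [h e / 2]. *)
  set (g := e / (2 * (B + 2))); assert (Hg : 0 < g) by (apply Rdiv_lt_0_compat; lra).
  destruct (F_strong (RtoC 1) x g Re_one Hg) as [d0 [Hd0 Hs]].
  set (h := d0 / 2); assert (Hh : 0 < h < d0) by (unfold h; lra).
  specialize (Hs h Hh); rewrite <- HF in Hs by (apply Re_one || lra).
  set (y := opval (F (RtoC 1) h) x) in *.
  set (w := opval (1 - emb (cexp_neg (RtoC 1) h) * Ualg h)%A x).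
  assert (Ey : y = opval J w).
  { exact (f_equal (fun Z : Alg => opval Z x) (H6 h ltac:(lra))). }
  set (p := Rabs c * nX w + 1).
  assert (Hp : 0 < p).
  { unfold p; pose proof (Rabs_pos c); pose proof (@norm_ge_0 C_AbsRing XN w); nra. }
  exists (h * e / (2 * p)); split; [apply Rdiv_lt_0_compat; nra|]; intros z Hz Hzd.
  rewrite HS by exact Hz.
  assert (HSy : dist (opval (S z) y) y <= h * (e / 2)).
  { rewrite Ey.
    apply Rle_trans with (Cmod z * c * nX w).
    - eapply Rle_trans; [exact (nrm_bound ((S z - 1) * J)%A w)|].
      apply Rmult_le_compat_r; [apply norm_ge_0|now apply H5].
    - apply Rle_trans with (Cmod z * p).
      + rewrite Rmult_assoc; apply Rmult_le_compat_l; [apply Cmod_ge_0|].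
        unfold p; pose proof (Rle_abs c); pose proof (@norm_ge_0 C_AbsRing XN w); nra.
      + apply Rle_trans with (h * e / (2 * p) * p); [apply Rmult_le_compat_r; lra|right; field; lra]. }
  assert (HSx : nX (opval (S z) (minus (sc (RtoC h) x) y)) <= B * (h * g)).
  { eapply Rle_trans; [apply nrm_bound|].
    apply Rmult_le_compat; [apply nrm_ge_0|apply norm_ge_0|now apply H1|].
    rewrite (normdist_sym XN); exact Hs. }
  apply Rmult_le_reg_l with h; [lra|].
  rewrite <- norm_scal_R by lra.
  apply Rle_trans with (dist (opval (S z) (sc (RtoC h) x)) (sc (RtoC h) x)).
  { right; f_equal; rewrite (bop_scalr XN); unfold minus.
    exact (eq_trans (@scal_distr_l C_Ring XN (RtoC h) (opval (S z) x) (opp x))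
      (f_equal (plus _) (@scal_opp_r C_Ring XN (RtoC h) x))). }
  eapply Rle_trans; [apply (normdist_triangle XN _ (opval (S z) y))|].
  rewrite <- (bop_minus XN).
  eapply Rle_trans; [apply Rplus_le_compat; [exact HSx|apply (normdist_triangle XN _ y)]|].
  apply Rle_trans with (B * (h * g) + (h * (e / 2) + h * g)).
  + apply Rplus_le_compat_l, Rplus_le_compat; assumption.
  + unfold g; replace (B * (h * (e / (2 * (B + 2)))) + (h * (e / 2) + h * (e / (2 * (B + 2)))))
      with (h * e * ((B + 1) / (2 * (B + 2)) + / 2)) by (field; lra).
    rewrite <- (Rmult_1_r (h * e)) at 2; apply Rmult_le_compat_l; [nra|].
    assert ((B + 1) / (2 * (B + 2)) <= / 2); [|lra].
    apply Rmult_le_reg_r with (2 * (B + 2)); [lra|].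
    replace ((B + 1) / (2 * (B + 2)) * (2 * (B + 2))) with (B + 1) by (field; lra); lra.
Qed.
End Instance.

(** * Sectors and constants *)

Lemma Rabs_sin_le x : Rabs x <= / 2 -> Rabs (sin x) <= Rabs x.
Proof.
assert (H : forall y, 0 <= y <= / 2 -> 0 <= sin y <= y).
{ intros y Hy; pose proof PI2_3_2; split; [apply sin_ge_0; lra|].
  destruct (proj1 Hy) as [H0 | <-]; [left; now apply sin_lt_x|rewrite sin_0; lra]. }
intros Hx; destruct (Rcase_abs x) as [Hn|Hp].
- rewrite (Rabs_left x) in * by exact Hn.
  specialize (H (- x) ltac:(lra)); rewrite sin_neg in H; rewrite Rabs_left1; lra.
- rewrite (Rabs_right x) in * by exact Hp.
  specialize (H x ltac:(lra)); rewrite Rabs_pos_eq; lra.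
Qed.

Lemma cos_ge_half x : Rabs x <= / 2 -> / 2 <= cos x.
Proof.
intros Hx; replace x with (2 * (x / 2)) by field; rewrite cos_2a_sin.
assert (H : Rabs (sin (x / 2)) <= / 4).
{ assert (E : Rabs (x / 2) = Rabs x / 2) by (unfold Rdiv; rewrite Rabs_mult, (Rabs_pos_eq (/ 2)); lra).
  eapply Rle_trans; [apply Rabs_sin_le|]; lra. }
apply Rabs_le_between in H; nra.
Qed.

Lemma is_arg_components z phi : is_arg z phi -> Rabs phi <= / 2 ->
  0 < Cmod z /\ Cmod z / 2 <= Re z /\ Rabs (Im z) <= Cmod z * Rabs phi.
Proof.
intros [Hz [_ E]] Hp; assert (Hm : 0 < Cmod z) by now apply Cmod_gt_0.
assert (HR : Re z = Cmod z * cos phi) by (rewrite E at 1; reflexivity).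
assert (HI : Im z = Cmod z * sin phi) by (rewrite E at 1; reflexivity).
pose proof (cos_ge_half phi Hp); pose proof (Rabs_sin_le phi Hp).
split; [exact Hm|split; [rewrite HR; nra|]].
rewrite HI, Rabs_mult, (Rabs_pos_eq (Cmod z)) by lra; apply Rmult_le_compat_l; lra.
Qed.

(** Half of the opening is lost to the crude bound [Re z >= |z| / 2]. *)
Lemma is_arg_cone k z phi : is_arg z phi -> Rabs phi <= / 2 -> Rabs phi <= k / 2 -> cone k z.
Proof.
intros Ha H1 H2; destruct (is_arg_components z phi Ha H1) as [Hm [HR HI]].
split; [lra|]; pose proof (Rabs_pos phi).
apply Rle_trans with (Cmod z * (k / 2)); [|nra].
eapply Rle_trans; [exact HI|apply Rmult_le_compat_l; lra].
Qed.

Lemma is_arg_cone_nbhd k z phi : k <= 1 -> is_arg z phi -> Rabs phi <= / 2 -> Rabs phi < k / 2 ->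
  exists d, 0 < d /\ forall z', Cmod (Cminus z' z) < d -> cone k z'.
Proof.
intros Hk Ha H1 H2; destruct (is_arg_components z phi Ha H1) as [Hm [HR HI]].
assert (Hp := Rabs_pos phi).
assert (Hstrict : Rabs (Im z) < k * Re z).
{ apply Rle_lt_trans with (Cmod z * Rabs phi); [exact HI|].
  apply Rlt_le_trans with (Cmod z * (k / 2)); [apply Rmult_lt_compat_l; lra|nra]. }
(* A displacement of size [d] changes [|Im z|] and [k Re z] by at most [d] each, as [k <= 1]. *)
exists ((k * Re z - Rabs (Im z)) / 2); split; [lra|].
intros z' Hd; set (w := Cminus z' z) in *.
assert (ER : Re z' = Re z + Re w) by (unfold w, Re, Cminus, Cplus, Copp; simpl; ring).
assert (EI : Im z' = Im z + Im w) by (unfold w, Im, Cminus, Cplus, Copp; simpl; ring).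
pose proof (Rmax_Cmod w) as Hw.
assert (HwR : Rabs (Re w) <= Cmod w) by (eapply Rle_trans; [apply Rmax_l|exact Hw]).
assert (HwI : Rabs (Im w) <= Cmod w) by (eapply Rle_trans; [apply Rmax_r|exact Hw]).
apply Rabs_le_between in HwR.
pose proof (Rabs_triang (Im z) (Im w)); pose proof (Rabs_pos (Im z)).
split; [rewrite ER; nra|rewrite ER, EI; nra].
Qed.

Lemma ln_2_le : ln 2 <= 4 / 5.
Proof.
rewrite <- (ln_exp (4 / 5)); apply ln_le; [lra|].
(* [(1 + 1/5)^4 = 2.0736] exceeds 2. *)
pose proof (exp_ineq1_le (/ 5)) as H.
replace (4 / 5) with (/ 5 + / 5 + (/ 5 + / 5)) by field; rewrite !exp_plus.
set (x := exp (/ 5)) in *.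
assert (1.44 <= x * x) by nra; nra.
Qed.

(** The logarithm may be negative, but [M / eps >= 1/2] keeps it above [- ln 2]. A bound without
    logarithm thus implies the stated one after multiplying its constant by 5. *)
Lemma one_plus_ln_ge M eps : 1 <= M -> 0 < eps <= 2 -> / 5 <= 1 + ln (M / eps).
Proof.
intros HM He; pose proof ln_2_le.
assert (Hh : / 2 <= M / eps).
{ apply Rmult_le_reg_r with eps; [lra|]; replace (M / eps * eps) with M by (field; lra); lra. }
assert (H1 : ln (/ 2) <= ln (M / eps)) by (apply ln_le; lra).
rewrite ln_Rinv in H1 by lra; lra.
Qed.

Lemma power_const_le M eps : 1 <= M -> 0 < eps <= 2 -> power_const M eps <= 1152 * (M ^ 2 / eps).
Proof.
intros HM He.
assert (H1 : 1 <= 2 * M / eps).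
{ apply Rmult_le_reg_r with eps; [lra|]; replace (2 * M / eps * eps) with (2 * M) by (field; lra); lra. }
unfold power_const; replace (1152 * (M ^ 2 / eps)) with (32 * (3 * M) * (12 * M / eps)) by (field; lra).
apply Rmult_le_compat; [nra| |nra|].
- replace (10 * M / eps) with (5 * (2 * M / eps)) by (field; lra); lra.
- replace (12 * M / eps) with (2 * M / eps + 10 * M / eps) by (field; lra); lra.
Qed.

Lemma derivative_const_le M eps : 1 <= M -> 0 < eps <= 2 -> derivative_const M eps <= 50688 * (M ^ 4 / eps ^ 2).
Proof.
intros HM He.
assert (H1 : 1 <= 2 * M / eps).
{ apply Rmult_le_reg_r with eps; [lra|]; replace (2 * M / eps * eps) with (2 * M) by (field; lra); lra. }
assert (Hb : 10 * M / eps = 5 * (2 * M / eps)) by (field; lra).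
apply Rle_trans with (64 * (3 * M) * (12 * M / eps) * (22 * M / eps)).
- unfold derivative_const; apply Rmult_le_compat; [|lra| |].
  + apply Rmult_le_pos; nra.
  + apply Rmult_le_compat; [nra|lra|nra|].
    replace (12 * M / eps) with (2 * M / eps + 10 * M / eps) by (field; lra); lra.
  + replace (22 * M / eps) with (2 * M / eps + 2 * (10 * M / eps)) by (field; lra); lra.
(* The estimate obtained is of order [M^3 / eps^2]; one power of [M] is given away. *)
- replace (64 * (3 * M) * (12 * M / eps) * (22 * M / eps)) with (50688 * (M ^ 3 / eps ^ 2)) by (field; lra).
  apply Rmult_le_compat_l; [lra|].
  apply Rmult_le_compat_r; [left; apply Rinv_0_lt_compat, pow_lt; lra|].
  apply Rle_pow; [exact HM|auto].
Qed.

Lemma le_mul_log x c M eps : 1 <= M -> 0 < eps <= 2 -> 0 <= c -> x <= c ->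
  x <= 5 * c * (1 + ln (M / eps)).
Proof. intros HM He Hc Hx; pose proof (one_plus_ln_ge M eps HM He); nra. Qed.

Theorem corollary3p18 :
  exists c1 c2 c3 c4 c5 : R,
    0 < c1 /\ 0 < c2 /\ 0 < c3 /\ 0 < c4 /\ 0 < c5 /\
    forall (X : CompleteNormedModule C_AbsRing) (T : R -> bounded_op X) (M eps : R),
      is_C0_semigroup T ->
      1 <= M ->
      (forall t : R, 0 <= t -> norm (T t) <= M) ->
      0 < eps <= 2 ->
      (forall t : R, 0 < t -> norm (minus (T t) (bop_id X)) <= 2 - eps) ->
      let Ct := M ^ 2 / eps in
      (exists (theta : R) (S : C -> bounded_op X),
         c1 / Ct <= theta <= c2 / Ct /\
         is_bounded_holomorphic_semigroup theta S /\
         (forall t : R, 0 <= t -> S (RtoC t) = T t) /\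
         (forall (z : C) (phi : R), is_arg z phi -> Rabs phi <= c3 / Ct ->
            sector theta z /\
            norm (S z) <= c4 * (M ^ 2 / eps) * (1 + ln (M / eps)))) /\
      (forall t : R, 0 < t ->
         exists T' : bounded_op X,
           @is_derive R_AbsRing (restr_R (bop_NormedModule X)) T t T' /\
           norm (scal (RtoC t) T') <= c5 * (M ^ 4 / eps ^ 2) * (1 + ln (M / eps))).
Proof.
(* The angle is exactly [1 / (160 Ct)], so [c1 = c2]. The cone has [k = eps / (40 M)], angles up to
   [k / 2] lie in it, and a further factor 2 makes [theta < k / 2] strict; halving once more puts
   the closed sector of [c3] inside the open one. *)
exists (/ 160), (/ 160), (/ 320), (5 * 1152), (5 * 50688).
split; [lra|split; [lra|split; [lra|split; [lra|split; [lra|]]]]].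
intros X T M eps HT HM HTM He HTe Ct.
destruct (operator_extension X T M eps HT HM HTM He HTe) as [S [H1 [H2 [H3 [H4 H5]]]]].
set (k := / (4 * (10 * M / eps))) in *.
assert (HMe : 1 <= M / eps * 2).
{ apply Rmult_le_reg_r with eps; [lra|]; replace (M / eps * 2 * eps) with (2 * M) by (field; lra); lra. }
assert (HCt : M / eps <= Ct).
{ unfold Ct, Rdiv; apply Rmult_le_compat_r; [left; apply Rinv_0_lt_compat; lra|nra]. }
assert (Ek : k = / 40 / (M / eps)) by (unfold k; field; lra).
set (theta := / 160 / Ct).
assert (Hth : 0 < theta) by (apply Rdiv_lt_0_compat; lra).
assert (Hthk : theta < k / 2).
{ apply Rle_lt_trans with (/ 160 / (M / eps)).
  - apply Rmult_le_compat_l; [lra|]; apply Rinv_le_contravar; lra.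
  - rewrite Ek; replace (/ 40 / (M / eps) / 2) with (/ 80 / (M / eps)) by (field; lra).
    apply Rmult_lt_compat_r; [apply Rinv_0_lt_compat|]; lra. }
assert (Hk : k <= / 20).
{ rewrite Ek; apply Rmult_le_reg_r with (M / eps); [lra|].
  replace (/ 40 / (M / eps) * (M / eps)) with (/ 40) by (field; lra); lra. }
assert (Hsec : forall z, sector theta z -> cone k z).
{ intros z [phi [Hz Hp]]; apply (is_arg_cone k z phi); [exact Hz|lra|lra]. }
assert (HB0 : 0 <= M ^ 2 / eps) by (fold Ct; lra).
assert (HK0 : 0 <= M ^ 4 / eps ^ 2).
{ left; apply Rdiv_lt_0_compat; apply pow_lt; lra. }
split.
- exists theta, S; split; [split; apply Rle_refl|split; [|split; [exact H4|]]].
  + split; [pose proof PI2_3_2; lra|split; [auto|split; [|split]]].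
    * intros z [phi [Hz Hp]].
      destruct (is_arg_cone_nbhd k z phi ltac:(lra) Hz ltac:(lra) ltac:(lra)) as [d0 [Hd0 Hn]].
      assert (Hc : cone k z) by (apply Hsec; now exists phi).
      destruct (H3 z Hc) as [D [_ HD]].
      exists D; split; [apply is_linear_scal_l|].
      intros z0 Hz0; apply (@is_filter_lim_locally_unique C_AbsRing (AbsRing_NormedModule C_AbsRing)) in Hz0; subst z0.
      intros e; destruct (HD e (cond_pos e)) as [d [Hd HDd]].
      assert (Hdd : 0 < Rmin d0 d) by now apply Rmin_pos.
      exists (mkposreal _ Hdd); intros z' Hz'.
      assert (Hb : Cmod (Cminus z' z) < Rmin d0 d) by exact Hz'.
      apply (HDd z').
      -- apply Hn; eapply Rlt_le_trans; [exact Hb|apply Rmin_l].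
      -- eapply Rlt_le_trans; [exact Hb|apply Rmin_r].
    * intros delta' x Hd'; apply filterlim_locally; intros e.
      destruct (H5 x (e / 2)) as [d [Hd HS]]; [pose proof (cond_pos e); lra|].
      (* The neighbourhood of 0 is taken componentwise here; [d / 2] on each component gives
         [|z| < d]. *)
      assert (Hd2 : 0 < d / 2) by lra.
      exists (mkposreal _ Hd2); intros z Hz Hcs.
      apply (@norm_compat1 C_AbsRing X).
      destruct Hcs as [-> | [phi [Ha Hp]]].
      { rewrite H4 by lra; destruct HT as [H0 _]; rewrite H0.
        apply Rle_lt_trans with 0; [right|apply cond_pos].
        exact (eq_trans (f_equal (@norm C_AbsRing X) (minus_eq_zero (x : X))) (@norm_zero C_AbsRing X)). }
      eapply Rle_lt_trans; [apply HS|pose proof (cond_pos e); lra].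
      -- apply Hsec; exists phi; split; [exact Ha|lra].
      -- assert (Hz2 : Rabs (Re z) < d / 2 /\ Rabs (Im z) < d / 2).
         { destruct Hz as [Hz1 Hz2]; revert Hz1 Hz2.
           unfold ball; simpl; unfold AbsRing_ball, abs, minus, plus, opp; simpl.
           rewrite Ropp_0, !Rplus_0_r; auto. }
         eapply Rle_lt_trans; [apply Cmod_Re_Im_le|lra].
    * intros delta' Hd'; exists (Rmax (power_const M eps) (opnorm (S (RtoC 0)))); intros z [-> | [phi [Ha Hp]]].
      -- apply Rmax_r.
      -- eapply Rle_trans; [|apply Rmax_l]; apply H1, Hsec; exists phi; split; [exact Ha|lra].
  + intros z phi Ha Hp.
    assert (Hp2 : Rabs phi < theta).
    { eapply Rle_lt_trans; [exact Hp|]; unfold theta, Rdiv; apply Rmult_lt_compat_r; [apply Rinv_0_lt_compat; lra|lra]. }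
    assert (Hs : sector theta z) by (exists phi; auto).
    split; [exact Hs|].
    eapply Rle_trans; [apply H1, Hsec, Hs|].
    rewrite (Rmult_assoc 5); apply le_mul_log; [exact HM|exact He|nra|now apply power_const_le].
- intros t Ht.
  assert (Hc : forall s, 0 < s -> cone k (RtoC s)).
  { intros s Hs; split; unfold Re, Im, RtoC; simpl; [exact Hs|rewrite Rabs_R0; nra]. }
  destruct (H3 (RtoC t) (Hc t Ht)) as [D [HD1 HD2]].
  rewrite Cmod_R, Rabs_pos_eq in HD1 by lra.
  exists D; split.
  + split; [apply is_linear_scal_l|].
    intros t0 Ht0; apply (@is_filter_lim_locally_unique R_AbsRing (AbsRing_NormedModule R_AbsRing)) in Ht0; subst t0.
    intros e; destruct (HD2 e (cond_pos e)) as [d [Hd HDd]].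
    (* The minimum with [t] keeps [s] positive, where [S] and [T] agree. *)
    assert (Hdd : 0 < Rmin t d) by now apply Rmin_pos.
    exists (mkposreal _ Hdd); intros s Hs.
    assert (Hb : Rabs (s - t) < Rmin t d) by exact Hs.
    assert (Hst : Rabs (s - t) < t) by (eapply Rlt_le_trans; [exact Hb|apply Rmin_l]).
    assert (Hsd : Rabs (s - t) < d) by (eapply Rlt_le_trans; [exact Hb|apply Rmin_r]).
    apply Rabs_def2 in Hst.
    specialize (HDd (RtoC s) (Hc s ltac:(lra))).
    rewrite !H4, <- RtoC_minus, Cmod_R in HDd by lra.
    exact (HDd Hsd).
  + rewrite (Rmult_assoc 5); apply le_mul_log; [exact HM|exact He|nra|].
    eapply Rle_trans; [exact (opnorm_scal (RtoC t) D)|].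
    rewrite Cmod_R, Rabs_pos_eq by lra.
    apply Rle_trans with (t * (derivative_const M eps / t)); [apply Rmult_le_compat_l; lra|].
    replace (t * (derivative_const M eps / t)) with (derivative_const M eps) by (field; lra); now apply derivative_const_le.
Qed.
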